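(* Let $E \subset \mathbb{C}$ be a compact set with $\operatorname{cap}(E) > 0$. Let $C_E$ be the smallest constant $C>0$ such that $$\|q\|_E \le C^n \,\|p\|_E, \qquad n=\deg p,$$ holds for every monic polynomial $p$ with complex coefficients and every monic factor $q$ of $p$ (i.e. $p = q r$ with $q, r$ monic complex polynomials). Then $$C_E = \frac{\displaystyle\max_{u \in \partial E} \exp\left( \int_{|z-u| \ge 1} \log |z-u| \, d \mu_E (z)\right)}{\operatorname{cap} (E)}.$$ Furthermore, if $E$ is regular, then $$C_E = \max_{u \in \partial E} \exp\left( -\int_{|z-u| \le 1} \log |z-u| \, d\mu_E (z)\right).$$
   Context: For a compact set $E\subset\mathbb{C}$, $\|f\|_E = \sup_{z\in E}|f(z)|$. $\operatorname{cap}(E)$ denotes the logarithmic capacity of $E$, and, when $\operatorname{cap}(E)>0$, $\mu_E$ denotes the equilibrium measure of $E$ (in the sense of logarithmic potential theory), a positive unit Borel measure supported on $E$. A compact set $E$ is called regular if it is regular in the sense of the exterior Dirichlet problem: every boundary point of the unbounded component $\Omega$ of $\overline{\mathbb{C}}\setminus E$ is a regular point for the Dirichlet problem in $\Omega$. *)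

(* Defs.v *)
From HB Require Import structures.
From mathcomp Require Import all_boot all_order all_algebra complex.
From mathcomp Require Import all_classical all_reals all_analysis.

Set Implicit Arguments.
Unset Strict Implicit.
Unset Printing Implicit Defensive.

Import Order.TTheory GRing.Theory Num.Theory numFieldNormedType.Exports.
Local Open Scope classical_set_scope.
Local Open Scope ring_scope.

Definition is_min d (T : porderType d) (A : set T) (m : T) : Prop :=
  A m /\ lbound A m.

Definition is_max d (T : porderType d) (A : set T) (m : T) : Prop :=
  A m /\ ubound A m.

Definition boundary (T : topologicalType) (A : set T) : set T :=
  closure A `\` interior A.

(* The norm of R[i] takes its values in R[i]; this is the same modulus seen as
   an element of R. *)
Definition cabs (R : realType) (z : R[i]) : R := complex.Re `|z|.

(* log |z - w|, equal to -oo when z = w. *)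
Definition log_dist (R : realType) (z w : R[i]) : \bar R :=
  lne (cabs (z - w))%:E.

Definition sup_norm (R : realType) (E : set R[i]^o) (f : R[i] -> R[i]) : R :=
  sup [set cabs (f z) | z in E].

(* For a monic polynomial p, the degree of p is (size p).-1. *)
Definition factor_constants (R : realType) (E : set R[i]^o) : set R :=
  [set C : R | 0 < C /\
    forall p q r : {poly R[i]},
      p \is monic -> q \is monic -> r \is monic -> p = q * r ->
      sup_norm E (horner q) <= C ^+ (size p).-1 * sup_norm E (horner p)].

Section potential_theory.
Variable R : realType.

(* The complex plane with its Borel sigma-algebra. *)
Definition borelC := g_sigma_algebraType (@open R[i]^o).

Definition supported_on (E : set R[i]^o) (mu : probability borelC R) : Prop :=
  mu (~` E) = 0%E.

Definition energy (mu : probability borelC R) : \bar R :=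
  (\int[mu]_z \int[mu]_w (- log_dist z w))%E.

(* Robin's constant; it is +oo when E carries no measure of finite energy, and
   the capacity is then 0. *)
Definition robin_constant (E : set R[i]^o) : \bar R :=
  ereal_inf [set energy mu | mu in supported_on E].

Definition capacity (E : set R[i]^o) : R :=
  fine (expeR (- robin_constant E)%E).

Definition equilibrium_measure (E : set R[i]^o) (mu : probability borelC R) :
  Prop := supported_on E mu /\ energy mu = robin_constant E.

End potential_theory.

Section dirichlet_problem.
Variable R : realType.

Definition riemann_sphere := one_point_compactification R[i]^o.

Definition unit_circle (t : R) : R[i] := Complex (cos t) (sin t).

(* The circle of radius r around x in the standard local coordinate at x: the
   coordinate is the translation z - x at a finite point, and 1 / z at the
   point at infinity None. *)
Definition chart_circle (x : riemann_sphere) (r t : R) : riemann_sphere :=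
  match x with
  | Some z => Some (z + r%:C%C * unit_circle t)
  | None => Some (r%:C%C * unit_circle t)^-1
  end.

Definition circle_mean (u : riemann_sphere -> \bar R) (x : riemann_sphere)
    (r : R) : \bar R :=
  ((2 * pi)^-1%:E *
   \int[lebesgue_measure]_(t in `[0%R, (2 * pi)%R]) u (chart_circle x r t))%E.

(* Subharmonicity on an open subset D of the sphere: values in [-oo, +oo),
   upper semicontinuity and the local submean inequality. The function
   identically equal to -oo is allowed. *)
Definition subharmonic (D : set riemann_sphere) (u : riemann_sphere -> \bar R) :
    Prop :=
  forall x, D x ->
    [/\ (u x < +oo)%E,
        forall a : R, (u x < a%:E)%E -> \forall y \near x, (u y < a%:E)%E
      & exists2 rho : R, 0 < rho &
          forall r : R, 0 < r -> r < rho -> (u x <= circle_mean u x r)%E].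

Definition perron_family (D : set riemann_sphere) (phi : riemann_sphere -> R) :
    set (riemann_sphere -> \bar R) :=
  [set u | subharmonic D u /\
    forall xi, boundary D xi ->
      (limf_esup u (within D (nbhs xi)) <= (phi xi)%:E)%E].

Definition perron_solution (D : set riemann_sphere)
    (phi : riemann_sphere -> R) (x : riemann_sphere) : \bar R :=
  ereal_sup [set u x | u in perron_family D phi].

(* Only the restriction of phi to the boundary of D matters. *)
Definition regular_boundary_point (D : set riemann_sphere)
    (zeta : riemann_sphere) : Prop :=
  forall phi : riemann_sphere -> R,
    {within boundary D, continuous phi} ->
    perron_solution D phi x @[x --> within D (nbhs zeta)] --> (phi zeta)%:E.

(* The unbounded component of the complement of E in the sphere, i.e. the one
   which contains the point at infinity. *)
Definition outer_domain (E : set R[i]^o) : set riemann_sphere :=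
  connected_component (~` [set (Some z : riemann_sphere) | z in E]) None.

Definition regular_compact (E : set R[i]^o) : Prop :=
  forall zeta, boundary (outer_domain E) zeta ->
    regular_boundary_point (outer_domain E) zeta.

End dirichlet_problem.

(* Main.v *)
(** Write lgr r z w = ln max(r, |z - w|), n = deg p, and let V be Robin's
    constant, so that cap E = e^-V.

    Upper bound.  On a compact set K of full mu-measure the potential of mu is at
    most V; a maximum principle extends this to the plane (Frostman) and yields
    |p(z)| <= ||p||_E exp(n (V + int ln|z - w| dmu(w))) (Bernstein-Walsh).  Taking
    means over circles around u, where ln|z - a| has mean lgr r a u, gives
    prod_{p(a) = 0} max(1, |a - u|) <= ||p||_E exp(n (V + int lgr 1 u dmu)).  The
    left-hand side bounds |q(u)| for every monic factor q of p, and ||q||_E is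
    attained on the boundary of E.

    Lower bound.  There are monic p with zeros in E and ||p||_E <= exp(n (-V + eps))
    such that the mean of lgr 1 u over the zeros is almost its mu-integral: drop one
    point from a near-maximiser of prod |z_i - z_j| * prod exp(t h(z_i)), where
    h = lgr 1 u.  Points drawn from mu bound the maximum from below, and the
    inequality between the transfinite diameter and the capacity bounds the
    Vandermonde factor from above.  For q take the zeros at distance at least 1
    from u.

    Regular case.  What is needed is that the potential of mu takes the value V at
    u.  A Perron solution whose boundary values stay below the potential of the
    part of mu far from u gives |p| <= ||p||_E e^(eta n) in a neighbourhood of u
    which does not depend on p; applied to the polynomials of the lower bound and
    averaged over small circles this forces int ln|z - u| dmu <= -V. *)

Require Import Defs.
From HB Require Import structures.
From mathcomp Require Import all_boot all_order all_algebra complex.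
From mathcomp Require Import all_classical all_reals all_analysis.
From mathcomp Require Import measurable_realfun.
From mathcomp Require Import ring lra zify.

Set Implicit Arguments.
Unset Strict Implicit.
Unset Printing Implicit Defensive.

Import Order.TTheory GRing.Theory Num.Theory numFieldNormedType.Exports.
Local Open Scope classical_set_scope.
Local Open Scope ring_scope.

(** Two obstacles shape the proof. First, mu is any minimiser of the energy. Since its uniqueness is
    not established, nothing would tell that the counting measures of plain Fekete points approach
    mu. The tilt exp(t h) takes over this task. If e is the error in the transfinite diameter, the
    two bounds on the tilted maximum give a mean of h of at least int h dmu - O(e/t), up to terms
    that vanish as n grows, while the tilt spoils the bound on E by a factor exp(O(t) n) only. Hence
    t is fixed small first, and e small against t.

    Second, the comparisons take place on unbounded domains. The natural exponent 1/n leaves a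
    finite limit at infinity that would have to be controlled. An exponent a with a n < 1 drives the
    comparison function to -oo there, and the loss is recovered at the end. Exceptional sets of
    capacity zero never occur: Frostman's bound is arranged to hold at every point of the carrier K,
    so the maximum principle needs no exceptional boundary points. *)

(** * Modulus and topology of the plane *)

Section modulus.
Context {R : realType}.
Implicit Types (x y z w : R[i]) (r s : R).

Lemma normC_cabs z : `|z| = (cabs z)%:C%C.
Proof. by rewrite /cabs normc_def. Qed.

Lemma cabs_ge0 z : 0 <= cabs z.
Proof. by rewrite /cabs normc_def /= sqrtr_ge0. Qed.

Lemma cabsM z w : cabs (z * w) = cabs z * cabs w.
Proof. by apply: (@complexI R); rewrite rmorphM /= -!normC_cabs normrM. Qed.

Lemma cabsD z w : cabs (z + w) <= cabs z + cabs w.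
Proof. by rewrite -lecR rmorphD /= -!normC_cabs ler_normD. Qed.

Lemma cabsN z : cabs (- z) = cabs z.
Proof. by rewrite /cabs normrN. Qed.

Lemma cabsC z w : cabs (z - w) = cabs (w - z).
Proof. by rewrite -opprB cabsN. Qed.

Lemma cabs0 : cabs (0 : R[i]) = 0.
Proof. by rewrite /cabs normr0. Qed.

Lemma cabs1 : cabs (1 : R[i]) = 1.
Proof. by rewrite /cabs normr1. Qed.

Lemma cabs_eq0 z : (cabs z == 0) = (z == 0).
Proof. by rewrite -[RHS]normr_eq0 normC_cabs -(inj_eq (@complexI R)). Qed.

Lemma cabs_gt0 z : (0 < cabs z) = (z != 0).
Proof. by rewrite lt_def cabs_ge0 andbT cabs_eq0. Qed.

Lemma cabsX z n : cabs (z ^+ n) = cabs z ^+ n.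
Proof. by elim: n => [|n IH]; rewrite ?expr0 ?cabs1// !exprS cabsM IH. Qed.

Lemma cabs_prod (I : Type) (s : seq I) (P : pred I) (F : I -> R[i]) :
  cabs (\prod_(i <- s | P i) F i) = \prod_(i <- s | P i) cabs (F i).
Proof. by elim/big_rec2: _ => [|i y1 y2 _ <-]; rewrite ?cabs1// cabsM. Qed.

Lemma cabs_real r : cabs r%:C%C = `|r|.
Proof. by rewrite /cabs normc_def /= expr0n addr0 sqrtr_sqr. Qed.

Lemma cabs_sqrE z : cabs z ^+ 2 = complex.Re z ^+ 2 + complex.Im z ^+ 2.
Proof. by rewrite /cabs normc_def /= sqr_sqrtr// addr_ge0 ?sqr_ge0. Qed.

Lemma cabs_dist z w : `|cabs z - cabs w| <= cabs (z - w).
Proof.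
have H x y : cabs x - cabs y <= cabs (x - y) by rewrite lerBlDr -{1}(subrK y x) cabsD.
by rewrite ler_norml lerNl opprB H cabsC H.
Qed.

Lemma cabs_triangle x y z : cabs (x - z) <= cabs (x - y) + cabs (y - z).
Proof. by apply: le_trans (cabsD _ _); rewrite addrA subrK. Qed.

Lemma Re_le_cabs z : `|complex.Re z| <= cabs z.
Proof.
rewrite -(@ler_pXn2r _ 2) ?nnegrE ?cabs_ge0// cabs_sqrE real_normK ?num_real//.
by rewrite lerDl sqr_ge0.
Qed.

Lemma Im_le_cabs z : `|complex.Im z| <= cabs z.
Proof.
rewrite -(@ler_pXn2r _ 2) ?nnegrE ?cabs_ge0// cabs_sqrE real_normK ?num_real//.
by rewrite lerDr sqr_ge0.
Qed.

Lemma cabs_le_ReIm z : cabs z <= `|complex.Re z| + `|complex.Im z|.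
Proof.
rewrite -(@ler_pXn2r _ 2) ?nnegrE ?cabs_ge0 ?addr_ge0//.
rewrite cabs_sqrE sqrrD !real_normK ?num_real// addrAC lerDl.
by rewrite mulrn_wge0// mulr_ge0.
Qed.

Lemma nbhsCP (z : R[i]^o) (P : set R[i]^o) :
  nbhs z P <-> exists2 r : R, 0 < r & forall y, cabs (y - z) < r -> P y.
Proof.
split=> [/nbhs_ballP[e /= e0 eP]|[r r0 rP]].
  have eE : e = (complex.Re e)%:C%C.
    by have := ger0_Im (ltW e0); case: (e) => a b /= ->.
  exists (complex.Re e) => [|y yz]; first by rewrite -ltcR -eE.
  by apply: eP; rewrite -ball_normE /= distrC normC_cabs eE ltcR.
apply/nbhs_ballP; exists r%:C%C; first by rewrite /= ltcR.
by move=> y; rewrite -ball_normE /= distrC normC_cabs ltcR => /rP.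
Qed.

End modulus.

Lemma usc_attains_max (R : realType) (T : topologicalType) (A : set T) (f : T -> R) :
  compact A -> A !=set0 ->
  (forall x a, A x -> f x < a -> \forall y \near x, f y < a) ->
  exists2 x, A x & forall y, A y -> f y <= f x.
Proof.
move=> cA A0 uscf; apply: contrapT => noMax.
have gtr x : A x -> exists2 y, A y & f x < f y.
  move=> Ax; apply: contrapT => H; apply: noMax; exists x => // y Ay.
  by rewrite leNgt; apply/negP => fxy; apply: H; exists y.
(* The superlevel sets generate a proper filter. At a cluster point p some y has [f p < f y], and
   semicontinuity separates p from the superlevel set of y. *)
pose F := filter_from A (fun y => [set x | A x /\ f y <= f x]).
have FF : ProperFilter F.
  apply: filter_from_proper; last by move=> y Ay; exists y.
  apply: filter_from_filter => // y1 y2 A1 A2.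
  have [le12|/ltW le21] := leP (f y1) (f y2).
    by exists y2 => // x [Ax h]; split; split => //; apply: le_trans h.
  by exists y1 => // x [Ax h]; split; split => //; apply: le_trans h.
have [|p [Ap clp]] := cA F.
  by case: A0 => a Aa; exists a => // x [].
have [y Ay fpy] := gtr p Ap.
have [||x [[_ h1] /= h2]] := clp [set x | A x /\ f y <= f x] [set x | f x < f y].
- by exists y.
- exact: uscf.
by move: h2; rewrite ltNge h1.
Qed.

Section plane_topology.
Context {R : realType}.

Lemma continuous_cabs_sub (w : R[i]) : continuous (fun z : R[i]^o => cabs (z - w) : R).
Proof.
move=> z P /nbhs_ballP[e /= e0 eP]; apply/nbhsCP; exists e => // y yz.
apply: eP; rewrite -ball_normE /=; apply: le_lt_trans (cabs_dist _ _) _.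
by rewrite opprB addrA subrK cabsC.
Qed.

Lemma near_cabs_lt (w z : R[i]) (a : R) : cabs (z - w) < a ->
  \forall y \near (z : R[i]^o), cabs (y - w) < a.
Proof.
move=> za; apply/nbhsCP; exists (a - cabs (z - w)); first by rewrite subr_gt0.
by move=> y yz; apply: le_lt_trans (cabs_triangle _ z _) _; rewrite -ltrBrDr.
Qed.

Lemma continuous_mkComplex : continuous (fun p : R * R => Complex p.1 p.2 : R[i]^o).
Proof.
move=> [a b] P /nbhsCP [r r0 rP].
exists (ball a (r / 2), ball b (r / 2)).
  by split; apply: nbhsx_ballx; rewrite divr_gt0.
move=> [x y] [] /=; rewrite -!ball_normE /= => ax bY.
apply: rP; apply: le_lt_trans (cabs_le_ReIm _) _ => /=.
by rewrite (splitr r) ltrD// distrC.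
Qed.

Lemma compact_disc (M : R) : compact [set z : R[i]^o | cabs z <= M].
Proof.
have cA : compact [set (Complex p.1 p.2 : R[i]^o) | p in `[- M, M] `*` `[- M, M]].
  apply: continuous_compact; last by apply: compact_setX; exact: segment_compact.
  exact/continuous_subspaceT/continuous_mkComplex.
apply: subclosed_compact cA _.
  have -> : [set z : R[i]^o | cabs z <= M] = (fun z : R[i]^o => cabs (z - 0)) @^-1` [set x | x <= M].
    by apply/seteqP; split => z /=; rewrite subr0.
  apply: preimage_closed; last exact: closed_le.
  by move=> z _; exact: continuous_cabs_sub.
move=> z /= zM; exists (complex.Re z, complex.Im z); last by case: z {zM}.
rewrite /= !in_itv /= -!ler_norml; split.
  exact: le_trans (Re_le_cabs z) zM.
exact: le_trans (Im_le_cabs z) zM.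
Qed.

Lemma compact_bounded_cabs (E : set R[i]^o) :
  compact E -> exists2 M : R, 0 < M & forall z, E z -> cabs z <= M.
Proof.
move=> cE; have [->|/set0P E0] := eqVneq E set0; first by exists 1.
have [z Ez h] := @usc_attains_max R _ E (fun z => cabs (z - 0)) cE E0 (fun x a _ ax =>
  near_cabs_lt ax).
exists (cabs z + 1) => [|y /h]; first by rewrite ltr_wpDl ?cabs_ge0.
by rewrite !subr0 => /le_trans; apply; rewrite lerDl.
Qed.

Lemma compact_closedC (E : set R[i]^o) : compact E -> closed E.
Proof. by apply: compact_closed; exact: norm_hausdorff. Qed.

End plane_topology.

(** * Maximum principle and four-point means *)

Section maximum_principle.
Context {R : realType}.

(* Only "not a local maximum of w + eps |.|^2" is required of w, which a submean
   inequality up to an error o(h^2) already gives. *)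
Lemma max_principle (D : set R[i]^o) (w : R[i] -> \bar R) (s : R) :
  (forall z, D z -> (w z < +oo)%E /\ forall a : R, (w z < a%:E)%E ->
     \forall y \near (z : R[i]^o), D y -> (w y < a%:E)%E) ->
  (forall z e t, D z -> 0 < e -> w z = t%:E ->
     ~ \forall y \near (z : R[i]^o),
         D y /\ (w y <= (t + e * (cabs z ^+ 2 - cabs y ^+ 2))%:E)%E) ->
  (forall z s', ~ D z -> s < s' ->
     \forall y \near (z : R[i]^o), D y -> (w y < s'%:E)%E) ->
  (forall s', s < s' -> exists M : R, forall y, D y -> M <= cabs y -> (w y < s'%:E)%E) ->
  (forall z, D z -> \forall y \near (z : R[i]^o), D y) ->
  forall z, D z -> (w z <= s%:E)%E.
Proof.
move=> uscw nomax bdw infw openD z0 Dz0; rewrite leNgt; apply/negP => sw.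
have [wfin _] := uscw _ Dz0.
have [t0 wt0] : exists t, w z0 = t%:E.
  by case: (w z0) sw wfin => // t _ _; exists t.
move: sw; rewrite wt0 lte_fin => st0.
pose s1 := s + (t0 - s) / 3.
have ss1 : s < s1 by rewrite /s1; lra.
have [M0 hM0] := infw _ ss1.
pose M := Num.max M0 (cabs z0) + 1.
have M0M : M0 < M by rewrite /M ltr_pwDr// le_max lexx.
have zM : cabs z0 < M by rewrite /M ltr_pwDr// le_max lexx orbT.
have Mpos : 0 < M by apply: le_lt_trans zM; exact: cabs_ge0.
(* On the disc of radius M the term [e * |z|^2] is at most a third of the gap [t0 - s], so a maximum
   point of the perturbed function still has a value above [s1]. *)
pose e := (t0 - s) / 3 / M ^+ 2.
have e0 : 0 < e by rewrite /e !divr_gt0// ?subr_gt0// exprn_gt0.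
(* Cutting w off at [s1] gives a real function on the whole disc. It is semicontinuous also at
   points off D, because w is eventually below any number above s there. *)
pose g y := if `[< D y >] && (s1%:E < w y)%E then fine (w y) else s1.
have gD y : D y -> (s1%:E < w y)%E -> w y = (g y)%:E.
  move=> Dy sy; rewrite /g sy (asboolT Dy) /=.
  by have [+ _] := uscw _ Dy; case: (w y) sy.
have g_lt y b : s1 < b -> (D y -> (w y < b%:E)%E) -> g y < b.
  move=> sb H; rewrite /g; case: ifPn => // /andP[/asboolP Dy sy].
  by have := H Dy; rewrite (gD _ Dy sy) lte_fin /g sy (asboolT Dy).
have g_ge y : s1 <= g y.
  rewrite /g; case: ifPn => // /andP[/asboolP Dy sy].
  have := sy; rewrite (gD _ Dy sy) lte_fin => /ltW; rewrite /g sy.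
  by rewrite (asboolT Dy).
pose A := [set z : R[i]^o | cabs z <= M].
have [|||z Az zmax] := @usc_attains_max R _ A (fun y => g y + e * cabs y ^+ 2).
- exact: compact_disc.
- by exists z0; exact: ltW.
- move=> x a _ ga.
  have [c [gc ca]] : exists c, g x < c /\ c + e * cabs x ^+ 2 < a.
    exists ((g x + (a - e * cabs x ^+ 2)) / 2); split; lra.
  have near1 : \forall y \near (x : R[i]^o), D y -> (w y < c%:E)%E.
    have sc : s1 < c by apply: le_lt_trans gc.
    have [Dx|nDx] := pselect (D x); last first.
      by apply: bdw => //; apply: lt_trans sc.
    apply: (uscw _ Dx).2.
    have [sx|sx] := ltP s1%:E (w x); first by rewrite (gD _ Dx sx) lte_fin.
    by apply: le_lt_trans sx _; rewrite lte_fin.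
  have near2 : \forall y \near (x : R[i]^o), e * cabs y ^+ 2 < a - c.
    pose b := Num.sqrt ((a - c) / e).
    have ace : cabs x ^+ 2 < (a - c) / e by rewrite ltr_pdivlMr// mulrC; lra.
    have b2 : b ^+ 2 = (a - c) / e.
      by rewrite sqr_sqrtr//; apply: le_trans (ltW ace); exact: sqr_ge0.
    have xb : cabs (x - 0) < b.
      by rewrite subr0 -(@ltr_pXn2r _ 2) ?nnegrE ?cabs_ge0 ?sqrtr_ge0// b2.
    apply: filterS (near_cabs_lt xb) => y; rewrite subr0 => yb.
    rewrite mulrC -ltr_pdivlMr// -b2 ltr_pXn2r ?nnegrE ?cabs_ge0 ?sqrtr_ge0//.
  apply: filterS2 near1 near2 => y h1 h2.
  have : g y < c by apply: g_lt => //; apply: le_lt_trans gc.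
  by move: h2; lra.
have e_M : e * M ^+ 2 = (t0 - s) / 3.
  by rewrite /e mulfVK// expf_neq0// gt_eqF.
have gz0 : g z0 = t0.
  apply/EFin_inj; rewrite -gD// wt0 lte_fin /s1; lra.
have hz := zmax z0 (ltW zM); rewrite gz0 in hz.
have gz_gt : s1 < g z.
  have h1 : e * cabs z ^+ 2 <= e * M ^+ 2.
    by rewrite ler_wpM2l ?(ltW e0)// lerXn2r ?nnegrE ?cabs_ge0// ltW.
  have h2 : 0 <= e * cabs z0 ^+ 2 by rewrite mulr_ge0 ?(ltW e0)// sqr_ge0.
  by move: hz h1 h2; rewrite e_M /s1; lra.
have [Dz sz] : D z /\ (s1%:E < w z)%E.
  by move: gz_gt; rewrite {1}/g; case: ifPn => [/andP[/asboolP]|]; rewrite ?ltxx.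
have ltzM : cabs z < M.
  rewrite ltNge; apply/negP => Mz.
  by have := hM0 _ Dz (le_trans (ltW M0M) Mz); rewrite ltNge (ltW sz).
apply: (nomax z e (g z) Dz e0 (gD _ Dz sz)).
have nearM : \forall y \near (z : R[i]^o), cabs y < M.
  have := @near_cabs_lt R 0 z M; rewrite subr0 => /(_ ltzM).
  by apply: filterS => y; rewrite subr0.
apply: filterS2 nearM (openD _ Dz) => y yM Dy; split=> //.
have h := zmax y (ltW yM).
have [sy|sy] := ltP s1%:E (w y).
  by rewrite (gD _ Dy sy) lee_fin mulrBr; move: h; lra.
apply: le_trans sy _; rewrite lee_fin mulrBr.
by have := g_ge y; move: h; lra.
Qed.

End maximum_principle.

Section four_point.
Context {R : realType}.
Implicit Types (z h : R[i]) (H : R[i] -> R).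

Lemma ln_near1 (x : R) : 1 / 2 <= x -> `|ln x| <= 2 * `|x - 1|.
Proof.
move=> x2; have x0 : 0 < x by lra.
have ub (y : R) : 0 < y -> ln y <= y - 1.
  move=> y0; have := @le_ln1Dx R (y - 1); rewrite (_ : 1 + (y - 1) = y); last ring.
  by apply; lra.
have [x1|x1] := leP 1 x.
  rewrite !ger0_norm ?ln_ge0 ?subr_ge0//; have := ub _ x0; lra.
have lb : - ln x <= x^-1 - 1 by rewrite -lnV ?posrE// ub// invr_gt0.
rewrite ler0_norm; last by rewrite ln_le0// ltW.
rewrite ltr0_norm ?subr_lt0//; apply: le_trans lb _.
have -> : x^-1 - 1 = (1 - x) / x by field; rewrite gt_eqF.
by rewrite ler_pdivrMr//; nra.
Qed.

(* Harmonicity only enters through four-point means: for H = ln|.| they are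
   computed by prod_k (z + i^k h) = z^4 - h^4, whence an error of order |h|^4. *)
Definition sum4 H z h := H (z + h) + H (z - h) + H (z + 'i%C * h) + H (z - 'i%C * h).

Definition four_mean H z := exists2 c : R, 0 <= c &
  exists2 r : R, 0 < r &
    forall h, cabs h < r -> `|sum4 H z h - 4 * H z| <= c * cabs h ^+ 4.

Lemma cabs_i : cabs ('i%C : R[i]) = 1.
Proof. by rewrite /cabs normc_def /= expr0n expr1n add0r sqrtr1. Qed.

Lemma sum4_sqr z h :
  sum4 (fun y => cabs y ^+ 2) z h = 4 * cabs z ^+ 2 + 4 * cabs h ^+ 2.
Proof.
rewrite /sum4 !cabs_sqrE; case: z => a b; case: h => c d /=.
by ring.
Qed.

Lemma cabs_sqr_diff4 z h :
  cabs (z + h) * cabs (z - h) * cabs (z + 'i%C * h) * cabs (z - 'i%C * h) =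
  cabs (z ^+ 4 - h ^+ 4).
Proof.
rewrite -!cabsM; congr cabs.
have i2 : 'i%C * 'i%C = -1 :> R[i] by rewrite -expr2 sqr_i.
transitivity ((z ^+ 2 - h ^+ 2) * (z ^+ 2 - ('i%C * 'i%C) * h ^+ 2)); first by ring.
by rewrite i2; ring.
Qed.

Lemma ln_cabs_four z h : z != 0 -> cabs h <= cabs z / 2 ->
  `|sum4 (fun y => ln (cabs y)) z h - 4 * ln (cabs z)| <=
  2 / cabs z ^+ 4 * cabs h ^+ 4.
Proof.
move=> z0 hz; have cz : 0 < cabs z by rewrite cabs_gt0.
have nz w : cabs w = cabs h -> z + w != 0.
  move=> wh; rewrite -cabs_gt0; have := cabsD (z + w) (- w).
  by rewrite addrK cabsN wh; move: hz; lra.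
have p1 := nz h erefl; have p2 := nz (- h) (cabsN _).
have p3 := nz ('i%C * h); rewrite cabsM cabs_i mul1r in p3; have {}p3 := p3 erefl.
have p4 := nz (- ('i%C * h)); rewrite cabsN cabsM cabs_i mul1r in p4; have {}p4 := p4 erefl.
rewrite /sum4 -!lnM ?posrE ?mulr_gt0 ?cabs_gt0 ?p1 ?p2 ?p3 ?p4// cabs_sqr_diff4.
have -> : 4 * ln (cabs z) = ln (cabs z ^+ 4) by rewrite lnXn// mulr_natl.
have zh : 0 < cabs (z ^+ 4 - h ^+ 4).
  by rewrite -cabs_sqr_diff4 !mulr_gt0 ?cabs_gt0.
rewrite -ln_div; [|by rewrite posrE|by rewrite posrE exprn_gt0].
(* This keeps the quotient of [|z^4 - h^4|] by [|z|^4] above 1/2, within the range of [ln_near1]. *)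
have t4 : cabs h ^+ 4 <= (1 / 16) * cabs z ^+ 4.
  apply: (@le_trans _ _ ((cabs z / 2) ^+ 4)).
    by rewrite lerXn2r ?nnegrE ?cabs_ge0 ?divr_ge0 ?cabs_ge0.
  by rewrite le_eqVlt; apply/orP; left; apply/eqP; field.
have z4 : 0 < cabs z ^+ 4 by rewrite exprn_gt0.
have key : `|cabs (z ^+ 4 - h ^+ 4) - cabs z ^+ 4| <= cabs h ^+ 4.
  rewrite -!cabsX; apply: le_trans (cabs_dist _ _) _.
  by rewrite addrAC subrr add0r cabsN.
apply: le_trans (ln_near1 _) _.
  rewrite ler_pdivlMr//; move: key; rewrite ler_norml => /andP[+ _]; lra.
rewrite -mulrA ler_wpM2l//.
rewrite -[X in `|_ - X|](@divff _ (cabs z ^+ 4)) ?gt_eqF// -mulrBl normrM.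
by rewrite (gtr0_norm (_ : 0 < (cabs z ^+ 4)^-1)) ?invr_gt0// mulrC ler_pM2l// invr_gt0.
Qed.

Lemma four_meanD H1 H2 z : four_mean H1 z -> four_mean H2 z ->
  four_mean (fun y => H1 y + H2 y) z.
Proof.
move=> [c1 c10 [r1 r10 h1]] [c2 c20 [r2 r20 h2]].
exists (c1 + c2); first exact: addr_ge0.
exists (Num.min r1 r2) => [|h]; first by rewrite lt_min r10.
rewrite lt_min => /andP[/h1 {}h1 /h2 {}h2].
rewrite (_ : _ - _ = (sum4 H1 z h - 4 * H1 z) + (sum4 H2 z h - 4 * H2 z)); last first.
  by rewrite /sum4; ring.
by apply: le_trans (ler_normD _ _) _; rewrite [leRHS]mulrDl lerD.
Qed.

Lemma four_meanZ (a : R) H z : four_mean H z -> four_mean (fun y => a * H y) z.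
Proof.
move=> [c c0 [r r0 h]]; exists (`|a| * c); first by rewrite mulr_ge0.
exists r => // k /h {}h.
rewrite (_ : _ - _ = a * (sum4 H z k - 4 * H z)); last by rewrite /sum4; ring.
by rewrite normrM -mulrA ler_wpM2l.
Qed.

Lemma four_mean_cst (a : R) z : four_mean (fun=> a) z.
Proof.
exists 0 => //; exists 1 => // h _.
rewrite (_ : _ - _ = 0); last by rewrite /sum4; ring.
by rewrite normr0 mul0r.
Qed.

Lemma four_mean_ln (a z : R[i]) : z != a -> four_mean (fun y => ln (cabs (y - a))) z.
Proof.
move=> za; have z0 : 0 < cabs (z - a) by rewrite cabs_gt0 subr_eq0.
exists (2 / cabs (z - a) ^+ 4); first by rewrite divr_ge0// exprn_ge0// ltW.
exists (cabs (z - a) / 2); first by rewrite divr_gt0.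
move=> h /ltW hz; rewrite /sum4 !(addrAC z _ (- a)).
by apply: ln_cabs_four => //; rewrite subr_eq0.
Qed.

(** By [sum4_sqr] the term [e |y|^2] has four-point excess [4 e |h|^2], which beats the error
    [c |h|^4] once h is small. *)
Lemma four_mean_no_max H z (e : R) : four_mean H z -> 0 < e ->
  ~ \forall y \near (z : R[i]^o), H y <= H z + e * (cabs z ^+ 2 - cabs y ^+ 2).
Proof.
move=> [c c0 [r r0 hr]] e0 /nbhsCP[r' r'0 hr'].
have c1 : 0 < c + 1 by lra.
pose t := Num.min (Num.min (r / 2) (r' / 2)) (Num.min 1 (e / (c + 1))).
have t0 : 0 < t by rewrite /t !lt_min !divr_gt0 ?ltr01.
have tr : t < r.
  by apply: le_lt_trans (_ : r / 2 < r); [rewrite /t !ge_min lexx|lra].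
have tr' : t < r'.
  by apply: le_lt_trans (_ : r' / 2 < r'); [rewrite /t !ge_min lexx ?orbT|lra].
have t1 : t <= 1 by rewrite /t !ge_min lexx ?orbT.
have te : t * (c + 1) <= e.
  by rewrite -ler_pdivlMr// /t !ge_min lexx ?orbT.
have ch : cabs (t%:C%C) = t by rewrite cabs_real gtr0_norm.
have ci : cabs ('i%C * t%:C%C) = t by rewrite cabsM cabs_i mul1r.
have := hr (t%:C)%C; rewrite ch => /(_ tr); rewrite ler_norml => /andP[+ _].
have n1 := hr' (z + t%:C%C); rewrite addrAC subrr add0r ch in n1.
have n2 := hr' (z - t%:C%C); rewrite addrAC subrr add0r cabsN ch in n2.
have n3 := hr' (z + 'i%C * t%:C%C); rewrite addrAC subrr add0r ci in n3.
have n4 := hr' (z - 'i%C * t%:C%C); rewrite addrAC subrr add0r cabsN ci in n4.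
have {}n1 := n1 tr'; have {}n2 := n2 tr'; have {}n3 := n3 tr'; have {}n4 := n4 tr'.
have s4 := sum4_sqr z (t%:C%C).
rewrite ch /sum4 in s4; rewrite /sum4.
have h1 : c * t ^+ 4 < 4 * e * t ^+ 2.
  have h2 : t ^+ 4 = t * t * t ^+ 2 by ring.
  have h3 : 0 < t ^+ 2 by rewrite exprn_gt0.
  rewrite h2 mulrA ltr_pM2r//.
  have : t * t <= t by rewrite ler_piMr// ltW.
  by move=> h; nra.
have s5 : e * (cabs (z + t%:C%C) ^+ 2 + cabs (z - t%:C%C) ^+ 2 +
  cabs (z + 'i%C * t%:C%C) ^+ 2 + cabs (z - 'i%C * t%:C%C) ^+ 2) =
  e * (4 * cabs z ^+ 2 + 4 * t ^+ 2) by rewrite -s4.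
rewrite !mulrDr in s5; rewrite !mulrBr in n1 n2 n3 n4; lra.
Qed.

End four_point.

(** * Minimisers of energies *)

Section restricted_integrals.
Context d (T : measurableType d) (R : realType) (mu : probability T R).
Local Open Scope ereal_scope.

Lemma ge0_integral_mrestr (B : set T) (mB : measurable B) (f : T -> \bar R) :
  measurable_fun setT f -> (forall x, 0 <= f x) ->
  \int[mrestr mu mB]_x f x = \int[mu]_(x in B) f x.
Proof.
move=> mf f0.
have mf' D : measurable_fun D f by exact: measurable_funS mf.
rewrite -(setUv B) ge0_integral_setU//; last 2 first.
- exact: measurableC.
- by apply/disj_setPS; rewrite setICr.
rewrite [X in _ + X](_ : _ = 0) ?adde0.
  apply: eq_measure_integral => A mA AB; rewrite /= /mrestr setIidl//.
transitivity (\int[mrestr mu mB]_(x in ~` B `\` ~` B) f x).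
  by apply: ge0_negligible_integral => //; [exact: measurableC|exact: measurableC|
    rewrite /= /mrestr setICl measure0].
by rewrite setDv integral_set0.
Qed.


Lemma integral_indicr (D : set T) (f : T -> \bar R) :
  \int[mu]_(x in D) f x = \int[mu]_x (f x * (\1_D x)%:E).
Proof.
rewrite integral_mkcond; apply: eq_integral => x _.
by rewrite patchE indicE; case: ifP => _; rewrite ?mule1 ?mule0.
Qed.

Variable k : T -> T -> \bar R.
Hypothesis mk : measurable_fun setT (fun p : T * T => k p.1 p.2).
Hypothesis k0 : forall x y, 0 <= k x y.

Lemma measurable_kernel_section z : measurable_fun setT (k z).
Proof.
exact: (measurableT_comp (f := fun p : T * T => k p.1 p.2) mk (measurable_pair1 z)).
Qed.

Lemma measurable_kernel_integral (D : set T) : measurable D ->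
  measurable_fun setT (fun z => \int[mu]_(w in D) k z w).
Proof.
move=> mD; under eq_fun do rewrite integral_indicr.
apply: (@measurable_fun_fubini_tonelli_F _ _ _ _ _ mu
  (fun p : T * T => k p.1 p.2 * (\1_D p.2)%:E)).
  apply: emeasurable_funM => //; apply/measurable_EFinP.
  by apply: measurableT_comp => //; exact: measurable_indic.
by move=> p; rewrite mule_ge0// lee_fin.
Qed.

Hypothesis ksym : forall x y, k x y = k y x.

Lemma kernel_integral_sym (B C : set T) : measurable B -> measurable C ->
  \int[mu]_(z in B) \int[mu]_(w in C) k z w =
  \int[mu]_(z in C) \int[mu]_(w in B) k z w.
Proof.
move=> mB mC.
have H (D D' : set T) : measurable D -> measurable D' ->
    \int[mu]_(z in D) \int[mu]_(w in D') k z w =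
    \int[mu]_z \int[mu]_w (k z w * (\1_D z * \1_D' w)%:E).
  move=> mD mD'; rewrite integral_indicr; apply: eq_integral => z _.
  rewrite integral_indicr -ge0_integralZr//; last 2 first.
  - apply: emeasurable_funM; first exact: measurable_kernel_section.
    by apply/measurable_EFinP; exact: measurable_indic.
  - by move=> w _; rewrite mule_ge0// lee_fin.
  by apply: eq_integral => w _; rewrite -muleA -EFinM mulrC.
rewrite (H B C mB mC) (H C B mC mB); pose f (p : T * T) := k p.1 p.2 * (\1_B p.1 * \1_C p.2)%:E.
have mf : measurable_fun setT f.
  apply: emeasurable_funM => //; apply/measurable_EFinP.
  by apply: measurable_funM; apply: measurableT_comp => //; exact: measurable_indic.
have f0 p : 0 <= f p by rewrite mule_ge0// lee_fin mulr_ge0.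
rewrite [LHS](@fubini_tonelli _ _ _ _ _ mu mu f mf f0).
by apply: eq_integral => z _; apply: eq_integral => w _; rewrite /f /= ksym mulrC.
Qed.

End restricted_integrals.

Section mixture.
Context d (T : measurableType d) (R : realType) (mu : probability T R).
Variables (B : set T) (mB : measurable B) (a b : {nonneg R}).
Local Open Scope ereal_scope.

(** The competitors in the variation of the energy. Reweighting mu on B and off B keeps the support
    inside that of mu, and the energy becomes a quadratic form in a and b. *)
Definition mixture : set T -> \bar R :=
  measure_add (mscale a (mrestr mu mB)) (mscale b (mrestr mu (measurableC mB))).

HB.instance Definition _ := Measure.on mixture.

Hypothesis mixture1 : mixture setT = 1.

HB.instance Definition _ := @Measure_isProbability.Build _ _ _ mixture mixture1.

Definition mixture_prob : probability T R := mixture.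

End mixture.

Section mixture_theory.
Context d (T : measurableType d) (R : realType) (mu : probability T R).
Variables (B : set T) (mB : measurable B) (a b : {nonneg R}).
Local Open Scope ereal_scope.

Lemma mixtureE A : mixture mu mB a b A =
  a%:num%:E * mu (A `&` B) + b%:num%:E * mu (A `&` ~` B).
Proof. by rewrite /mixture measure_addE. Qed.

Lemma ge0_integral_mixture (f : T -> \bar R) :
  measurable_fun setT f -> (forall x, 0 <= f x) ->
  \int[mixture mu mB a b]_x f x =
  a%:num%:E * \int[mu]_(x in B) f x + b%:num%:E * \int[mu]_(x in ~` B) f x.
Proof.
move=> mf f0; rewrite ge0_integral_measure_add// !ge0_integral_mscale//.
by rewrite !ge0_integral_mrestr.
Qed.

End mixture_theory.

Section energy_minimizer.
Context d (T : measurableType d) (R : realType) (mu : probability T R).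
Local Open Scope ereal_scope.
Variable k : T -> T -> \bar R.
Hypothesis mk : measurable_fun setT (fun p : T * T => k p.1 p.2).
Hypothesis k0 : forall x y, 0 <= k x y.
Hypothesis ksym : forall x y, k x y = k y x.

Lemma mixture_energy (B : set T) (mB : measurable B) (a b : {nonneg R}) :
  \int[mixture mu mB a b]_z \int[mixture mu mB a b]_w k z w =
  a%:num%:E * (a%:num%:E * \int[mu]_(z in B) \int[mu]_(w in B) k z w +
               b%:num%:E * \int[mu]_(z in B) \int[mu]_(w in ~` B) k z w) +
  b%:num%:E * (a%:num%:E * \int[mu]_(z in B) \int[mu]_(w in ~` B) k z w +
               b%:num%:E * \int[mu]_(z in ~` B) \int[mu]_(w in ~` B) k z w).
Proof.
have mC := measurableC mB.
have msec := measurable_kernel_section mk.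
have mint := measurable_kernel_integral mu mk k0.
have i0 D z : 0 <= \int[mu]_(w in D) k z w by exact: integral_ge0.
under eq_integral do rewrite ge0_integral_mixture//.
rewrite ge0_integral_mixture//; last 2 first.
- by apply: emeasurable_funD; apply: measurable_funeM; exact: mint.
- by move=> x; rewrite adde_ge0// mule_ge0.
have split (D : set T) : measurable D ->
    \int[mu]_(z in D) (a%:num%:E * \int[mu]_(w in B) k z w + b%:num%:E * \int[mu]_(w in ~` B) k z w) =
    a%:num%:E * \int[mu]_(z in D) \int[mu]_(w in B) k z w +
    b%:num%:E * \int[mu]_(z in D) \int[mu]_(w in ~` B) k z w.
  move=> mD; have mi C : measurable C -> measurable_fun D (fun z => \int[mu]_(w in C) k z w).
    by move=> mC'; apply: measurable_funS (mint _ mC').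
  rewrite ge0_integralD//; last 4 first.
  - by move=> x _; rewrite mule_ge0.
  - by apply: measurable_funeM; exact: mi.
  - by move=> x _; rewrite mule_ge0.
  - by apply: measurable_funeM; exact: mi.
  by rewrite !ge0_integralZl//; exact: mi.
by rewrite (split B mB) (split (~` B) mC) (kernel_integral_sym _ mk k0 ksym mC mB).
Qed.

(* First-order condition at t = 0+ for the mixtures with weights
   1 - t (1 - m) on B and 1 + t m off B, where m = mu B. *)
Lemma energy_minimizer_le (W : R) (B : set T) :
  \int[mu]_z \int[mu]_w k z w = W%:E ->
  (forall B (mB : measurable B) (a b : {nonneg R})
     (h : mixture mu mB a b setT = 1),
     W%:E <= \int[mixture_prob h]_z \int[mixture_prob h]_w k z w) ->
  measurable B -> \int[mu]_(z in B) \int[mu]_w k z w <= W%:E * mu B.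
Proof.
move=> muW minW mB.
have mC := measurable_kernel_integral mu mk k0 measurableT.
have mBC := measurableC mB.
have i0 D z : 0 <= \int[mu]_(w in D) k z w by exact: integral_ge0.
have ii0 D D' : 0 <= \int[mu]_(z in D') \int[mu]_(w in D) k z w by exact: integral_ge0.
set X := \int[mu]_(z in B) \int[mu]_(w in B) k z w.
set Y := \int[mu]_(z in B) \int[mu]_(w in ~` B) k z w.
set Z := \int[mu]_(z in ~` B) \int[mu]_(w in ~` B) k z w.
have mint := measurable_kernel_integral mu mk k0.
have splitw z : \int[mu]_w k z w = \int[mu]_(w in B) k z w + \int[mu]_(w in ~` B) k z w.
  rewrite -ge0_integral_setU ?setUv//; last by apply/disj_setPS; rewrite setICr.
  exact: measurable_kernel_section.
have splitz (D : set T) : measurable D -> \int[mu]_(z in D) \int[mu]_w k z w =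
   \int[mu]_(z in D) \int[mu]_(w in B) k z w + \int[mu]_(z in D) \int[mu]_(w in ~` B) k z w.
  move=> mD; rewrite -ge0_integralD//.
  - by apply: eq_integral => z _; exact: splitw.
  - by apply: measurable_funS (mint _ mB).
  - by apply: measurable_funS (mint _ mBC).
have XYE : \int[mu]_(z in B) \int[mu]_w k z w = X + Y by exact: splitz.
have totE : X + Y + (Y + Z) = W%:E.
  rewrite -muW.
  have -> : \int[mu]_z \int[mu]_w k z w =
      \int[mu]_(z in B) \int[mu]_w k z w + \int[mu]_(z in ~` B) \int[mu]_w k z w.
    rewrite -ge0_integral_setU ?setUv//; last by apply/disj_setPS; rewrite setICr.
  by rewrite XYE (splitz _ mBC) (kernel_integral_sym _ mk k0 ksym mBC mB).
have [x [y [z [XE YE ZE]]]] : exists x y z : R, [/\ X = x%:E, Y = y%:E & Z = z%:E].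
  move: {XYE} totE (ii0 B B) (ii0 (~` B) B) (ii0 (~` B) (~` B)); rewrite -/X -/Y -/Z.
  case: X => [x||]; case: Y => [y||]; case: Z => [z||] //= _ _ _ _.
  by exists x, y, z.
pose m := fine (mu B).
have mE : mu B = m%:E by rewrite /m fineK// fin_num_measure.
have m0 : (0 <= m)%R by rewrite -lee_fin -mE measure_ge0.
have m1 : (m <= 1)%R by rewrite -lee_fin -mE probability_le1.
have xyzW : (x + y + (y + z))%R = W by move: totE; rewrite XE YE ZE -!EFinD => -[].
have x0 : (0 <= x)%R by rewrite -lee_fin -XE; exact: ii0.
have y0 : (0 <= y)%R by rewrite -lee_fin -YE; exact: ii0.
have z0 : (0 <= z)%R by rewrite -lee_fin -ZE; exact: ii0.
have quad t : (0 < t)%R -> (t <= 1)%R ->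
    (W <= (1 - t * (1 - m)) * ((1 - t * (1 - m)) * x + (1 + t * m) * y) +
          (1 + t * m) * ((1 - t * (1 - m)) * y + (1 + t * m) * z))%R.
  move=> t0 t1.
  have a0 : (0 <= 1 - t * (1 - m))%R by nra.
  have b0 : (0 <= 1 + t * m)%R by rewrite addr_ge0// mulr_ge0// ltW.
  have h : mixture mu mB (NngNum a0) (NngNum b0) setT = 1.
    rewrite mixtureE !setTI mE probability_setC// mE /= -EFinB -!EFinM -EFinD.
    by congr (_%:E); ring.
  have := minW _ mB _ _ h; rewrite /mixture_prob /=.
  rewrite mixture_energy// -/X -/Y -/Z XE YE ZE /=.
by rewrite -?(EFinM, EFinD) lee_fin.
rewrite XYE XE YE mE -EFinD -EFinM lee_fin mulrC.
rewrite leNgt; apply/negP => xyW.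
(* The energy at t is W - 2 t D plus a second-order term of at most t^2 Q. With [t * (Q + 1) <= D]
   the linear term wins, against minimality. *)
pose D := (x + y - m * W)%R.
pose Q := ((1 - m) ^+ 2 * x + m ^+ 2 * z)%R.
have D0 : (0 < D)%R by rewrite subr_gt0.
have Q0 : (0 <= Q)%R by rewrite addr_ge0// mulr_ge0// sqr_ge0.
have Q1 : (0 < Q + 1)%R by lra.
pose t := Num.min 1%R (D / (Q + 1))%R.
have t0 : (0 < t)%R by rewrite lt_min ltr01 divr_gt0.
have t1 : (t <= 1)%R by rewrite ge_min lexx.
have tQ : (t * (Q + 1) <= D)%R by rewrite -ler_pdivlMr// ge_min lexx orbT.
have := quad _ t0 t1; rewrite -xyzW.
have -> : ((1 - t * (1 - m)) * ((1 - t * (1 - m)) * x + (1 + t * m) * y) +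
        (1 + t * m) * ((1 - t * (1 - m)) * y + (1 + t * m) * z) =
   (x + y + (y + z)) - t * 2 * (x + y - m * (x + y + (y + z))) +
   t * (t * (Q - 2 * m * (1 - m) * y)))%R by rewrite /Q; ring.
rewrite xyzW -/D.
have : (0 <= m * (1 - m) * y)%R by rewrite !mulr_ge0// subr_ge0.
move: tQ Q0 t0 D0; nra.
Qed.

(** On the set where the potential is at least W + 1/(n+1) the previous inequality leaves no room
    for positive mass. Countably many such sets exhaust the one in question. *)
Lemma energy_minimizer_potential (W : R) :
  \int[mu]_z \int[mu]_w k z w = W%:E ->
  (forall B (mB : measurable B) (a b : {nonneg R})
     (h : mixture mu mB a b setT = 1),
     W%:E <= \int[mixture_prob h]_z \int[mixture_prob h]_w k z w) ->
  mu [set z | W%:E < \int[mu]_w k z w] = 0.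
Proof.
move=> muW minW.
have mC := measurable_kernel_integral mu mk k0 measurableT.
pose B n := [set z | (W + n.+1%:R^-1)%:E <= \int[mu]_w k z w].
have mB n : measurable (B n).
  have := measurable_lee measurableT (measurable_cst (W + n.+1%:R^-1)%:E) mC.
  by rewrite setTI.
have B0 n : mu (B n) = 0.
  have := energy_minimizer_le muW minW (mB n).
  have : \int[mu]_(z in B n) cst (W + n.+1%:R^-1)%:E z <= \int[mu]_(z in B n) \int[mu]_w k z w.
    apply: ge0_le_integral => //.
    - by move=> z _; rewrite lee_fin addr_ge0 ?invr_ge0// -lee_fin -muW integral_ge0// => ? _; exact: integral_ge0.
    - by apply: measurable_funS mC.
  have -> : \int[mu]_(z in B n) cst (W + n.+1%:R^-1)%:E z = (W + n.+1%:R^-1)%:E * mu (B n).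
    exact: integral_cst.
  move=> /le_trans /[apply].
  have mE : mu (B n) = (fine (mu (B n)))%:E by rewrite fineK// fin_num_measure.
  have m0 : (0 <= fine (mu (B n)))%R by rewrite fine_ge0.
  rewrite mE -!EFinM lee_fin mulrDl gerDl => h.
  have n0 : (0 < n.+1%:R^-1 :> R)%R by rewrite invr_gt0.
  by congr (_%:E); apply/eqP; rewrite eq_le m0 andbT -(pmulr_rle0 _ n0).
apply/eqP; rewrite eq_le measure_ge0 andbT.
have -> : [set z | W%:E < \int[mu]_w k z w] = \bigcup_n B n.
  apply/seteqP; split=> [z /= Wz|z [n _]] /=; last first.
    by apply: lt_le_trans; rewrite lte_fin ltrDl invr_gt0.
  have [e e0 We] : exists2 e : R, (0 < e)%R & (W + e)%:E <= \int[mu]_w k z w.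
    case: (\int[mu]_w k z w) Wz => [t||]//; last by exists 1%R; rewrite ?leey.
    by rewrite lte_fin => Wt; exists (t - W)%R; rewrite ?subr_gt0 ?lee_fin ?subrKC.
  have [n _ /(_ n (leqnn n)) /ltW hn] := near_infty_natSinv_lt (PosNum e0).
  by exists n => //=; apply: le_trans We; rewrite lee_fin lerD2l.
have /negligibleP -> // : mu.-negligible (\bigcup_n B n).
  apply: negligible_bigcup => n; apply/negligibleP => //; exact: B0.
exact: bigcupT_measurable.
Qed.
End energy_minimizer.

(** * Truncated logarithms and potentials *)

Section plane_measurability.
Context {R : realType}.

Lemma measurable_continuousC (f : R[i]^o -> R) : continuous f ->
  measurable_fun setT (f : borelC R -> R).
Proof.
move=> /continuousP cf; apply: (measurability _ (RGenOpens.measurableE R)).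
move=> _ [_ [a [b ->] <-]]; rewrite setTI.
by apply: sub_sigma_algebra; exact/cf/interval_open.
Qed.

Lemma open_measurableC (A : set R[i]^o) : open A -> measurable (A : set (borelC R)).
Proof. by move=> oA; exact: sub_sigma_algebra. Qed.

Lemma closed_measurableC (A : set R[i]^o) : closed A -> measurable (A : set (borelC R)).
Proof.
by move=> /closed_openC/open_measurableC/measurableC; rewrite setCK.
Qed.

Lemma measurable_Re : measurable_fun setT (@complex.Re R : borelC R -> R).
Proof.
apply: (@measurable_continuousC (@complex.Re R)) => z P /nbhs_ballP[e /= e0 eP].
apply/nbhsCP; exists e => // y yz; apply: eP; rewrite -ball_normE /= distrC.
by apply: le_lt_trans yz; apply: le_trans (Re_le_cabs _); case: y z => [? ?] [? ?].
Qed.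

Lemma measurable_Im : measurable_fun setT (@complex.Im R : borelC R -> R).
Proof.
apply: (@measurable_continuousC (@complex.Im R)) => z P /nbhs_ballP[e /= e0 eP].
apply/nbhsCP; exists e => // y yz; apply: eP; rewrite -ball_normE /= distrC.
by apply: le_lt_trans yz; apply: le_trans (Im_le_cabs _); case: y z => [? ?] [? ?].
Qed.

(** The pairs carry the product of the two Borel sigma-algebras, so continuity on the product does
    not apply directly. Real coordinates reduce the claim to sums and squares of measurable
    functions. *)
Lemma measurable_cabs_diff :
  measurable_fun setT (fun p : borelC R * borelC R => cabs (p.1 - p.2 : R[i])).
Proof.
have -> : (fun p : borelC R * borelC R => cabs (p.1 - p.2 : R[i])) =
  (fun p : borelC R * borelC R => Num.sqrt ((complex.Re p.1 - complex.Re p.2) ^+ 2 +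
     (complex.Im p.1 - complex.Im p.2) ^+ 2)).
  by apply/funext => -[[a b] [c d]]; rewrite /cabs normc_def.
apply: (@measurableT_comp _ _ _ _ _ _ (@Num.sqrt R)).
  by apply: continuous_measurable_fun; exact: sqrt_continuous.
apply: measurable_funD; apply: measurable_funX;
  apply: measurable_funB; apply: measurableT_comp => //;
  solve [exact: measurable_Re | exact: measurable_Im].
Qed.

Lemma measurable_cabs_sub (z : R[i]) :
  measurable_fun setT (fun w : borelC R => cabs (z - w : R[i])).
Proof.
exact: (measurableT_comp (f := fun p : borelC R * borelC R => cabs (p.1 - p.2 : R[i]))
  measurable_cabs_diff (measurable_pair1 (z : borelC R))).
Qed.

Lemma log_distE (z w : R[i]) :
  log_dist z w = if cabs (z - w) == 0 then -oo%E else (ln (cabs (z - w)))%:E.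
Proof.
rewrite /log_dist; case: eqP => [->|/eqP h]; first by rewrite le0_lneNy.
by rewrite lne_EFin// lt_def h cabs_ge0.
Qed.

Lemma measurable_log_dist :
  measurable_fun setT (fun p : borelC R * borelC R => log_dist (p.1 : R[i]) p.2).
Proof.
under eq_fun do rewrite log_distE.
apply: measurable_fun_ifT => //.
- apply: (measurable_fun_bool true) => //.
  rewrite setTI (_ : _ @^-1` _ = (fun p : borelC R * borelC R => cabs (p.1 - p.2 : R[i])) @^-1` [set 0]).
    by rewrite -[X in measurable X]setTI; exact: measurable_cabs_diff.
  by apply/seteqP; split => p /= /eqP.
- apply/measurable_EFinP; apply: measurableT_comp => //; exact: measurable_cabs_diff.
Qed.

Lemma measurable_log_dist_r (z : R[i]) :
  measurable_fun setT (fun w : borelC R => log_dist z w).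
Proof.
exact: (measurableT_comp (f := fun p : borelC R * borelC R => log_dist (p.1 : R[i]) p.2)
  measurable_log_dist (measurable_pair1 (z : borelC R))).
Qed.

End plane_measurability.

Section truncated_log.
Context {R : realType}.
Implicit Types (z w : R[i]) (r c : R).

Definition lgr r z w := ln (Num.max r (cabs (z - w))).

Lemma ln_le (x y : R) : 0 < x -> x <= y -> ln x <= ln y.
Proof. by move=> x0 xy; rewrite ler_ln ?posrE// (lt_le_trans x0). Qed.

Lemma lgr_mono r s z w : 0 < r -> r <= s -> lgr r z w <= lgr s z w.
Proof.
move=> r0 rs; apply: ln_le; first by rewrite lt_max r0.
by rewrite ge_max !le_max rs lexx orbT.
Qed.

Lemma lgr_ge r z w : 0 < r -> ln r <= lgr r z w.
Proof. by move=> r0; apply: ln_le => //; rewrite le_max lexx. Qed.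

Lemma lgr_ge_ln r z w : z != w -> ln (cabs (z - w)) <= lgr r z w.
Proof.
by move=> zw; apply: ln_le; rewrite ?cabs_gt0 ?subr_eq0// le_max lexx orbT.
Qed.

Lemma lgr_le r z w B : 0 < r -> r <= B -> cabs (z - w) <= B -> lgr r z w <= ln B.
Proof. by move=> r0 rB zB; apply: ln_le; rewrite ?lt_max ?r0// ge_max rB. Qed.

Lemma lgr_eq r z w : r <= cabs (z - w) -> lgr r z w = ln (cabs (z - w)).
Proof. by rewrite /lgr => /max_idPr ->. Qed.

Lemma lgrC r z w : lgr r z w = lgr r w z.
Proof. by rewrite /lgr cabsC. Qed.

Lemma ln_lipschitz (r x y : R) : 0 < r -> r <= x -> r <= y ->
  `|ln x - ln y| <= `|x - y| / r.
Proof.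
move=> r0; wlog xy : x y / x <= y.
  move=> H rx ry; have [xy|/ltW yx] := leP x y; first exact: H.
  by rewrite distrC (distrC x); exact: H.
move=> rx ry; have x0 := lt_le_trans r0 rx; have y0 := lt_le_trans r0 ry.
rewrite distrC (distrC x) ger0_norm ?subr_ge0 ?ln_le//.
rewrite ger0_norm ?subr_ge0// -ln_div ?posrE//.
have := @le_ln1Dx R (y / x - 1).
rewrite (_ : 1 + (y / x - 1) = y / x); last by ring.
have yx0 : 0 < y / x by rewrite divr_gt0.
move=> /(_ _) /le_trans; apply; first by lra.
have -> : y / x - 1 = (y - x) / x by field; rewrite gt_eqF.
by rewrite ler_wpM2l ?subr_ge0// lef_pV2 ?posrE.
Qed.

Lemma lgr_lipschitz r z z' w : 0 < r ->
  `|lgr r z w - lgr r z' w| <= cabs (z - z') / r.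
Proof.
move=> r0; apply: le_trans (ln_lipschitz r0 _ _) _; rewrite ?le_max ?lexx//.
rewrite ler_pM2r ?invr_gt0//.
apply: (@le_trans _ _ `|cabs (z - w) - cabs (z' - w)|).
  have H a b : b <= a -> Num.max r a - Num.max r b <= a - b.
    by move=> ba; case: (leP r a); case: (leP r b); lra.
  have [ab|/ltW ba] := leP (cabs (z - w)) (cabs (z' - w)).
    rewrite distrC (distrC (cabs _)) !ger0_norm ?subr_ge0 ?H//.
    by rewrite ge_max !le_max lexx ab orbT.
  rewrite !ger0_norm ?subr_ge0 ?H//.
  by rewrite ge_max !le_max lexx ba orbT.
have := cabs_dist (z - w) (z' - w).
by rewrite opprB addrA subrK.
Qed.

Lemma measurable_lgr r : measurable_fun setT
  (fun p : borelC R * borelC R => lgr r (p.1 : R[i]) p.2).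
Proof.
apply: measurableT_comp => //; apply: measurable_maxr => //.
exact: measurable_cabs_diff.
Qed.

Lemma measurable_lgr_r r z : measurable_fun setT (fun w : borelC R => lgr r z w).
Proof.
exact: (measurableT_comp (f := fun p : borelC R * borelC R => lgr r (p.1 : R[i]) p.2)
  (measurable_lgr r) (measurable_pair1 (z : borelC R))).
Qed.

(* The constant c dominates the logarithms of all distances in question, so that
   the maximum with 0, which makes the kernels nonnegative, is inactive. *)
Definition ekern c z w : \bar R := (maxe 0 (c%:E - log_dist z w))%E.

Definition kern c r z w : R := Num.max 0 (c - lgr r z w).

Lemma ekern_ge0 c z w : (0 <= ekern c z w)%E.
Proof. by rewrite le_max lexx. Qed.

Lemma ekernC c z w : ekern c z w = ekern c w z.
Proof. by rewrite /ekern !log_distE cabsC. Qed.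

Lemma kern_ge0 c r z w : 0 <= kern c r z w.
Proof. by rewrite le_max lexx. Qed.

Lemma measurable_ekern c : measurable_fun setT
  (fun p : borelC R * borelC R => ekern c (p.1 : R[i]) p.2).
Proof.
apply: measurable_maxe => //; apply: emeasurable_funB => //.
exact: measurable_log_dist.
Qed.

Lemma kern_le_ekern c r z w : 0 < r -> ((kern c r z w)%:E <= ekern c z w)%E.
Proof.
move=> r0; rewrite /kern /ekern EFin_max ge_max le_max lexx /= le_max.
apply/orP; right; rewrite EFinB log_distE; case: eqP => [_|/eqP zw].
  by rewrite -EFinB /= leey.
by rewrite -!EFinB lee_fin lerD2l lerN2 lgr_ge_ln// -subr_eq0 -cabs_eq0.
Qed.

Lemma kern_nonincr c r s z w : 0 < r -> r <= s -> kern c s z w <= kern c r z w.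
Proof.
move=> r0 rs; rewrite /kern ge_max !le_max lexx /=; apply/orP; right.
by rewrite lerD2l lerN2 lgr_mono.
Qed.

Lemma cvg_kern c z w :
  (kern c n.+1%:R^-1 z w)%:E @[n --> \oo] --> ekern c z w.
Proof.
rewrite /ekern log_distE; case: eqP => [zw|/eqP zw].
  rewrite (_ : maxe _ _ = +oo%E); last by apply/max_idPr; rewrite leey.
  apply/cvgeyPge => A; near=> n; rewrite lee_fin /kern /lgr zw le_max; apply/orP; right.
  rewrite (_ : Num.max _ _ = n.+1%:R^-1); last first.
    by apply/max_idPl; rewrite invr_ge0.
  rewrite lnV ?posrE// opprK -lerBlDl -[leLHS]expRK ler_ln ?posrE ?expR_gt0//.
  have : expR (A - c) <= n%:R by near: n; exact: nbhs_infty_ger.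
  by move=> /le_trans; apply; rewrite ler_nat.
have z0 : 0 < cabs (z - w) by rewrite lt_def zw cabs_ge0.
apply: cvg_near_cst; near=> n.
rewrite -EFinB -EFin_max /kern lgr_eq//.
by apply: ltW; near: n; exact: (near_infty_natSinv_lt (PosNum z0)).
Unshelve. all: by end_near. Qed.

End truncated_log.

(** * Reduction of the signed energy to a nonnegative kernel *)

Section integral_shift.
Context d (T : measurableType d) (R : realType) (nu : probability T R).
Local Open Scope ereal_scope.

Lemma integral_cst_probability (c : \bar R) : \int[nu]_x (cst c) x = c.
Proof.
by rewrite integral_cst// -[RHS]mule1; congr (_ * _); exact: probability_setT.
Qed.

(** No integrability is assumed: the integral of g may be [+oo]. Only the negative part of g - c
    needs a bound, and it is at most c. *)
Lemma integral_shift (f g : T -> \bar R) (c : R) (A : set T) :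
  measurable_fun setT f -> measurable_fun setT g -> (forall x, 0 <= g x) ->
  (0 <= c)%R -> measurable A -> nu (~` A) = 0 ->
  (forall x, A x -> f x = g x - c%:E) ->
  \int[nu]_x f x = \int[nu]_x g x - c%:E.
Proof.
move=> mf mg g0 c0 mA A0 fg.
have mgc : measurable_fun setT (fun x => g x - c%:E) by exact: emeasurable_funB.
transitivity (\int[nu]_x (g x - c%:E)).
  apply: ae_eq_integral => //; exists (~` A); split => //; first exact: measurableC.
  by move=> x /= h Ax; apply: h => _; exact: fg.
set h := fun x => _.
have h1 x : h^\+ x + c%:E = g x + h^\- x.
  rewrite funeposE funenegE /h; move: (g0 x); case: (g x) => [t||] // _; last first.
    by rewrite (_ : +oo - c%:E = +oo)// maxye maxNye.
  rewrite -!EFinB -!EFin_max -!EFinD; congr (_%:E).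
  by case: (leP (t - c)%R 0%R) => h1; case: (leP (- (t - c))%R 0%R) => h2; lra.
have mhp : measurable_fun setT h^\+ by exact: measurable_funepos.
have mhn : measurable_fun setT h^\- by exact: measurable_funeneg.
have hn : \int[nu]_x h^\- x <= c%:E.
  rewrite -[leRHS]integral_cst_probability.
  apply: ge0_le_integral => // x _.
  rewrite funenegE /h ge_max lee_fin c0 andbT.
  rewrite leeNl; apply: le_trans (_ : 0 - c%:E <= _); first by rewrite sub0e.
  exact: leeB.
have key : \int[nu]_x h^\+ x + c%:E = \int[nu]_x g x + \int[nu]_x h^\- x.
  rewrite -{1}(integral_cst_probability c%:E).
  rewrite -!ge0_integralD//.
  by apply: eq_integral => x _; exact: h1.
have [t tE] : exists t, \int[nu]_x h^\- x = t%:E.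
  have : 0 <= \int[nu]_x h^\- x by exact: integral_ge0.
  by case: (\int[nu]_x h^\- x) hn => // t _ _; exists t.
rewrite integralE tE; rewrite tE in key.
have g0' : 0 <= \int[nu]_x g x by exact: integral_ge0.
have h0' : 0 <= \int[nu]_x h^\+ x by exact: integral_ge0.
case: (\int[nu]_x h^\+ x) key h0' => [a||]; case: (\int[nu]_x g x) g0' => [b||]//= _ + _.
by rewrite -!EFinD => -[h2]; congr (_%:E); lra.
Qed.

End integral_shift.

Section energy_kernel.
Context {R : realType}.
Local Open Scope ereal_scope.

Lemma ekernE c (M : R) (z w : R[i]) : (0 < M)%R -> (cabs z <= M)%R -> (cabs w <= M)%R ->
  (ln (2 * M) <= c)%R -> ekern c z w = c%:E - log_dist z w.
Proof.
move=> M0 zM wM cM; apply/max_idPr; rewrite log_distE.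
case: eqP => [_|/eqP zw]; first by rewrite leey.
rewrite -EFinB lee_fin subr_ge0; apply: le_trans cM.
apply: ln_le; first by rewrite lt_def zw cabs_ge0.
by apply: le_trans (cabsD _ _) _; rewrite cabsN; lra.
Qed.

Variables (E : set R[i]^o) (M c : R) (nu : probability (borelC R) R).
Hypotheses (cE : closed E) (M0 : (0 < M)%R) (EM : forall z, E z -> (cabs z <= M)%R).
Hypotheses (cM : (ln (2 * M) <= c)%R) (c0 : (0 <= c)%R) (nuE : supported_on E nu).

Lemma measurable_ekern_r (z : R[i]) : measurable_fun setT (fun w : borelC R => ekern c z w).
Proof. exact: (measurable_kernel_section (measurable_ekern c)). Qed.

Lemma potential_ekern (z : R[i]) : E z ->
  \int[nu]_w (- log_dist z w) = \int[nu]_w ekern c z w - c%:E.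
Proof.
move=> Ez; apply: (@integral_shift _ (borelC R) R nu (fun w => - log_dist z w)
  (fun w => ekern c z w) c E) => //.
- by apply: measurableT_comp => //; exact: measurable_log_dist_r.
- exact: measurable_ekern_r.
- by move=> x; exact: ekern_ge0.
- exact: closed_measurableC.
move=> w Ew; rewrite (@ekernE _ M)// ?EM//.
by rewrite addeAC subee// add0e.
Qed.

(** Gives access to Tonelli and to the minimiser argument, both of which want a nonnegative
    kernel. *)
Lemma energy_ekern : energy nu = \int[nu]_z \int[nu]_w ekern c z w - c%:E.
Proof.
rewrite /energy; apply: (@integral_shift _ (borelC R) R nu (fun z => \int[nu]_w (- log_dist z w))
  (fun z => \int[nu]_w ekern c z w) c E) => //.
- have H := measurable_log_dist (R := R).
  pose f1 (p : borelC R * borelC R) := maxe (- log_dist (p.1 : R[i]) p.2) 0.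
  pose f2 (p : borelC R * borelC R) := maxe (- - log_dist (p.1 : R[i]) p.2) 0.
  have mL : measurable_fun setT (fun p : borelC R * borelC R => - log_dist (p.1 : R[i]) p.2).
    exact: measurableT_comp.
  have mf1 : measurable_fun setT f1 by exact: measurable_maxe.
  have mf2 : measurable_fun setT f2.
    by apply: measurable_maxe => //; apply: measurableT_comp => //.
  have -> : (fun z : borelC R => \int[nu]_w (- log_dist (z : R[i]) w)) =
      (fun z => fubini_F nu f1 z - fubini_F nu f2 z).
    apply/funext => z; rewrite integralE; congr (_ - _); apply: eq_integral => w _.
      by rewrite funeposE.
    by rewrite funenegE.
  apply: emeasurable_funB; apply: measurable_fun_fubini_tonelli_F => // p;
    by rewrite le_max lexx orbT.
- apply: (measurable_kernel_integral nu (measurable_ekern c)) => //.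
  by move=> *; exact: ekern_ge0.
- by move=> z; apply: integral_ge0 => w _; exact: ekern_ge0.
- exact: closed_measurableC.
- exact: potential_ekern.
Qed.

End energy_kernel.

Section truncated_potential.
Context {R : realType}.
Variable mu : probability (borelC R) R.
Implicit Types (A : set (borelC R)) (z w : R[i]) (r : R).

(** The sign is that of +ln, opposite to the energy, so Frostman's bound reads [- V <= pot].
    Truncation at r > 0 makes the integrand bounded on bounded sets and Lipschitz in z. *)
Definition pot A r z : R := \int[mu]_(w in A) lgr r z w.

Definition bounded_by (M : R) A := forall w, A w -> cabs (w : R[i]) <= M.

Lemma bounded_integrable A (f : borelC R -> R) (B : R) : measurable A ->
  measurable_fun setT f -> (forall w, A w -> `|f w| <= B) ->
  mu.-integrable A (EFin \o f).
Proof.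
move=> mA mf fB; apply: measurable_bounded_integrable => //.
- by apply: le_lt_trans (ltry 1%R); exact: probability_le1.
- exact: measurable_funS mf.
- exists B; split; first by rewrite num_real.
  by move=> x Bx w Aw /=; apply: le_trans (fB _ Aw) (ltW Bx).
Qed.

Lemma integrable_lgr A M r z : measurable A -> bounded_by M A -> 0 < r ->
  mu.-integrable A (EFin \o lgr r z).
Proof.
move=> mA AM r0; pose B := Num.max r (cabs z + M).
apply: (@bounded_integrable _ _ (`|ln r| + `|ln B|)) => //.
  exact: measurable_lgr_r.
move=> w Aw; have h1 := lgr_ge z w r0.
have h2 : lgr r z w <= ln B.
  apply: lgr_le => //; rewrite le_max ?lexx//; apply/orP; right.
  by apply: le_trans (cabsD _ _) _; rewrite cabsN lerD2l; exact: AM.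
rewrite ler_norml; apply/andP; split.
  by apply: le_trans h1; rewrite lerNl; apply: le_trans (_ : `|ln r| <= _); [rewrite -normrN ler_norm|rewrite lerDl].
by apply: le_trans h2 _; apply: le_trans (ler_norm _) _; rewrite lerDr.
Qed.

Lemma fine_prob_le1 A : measurable A -> 0 <= fine (mu A) <= 1.
Proof.
move=> mA; rewrite fine_ge0 ?measure_ge0//= -lee_fin fineK ?fin_num_measure//.
exact: probability_le1.
Qed.

Lemma conull_probability A : measurable A -> mu (~` A) = 0%E -> mu A = 1%E.
Proof.
move=> mA A0; have := probability_setC mu mA; rewrite A0 => /esym/eqP.
by rewrite sube_eq// ?fin_num_measure// add0e => /eqP.
Qed.

Lemma Rintegral_dist A (f g : borelC R -> R) (e : R) : measurable A ->
  mu.-integrable A (EFin \o f) -> mu.-integrable A (EFin \o g) -> 0 <= e ->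
  (forall w, A w -> `|f w - g w| <= e) ->
  `|\int[mu]_(w in A) f w - \int[mu]_(w in A) g w| <= e.
Proof.
move=> mA If Ig e0 fge; rewrite -RintegralB//.
have Ifg : mu.-integrable A (EFin \o (fun w => f w - g w)).
  have := integrableB mA If Ig; apply: eq_integrable => //.
apply: le_trans (le_normr_Rintegral mA Ifg) _.
apply: (@le_trans _ _ (\int[mu]_(w in A) (cst e) w)).
  apply: le_Rintegral => //.
    by have := integrable_abse Ifg; apply: eq_integrable.
  apply: (@bounded_integrable _ _ e) => // w _.
  by rewrite ger0_norm.
by rewrite Rintegral_cst//; have /andP[? ?] := fine_prob_le1 mA; rewrite ler_piMr.
Qed.

Lemma pot_lipschitz A M r z z' : measurable A -> bounded_by M A -> 0 < r ->
  `|pot A r z - pot A r z'| <= cabs (z - z') / r.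
Proof.
move=> mA AM r0; apply: Rintegral_dist => //.
- exact: (integrable_lgr _ mA AM r0).
- exact: (integrable_lgr _ mA AM r0).
- by rewrite divr_ge0 ?cabs_ge0// ltW.
- by move=> w _; exact: lgr_lipschitz.
Qed.

Lemma Rintegral_conull A B (f : borelC R -> R) : measurable A -> measurable B ->
  A `<=` B -> mu (~` A) = 0%E -> mu.-integrable B (EFin \o f) ->
  \int[mu]_(w in B) f w = \int[mu]_(w in A) f w.
Proof.
move=> mA mB AB A0 If; have mAC := measurableC mA.
rewrite /Rintegral (@negligible_integral _ _ _ mu B (~` A))//.
by rewrite setDE setCK setIidr.
Qed.

Lemma pot_conull A B M r z : measurable A -> measurable B -> bounded_by M B ->
  A `<=` B -> mu (~` A) = 0%E -> 0 < r -> pot B r z = pot A r z.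
Proof. by move=> mA mB BM AB A0 r0; apply: Rintegral_conull => //; exact: (integrable_lgr _ mB BM r0). Qed.

End truncated_potential.

Section frostman.
Context {R : realType}.
Variables (E : set R[i]^o) (mu : probability (borelC R) R) (V : R).
Hypotheses (cE : compact E) (muE : equilibrium_measure E mu) (muV : energy mu = V%:E).

(* On the set where the potential of mu is at most V, which has full measure,
   and then by semicontinuity on its closure K. *)
Lemma frostman_carrier : exists K : set R[i]^o,
  [/\ compact K, K `<=` E, mu (~` K) = 0%E &
      forall z r, K z -> 0 < r -> - V <= pot mu K r z].
Proof.
have [M M0 EM] := compact_bounded_cabs cE.
have clE := compact_closedC cE; have mE := closed_measurableC clE.
pose c := Num.max 0 (ln (2 * M)).
have c0 : 0 <= c by rewrite le_max lexx.
have cM : ln (2 * M) <= c by rewrite le_max lexx orbT.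
have [suppE minE] := muE.
have k0 (x y : borelC R) : (0 <= ekern c (x : R[i]) y)%E by exact: ekern_ge0.
have tot : (\int[mu]_z \int[mu]_w ekern c z w)%E = (V + c)%:E.
  have := energy_ekern clE M0 EM cM c0 suppE; rewrite muV.
  case: (integral _ _ _) => [t||]//=.
  by rewrite -EFinB => -[->]; congr (_%:E); ring.
have Qnull : mu [set z : borelC R | (V + c)%:E < \int[mu]_w ekern c (z : R[i]) w]%E = 0%E.
  apply: energy_minimizer_potential => //; first exact: measurable_ekern.
  - by move=> x y; exact: ekernC.
  move=> B mB a b h.
  have supp' : supported_on E (mixture_prob h).
    rewrite /supported_on /= mixtureE.
    have sub (C : set (borelC R)) : measurable C -> mu (~` E `&` C) = 0%E.
      move=> mC; apply/eqP; rewrite eq_le measure_ge0 andbT -[leRHS]suppE.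
      by apply: le_measure; rewrite ?inE//; [apply: measurableI => //|]; exact: measurableC.
    by rewrite !sub//; [rewrite !mule0 adde0|exact: measurableC].
  have : (V%:E <= energy (mixture_prob h))%E.
    rewrite -muV minE; apply: ereal_inf_lbound; exists (mixture_prob h) => //.
  rewrite (energy_ekern clE M0 EM cM c0 supp').
  by rewrite leeBrDr// EFinD.
pose Q (z : R[i]) := (\int[mu]_w ekern c z w)%E.
pose G := [set z : R[i]^o | E z /\ (Q z <= (V + c)%:E)%E].
have GE : closure G `<=` E.
  by rewrite [X in _ `<=` X](closure_id E).1//; apply: closure_subset => z [].
have clK : closed (closure G) by exact: closed_closure.
have mK := closed_measurableC clK.
have boundE : bounded_by M (E : set (borelC R)) by [].
have K0 : mu (~` closure G) = 0%E.
  have mQ : measurable [set z : borelC R | (V + c)%:E < \int[mu]_w ekern c (z : R[i]) w]%E.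
    have mC := measurable_kernel_integral mu (measurable_ekern c) k0 measurableT.
    by have := measurable_lte measurableT (measurable_cst (V + c)%:E) mC; rewrite setTI.
  have /negligibleP : mu.-negligible (~` E `|` [set z : borelC R | (V + c)%:E < \int[mu]_w ekern c (z : R[i]) w]%E).
    by apply: negligibleU; apply/negligibleP => //; exact: measurableC.
  move=> h; apply/eqP; rewrite eq_le measure_ge0 andbT -[leRHS]h; last first.
    by apply: measurableU => //; exact: measurableC.
  apply: le_measure; rewrite ?inE//; first exact: measurableC.
    by apply: measurableU => //; exact: measurableC.
  move=> z /= nz; have [Ez|] := pselect (E z); last by left.
  by right; rewrite /= ltNge; apply/negP => Qz; apply: nz; apply: subset_closure.
exists (closure G); split => //.
  exact: subclosed_compact clK cE GE.
move=> z r Kz r0; rewrite -(pot_conull _ mK mE boundE GE K0 r0).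
(* The truncated kernel lies below the full one, so the bound on [Q y] yields the inequality for
   every r. *)
have potG y : G y -> - V <= pot mu E r y.
  move=> [Ey Qy]; have Ilgr := integrable_lgr mu y mE boundE r0.
  suff : (c%:E - (pot mu E r y)%:E <= (V + c)%:E)%E by rewrite -EFinB lee_fin; lra.
  apply: le_trans Qy.
  have mk : measurable_fun setT (fun w : borelC R => kern c r y w).
    by apply: measurable_maxr => //; apply: measurable_funB => //; exact: measurable_lgr_r.
  have mke : measurable_fun setT (fun w : borelC R => (kern c r y w)%:E).
    exact/measurable_EFinP.
  have mEC : measurable (~` E : set (borelC R)) by exact: measurableC.
  have Ic : mu.-integrable (E : set (borelC R)) (EFin \o cst c).
    by apply: (@bounded_integrable _ _ _ _ `|c|).
  have -> : (c%:E - (pot mu E r y)%:E = \int[mu]_(w in (E : set (borelC R))) (c%:E - (lgr r y w)%:E))%E.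
    rewrite integralB//; congr (_ - _)%E; last by rewrite fineK//; exact: integrable_fin_num Ilgr.
    rewrite integral_cst//.
    by rewrite -[LHS]mule1; congr (_ * _)%E; rewrite -(conull_probability mE suppE).
  apply: (@le_trans _ _ (\int[mu]_(w in (E : set (borelC R))) (kern c r y w)%:E)%E).
    apply: le_integral => //.
    - exact: integrableB.
    - have Ic' := integrableB mE Ic Ilgr.
      have := integrable_funepos mE Ic'; apply: eq_integrable => // w _.
      by rewrite funeposE /= -EFinB -EFin_max /kern maxC.
    - by move=> w _; rewrite -EFinB lee_fin /kern le_max lexx orbT.
  apply: (@le_trans _ _ (\int[mu]_w (kern c r y w)%:E)%E).
    by apply: ge0_subset_integral => // w _; rewrite lee_fin kern_ge0.
  apply: ge0_le_integral => //.
  - by move=> w _; rewrite lee_fin kern_ge0.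
  - exact: measurable_ekern_r.
  - by move=> w _; exact: kern_le_ekern.
rewrite leNgt; apply/negP => hlt.
(* For fixed r the truncated potential is 1/r-Lipschitz, so a failure at z would persist within
   distance e, where G has a point. *)
pose e := (- V - pot mu E r z) * r.
have e0 : 0 < e by rewrite mulr_gt0// subr_gt0.
have nbz : nbhs (z : R[i]^o) [set y : R[i]^o | cabs (y - z) < e].
  by apply/nbhsCP; exists e.
have [y [Gy /= yz]] := Kz _ nbz.
have := potG y Gy.
have := pot_lipschitz mu y z mE boundE r0.
rewrite ler_norml => /andP[_ h1].
have h2 : cabs (y - z) / r < - V - pot mu E r z by rewrite ltr_pdivrMr.
lra.
Qed.

End frostman.

(** * Frostman and Bernstein-Walsh inequalities *)

Section potential_off_support.
Context {R : realType}.
Variable mu : probability (borelC R) R.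
Implicit Types (A : set (borelC R)) (z w : R[i]) (r : R).

(* Since ln 0 = 0, this is the potential of A only at points z off A. *)
Definition logpot A z : R := \int[mu]_(w in A) ln (cabs (z - w)).

Definition separated (d : R) A z := forall w, A w -> d <= cabs (z - w).

Lemma logpot_pot A z r : separated r A z -> logpot A z = pot mu A r z.
Proof.
move=> sA; apply: eq_Rintegral => w /set_mem Aw.
by rewrite lgr_eq//; exact: sA.
Qed.

Lemma integrable_logpot A M z d : measurable A -> bounded_by M A -> 0 < d ->
  separated d A z -> mu.-integrable A (EFin \o (fun w => ln (cabs (z - w)))).
Proof.
move=> mA AM d0 sA; have := integrable_lgr mu z mA AM d0.
apply: eq_integrable => // w /set_mem Aw.
by rewrite /= lgr_eq//; exact: sA.
Qed.

Lemma separated_near A z y d : separated d A z -> cabs (y - z) <= d / 2 ->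
  separated (d / 2) A y.
Proof.
move=> sA yz w Aw; have := sA _ Aw; have := cabs_triangle z y w.
by rewrite (cabsC z y); lra.
Qed.

Lemma logpot_near A M z d : measurable A -> bounded_by M A -> 0 < d ->
  separated d A z -> forall e, 0 < e ->
  \forall y \near (z : R[i]^o), `|logpot A y - logpot A z| < e.
Proof.
move=> mA AM d0 sA e e0; have d20 : 0 < d / 2 by rewrite divr_gt0.
apply/nbhsCP; exists (Num.min (d / 2) (e * (d / 2))).
  by rewrite lt_min d20 mulr_gt0.
move=> y; rewrite lt_min => /andP[/ltW y1 y2].
rewrite (logpot_pot (separated_near sA y1)) (@logpot_pot A z (d / 2)); last first.
  by move=> w /sA; apply: le_trans; lra.
apply: le_lt_trans (pot_lipschitz mu _ _ mA AM d20) _.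
by rewrite ltr_pdivrMr.
Qed.

(** The constant of [ln_cabs_four] at z - w is at most 2 / d^4 for every w in A, so the four-point
    estimate can be integrated over A. *)
Lemma logpot_four_mean A M z d : measurable A -> bounded_by M A -> 0 < d ->
  separated d A z -> four_mean (logpot A) z.
Proof.
move=> mA AM d0 sA; have d20 : 0 < d / 2 by rewrite divr_gt0.
exists (2 / d ^+ 4); first by rewrite divr_ge0// exprn_ge0// ltW.
exists (d / 2) => // h hd.
have I y : cabs (y - z) <= d / 2 ->
    mu.-integrable A (EFin \o (fun w => ln (cabs (y - w)))).
  by move=> yz; exact: (integrable_logpot mA AM d20 (separated_near sA yz)).
have hi : cabs ('i%C * h) = cabs h by rewrite cabsM cabs_i mul1r.
have I1 := I (z + h); rewrite addrAC subrr add0r in I1.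
have I2 := I (z - h); rewrite addrAC subrr add0r cabsN in I2.
have I3 := I (z + 'i%C * h); rewrite addrAC subrr add0r hi in I3.
have I4 := I (z - 'i%C * h); rewrite addrAC subrr add0r cabsN hi in I4.
have {}I1 := I1 (ltW hd); have {}I2 := I2 (ltW hd).
have {}I3 := I3 (ltW hd); have {}I4 := I4 (ltW hd).
have I0 := I z; rewrite subrr cabs0 in I0; have {}I0 := I0 (ltW d20).
have ID f g : mu.-integrable A (EFin \o f) -> mu.-integrable A (EFin \o g) ->
    mu.-integrable A (EFin \o (fun w => f w + g w)).
  by move=> If Ig; have := integrableD mA If Ig; apply: eq_integrable.
have I12 := ID _ _ I1 I2; have I123 := ID _ _ I12 I3; have I1234 := ID _ _ I123 I4.
have I40 : mu.-integrable A (EFin \o (fun w => 4 * ln (cabs (z - w)))).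
  by have := integrableZl mA 4 I0; apply: eq_integrable.
have -> : sum4 (logpot A) z h =
    \int[mu]_(w in A) (ln (cabs (z + h - w)) + ln (cabs (z - h - w)) +
      ln (cabs (z + 'i%C * h - w)) + ln (cabs (z - 'i%C * h - w))).
  by rewrite !RintegralD.
rewrite -RintegralZl//; apply: Rintegral_dist => //.
  by rewrite mulr_ge0 ?divr_ge0 ?exprn_ge0 ?cabs_ge0// ltW.
move=> w Aw; have dzw := sA _ Aw; have zw0 := lt_le_trans d0 dzw.
have := @ln_cabs_four _ (z - w) h; rewrite -cabs_gt0 /sum4.
rewrite -!(addrAC z _ (- w)) => /(_ zw0) H.
apply: le_trans (H _) _; first by apply: le_trans (ltW hd) _; rewrite ler_pM2r.
rewrite ler_wpM2r ?exprn_ge0 ?cabs_ge0// ler_wpM2l// lef_pV2 ?posrE ?exprn_gt0//.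
by rewrite lerXn2r ?nnegrE ?cabs_ge0 ?(ltW d0).
Qed.

End potential_off_support.

Section continuity_principle.
Context {R : realType}.
Variables (mu : probability (borelC R) R) (K : set R[i]^o) (V M : R).
Hypotheses (cK : compact K) (K0 : mu (~` K) = 0%E) (M1 : 1 <= M).
Hypothesis KM : forall w, K w -> cabs w <= M.
Hypothesis potK : forall z r, K z -> 0 < r -> - V <= pot mu K r z.

Local Notation KB := (K : set (borelC R)).

Let mK : measurable KB. Proof. by apply: closed_measurableC; exact: compact_closedC. Qed.
Let bK : bounded_by M KB. Proof. exact: KM. Qed.

Lemma Rintegral_indicator (A B : set (borelC R)) : measurable A -> measurable B ->
  \int[mu]_(w in A) \1_B w = fine (mu (B `&` A)).
Proof. by move=> mA mB; rewrite /Rintegral integral_indic. Qed.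

Lemma Rintegral_cst_conull (c : R) : \int[mu]_(w in KB) c = c.
Proof.
rewrite Rintegral_cst// -[RHS]mulr1; congr (c * _).
exact: (f_equal fine (conull_probability mK K0)).
Qed.

Lemma carrier_neq0 : K !=set0.
Proof.
apply/set0P/eqP => Ke; have := conull_probability mK K0.
by rewrite Ke measure0 => /eqP; rewrite eq_sym onee_eq0.
Qed.

(* The bound on the potential at z rules out concentration at z. *)
Lemma small_ball_mass (z : R[i]) (e : R) : K z -> 0 < e ->
  exists2 r : R, 0 < r < 1 &
    fine (mu ([set w : borelC R | cabs (z - w) < r] `&` KB)) <= e.
Proof.
move=> Kz e0.
have lM : 0 <= ln (2 * M).
  apply: ln_ge0; move: M1; lra.
pose D := (`|V| + ln (2 * M) + 1 : R).
have D0 : 0 < D by rewrite /D; have := normr_ge0 V; lra.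
(* On the ball [lgr r] equals -D/e and elsewhere on K it is at most ln(2M). A mass m in the ball
   thus gives -V <= ln(2M) - (D/e) m, hence m <= e by the choice of D. *)
pose r := expR (- (D / e)).
have r0 : 0 < r by exact: expR_gt0.
have De : 0 < D / e by rewrite divr_gt0.
have r1 : r < 1 by rewrite /r expR_lt1; lra.
exists r; first by rewrite r0.
set B := [set w : borelC R | cabs (z - w) < r].
have mB : measurable B.
  rewrite /B (_ : [set w | _] = (fun w : borelC R => cabs (z - w)) @^-1` [set` `]-oo, r[ ]).
    by rewrite -[X in measurable X]setTI; apply: measurable_cabs_sub.
  by apply/seteqP; split => w /=; rewrite in_itv.
set m := fine _.
have Il := integrable_lgr mu z mK bK r0.
have IB : mu.-integrable KB (EFin \o (fun w => ln (2 * M) - (D / e) * \1_B w)).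
  apply: (@bounded_integrable _ _ _ _ (ln (2 * M) + D / e)) => //.
    by apply: measurable_funB => //; apply: measurable_funM => //; exact: measurable_indic.
  move=> w _; rewrite indicE; case: (w \in B) => /=; rewrite ler_norml; lra.
have h1 : pot mu K r z <= \int[mu]_(w in KB) (ln (2 * M) - (D / e) * \1_B w).
  apply: le_Rintegral => // w Kw; rewrite indicE; have [/set_mem wB|_] := boolP (w \in B); rewrite /=.
    rewrite mulr1 (_ : lgr r z w = - (D / e)); first lra.
    by rewrite /lgr (max_idPl _) ?(ltW wB)// expRK.
  rewrite mulr0 subr0; apply: lgr_le => //; first by move: M1; lra.
  apply: le_trans (cabsD _ _) _; rewrite cabsN; have := KM Kz; have := KM Kw; lra.
have h2 : \int[mu]_(w in KB) (ln (2 * M) - (D / e) * \1_B w) = ln (2 * M) - (D / e) * m.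
  rewrite RintegralB//; last 2 first.
  - by apply: (@bounded_integrable _ _ _ _ `|ln (2 * M)|).
  - apply: (@bounded_integrable _ _ _ _ (D / e)) => //.
      by apply: measurable_funM => //; exact: measurable_indic.
    by move=> w _; rewrite indicE; case: (w \in B) => /=; rewrite ?mulr1 ?mulr0 ?normr0 ?gtr0_norm// ltW.
  rewrite Rintegral_cst_conull RintegralZl//; last first.
    apply: (@bounded_integrable _ _ _ (\1_B) 1) => //.
    by move=> w _; rewrite indicE; case: (w \in B); rewrite /= ?normr1 ?normr0.
  by rewrite Rintegral_indicator.
have := potK Kz r0; rewrite -/KB => h3.
have h4 : (D / e) * m <= D.
  have := ler_norm V; rewrite /D in h1 h2 *; lra.
have : D * m <= D * e by move: h4; rewrite mulrAC ler_pdivrMr.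
by rewrite ler_pM2l.
Qed.

(** Let x be a point of K nearest to y. Then |x - w| <= 2 |y - w| for w in K, so passing from y to x
    costs at most ln 2 in the logarithm. The full cost is paid only in a ball around zeta of small
    mass, and Lipschitz continuity controls the rest. *)
Lemma continuity_principle (zeta : R[i]) (eta : R) : K zeta -> 0 < eta ->
  \forall y \near (zeta : R[i]^o), ~ K y -> - V - eta <= logpot mu K y.
Proof.
move=> Kz eta0.
have l2 : 0 < ln 2 :> R by rewrite ln_gt0//; lra.
have e20 : 0 < eta / 2 / ln 2 by rewrite !divr_gt0.
have [r /andP[r0 r1]] := small_ball_mass Kz e20.
set B := [set w : borelC R | _]; set m := fine _ => mle.
have mB : measurable B.
  rewrite /B (_ : [set w | _] = (fun w : borelC R => cabs (zeta - w)) @^-1` [set` `]-oo, r[ ]).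
    by rewrite -[X in measurable X]setTI; apply: measurable_cabs_sub.
  by apply/seteqP; split => w /=; rewrite in_itv.
(* For w outside the ball, t <= r/4 keeps x and y at distance at least r/2 from w, and t <= eta r/4
   makes the Lipschitz loss d / (r/2) at most eta/2. *)
pose t := Num.min (r / 4) (eta * r / 4).
have t0 : 0 < t by rewrite lt_min !divr_gt0// mulr_gt0.
have tr : t <= r / 4 by rewrite /t ge_min lexx.
have te : t <= eta * r / 4 by rewrite /t ge_min lexx orbT.
apply/nbhsCP; exists t => // y yz nKy.
have [|x Kx xmin] := @usc_attains_max R _ K (fun x => - cabs (x - y)) cK carrier_neq0.
  move=> x a _ ax; apply/nbhsCP; exists (a + cabs (x - y)) => [|s sx]; first by lra.
  by have := cabs_triangle x s y; rewrite (cabsC x s); lra.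
have {}xmin w : K w -> cabs (y - x) <= cabs (y - w).
  by move=> /xmin; rewrite lerN2 !(cabsC y).
set d := cabs (y - x).
have d0 : 0 < d.
  by rewrite cabs_gt0 subr_eq0; apply/eqP => yx; apply: nKy; rewrite yx.
have dt : d < t by apply: le_lt_trans (xmin _ Kz) _.
have d20 : 0 < 2 * d by lra.
have sy : separated d KB y by move=> w Kw; exact: xmin.
have Iy := integrable_logpot mu mK bK d0 sy.
have Ix := integrable_lgr mu x mK bK d20.
have IB : mu.-integrable KB (EFin \o (fun w => ln 2 * \1_B w)).
  apply: (@bounded_integrable _ _ _ _ (ln 2)) => //.
    by apply: measurable_funM => //; exact: measurable_indic.
  by move=> w _; rewrite indicE; case: (w \in B) => /=; rewrite ?mulr1 ?mulr0 ?normr0 ?gtr0_norm// ltW.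
have IxB : mu.-integrable KB (EFin \o (fun w => lgr (2 * d) x w - ln 2 * \1_B w)).
  by have := integrableB mK Ix IB; apply: eq_integrable.
have Ie : mu.-integrable KB (EFin \o (cst (eta / 2))).
  by apply: (@bounded_integrable _ _ _ _ `|eta / 2|).
have IxBe : mu.-integrable KB (EFin \o (fun w => lgr (2 * d) x w - ln 2 * \1_B w - eta / 2)).
  by have := integrableB mK IxB Ie; apply: eq_integrable.
have h1 : \int[mu]_(w in KB) (lgr (2 * d) x w - ln 2 * \1_B w - eta / 2) <= logpot mu K y.
  apply: le_Rintegral => // w Kw.
  have yw0 : 0 < cabs (y - w) by apply: lt_le_trans (xmin _ Kw).
  have dyw := xmin _ Kw; rewrite -/d in dyw.
  rewrite indicE; have [_|wB] := boolP (w \in B); rewrite /=.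
    suff : lgr (2 * d) x w <= ln 2 + ln (cabs (y - w)) by lra.
    rewrite -lnM ?posrE//; apply: lgr_le => //; first by rewrite ler_pM2l.
    by have := cabs_triangle x y w; rewrite (cabsC x y) -/d; lra.
  have {}wB : r <= cabs (zeta - w) by rewrite leNgt; apply: contra wB => h; exact/mem_set.
  have g1 := cabs_triangle zeta y w; rewrite (cabsC zeta y) in g1.
  have g2 := cabs_triangle y x w; rewrite -/d in g2.
  have r20 : 0 < r / 2 by lra.
  rewrite lgr_eq; last by lra.
  have yw2 : r / 2 <= cabs (y - w) by lra.
  have xw2 : r / 2 <= cabs (x - w) by lra.
  have := ln_lipschitz r20 yw2 xw2; rewrite ler_norml mulr0 subr0 => /andP[+ _].
  have g3 : `|cabs (y - w) - cabs (x - w)| <= d.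
    by apply: le_trans (cabs_dist _ _) _; rewrite opprB addrA subrK.
  have g4 : `|cabs (y - w) - cabs (x - w)| / (r / 2) <= eta / 2.
    rewrite ler_pdivrMr//; apply: le_trans g3 _; lra.
  lra.
apply: le_trans h1; rewrite RintegralB// RintegralB// RintegralZl//; last first.
  apply: (@bounded_integrable _ _ _ (\1_B) 1) => //.
  by move=> w _; rewrite indicE; case: (w \in B); rewrite /= ?normr1 ?normr0.
rewrite Rintegral_cst_conull Rintegral_indicator// -/m.
have := potK Kx d20; rewrite /pot => g1.
have g2 : ln 2 * m <= eta / 2.
  by move: mle; rewrite ler_pdivlMr// mulrC.
lra.
Qed.

End continuity_principle.

Lemma ln_prod {R : realType} (I : eqType) (r : seq I) (F : I -> R) :
  (forall i, i \in r -> 0 < F i) -> ln (\prod_(i <- r) F i) = \sum_(i <- r) ln (F i).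
Proof.
elim: r => [_|i r IH F0]; first by rewrite !big_nil ln1.
have F0' j : j \in r -> 0 < F j by move=> jr; apply: F0; rewrite inE jr orbT.
rewrite !big_cons lnM ?posrE ?F0 ?mem_head ?IH//.
by rewrite big_seq; apply: prodr_gt0.
Qed.

Section continuity_in_plane.
Context {R : realType}.
Implicit Types (f g : R[i] -> R) (z a : R[i]).

Lemma nearCW z (P : R[i] -> Prop) : (forall y, P y) -> \forall y \near (z : R[i]^o), P y.
Proof. by move=> h; apply/nbhsCP; exists 1. Qed.

Definition cont_at f z := forall e, 0 < e ->
  \forall y \near (z : R[i]^o), `|f y - f z| < e.

Lemma cont_atD f g z : cont_at f z -> cont_at g z -> cont_at (fun y => f y + g y) z.
Proof.
move=> cf cg e e0; have e20 : 0 < e / 2 by rewrite divr_gt0.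
apply: filterS2 (cf _ e20) (cg _ e20) => y h1 h2.
rewrite opprD addrACA; apply: le_lt_trans (ler_normD _ _) _.
by rewrite (splitr e) ltrD.
Qed.

Lemma cont_at_cst (c : R) z : cont_at (fun=> c) z.
Proof. by move=> e e0; apply: nearCW => y; rewrite subrr normr0. Qed.

Lemma cont_atZ (c : R) f z : cont_at f z -> cont_at (fun y => c * f y) z.
Proof.
move=> cf e e0; have c1 : 0 < `|c| + 1 by rewrite ltr_wpDl.
have ec : 0 < e / (`|c| + 1) by rewrite divr_gt0.
apply: filterS (cf _ ec) => y; rewrite ltr_pdivlMr// => h.
rewrite -mulrBr normrM; apply: le_lt_trans h; rewrite mulrC ler_wpM2l//.
by rewrite lerDl.
Qed.

Lemma cont_at_lt f z (b : R) : cont_at f z -> f z < b ->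
  \forall y \near (z : R[i]^o), f y < b.
Proof.
move=> cf fb; have b0 : 0 < b - f z by rewrite subr_gt0.
by apply: filterS (cf _ b0) => y; rewrite ltr_norml => /andP[_]; lra.
Qed.

Lemma cont_at_cabs a z : cont_at (fun y => cabs (y - a)) z.
Proof.
move=> e e0; apply/nbhsCP; exists e => // y yz; apply: le_lt_trans yz.
by apply: le_trans (cabs_dist _ _) _; rewrite opprB addrA subrK.
Qed.

Lemma cont_at_ln_cabs a z : z != a -> cont_at (fun y => ln (cabs (y - a))) z.
Proof.
move=> za e e0; have d0 : 0 < cabs (z - a) by rewrite cabs_gt0 subr_eq0.
pose d := cabs (z - a) / 2; have d20 : 0 < d by rewrite divr_gt0.
apply/nbhsCP; exists (Num.min d (e * d)); first by rewrite lt_min d20 mulr_gt0.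
move=> y; rewrite lt_min => /andP[y1 y2].
have dz : d <= cabs (z - a) by rewrite /d; lra.
have dy : d <= cabs (y - a).
  have := cabs_triangle z y a; rewrite (cabsC z y); rewrite /d in y1 *; lra.
apply: le_lt_trans (ln_lipschitz d20 dy dz) _.
rewrite ltr_pdivrMr//; apply: le_lt_trans y2.
by apply: le_trans (cabs_dist _ _) _; rewrite opprB addrA subrK.
Qed.

(** The modulus at z of the monic polynomial with root list [rs], multiplicities included. The
    potential theory below handles polynomials in this form only. *)
Definition rprod (rs : seq R[i]) z : R := \prod_(a <- rs) cabs (z - a).

Lemma rprod_ge0 rs z : 0 <= rprod rs z.
Proof. by apply: prodr_ge0 => a _; exact: cabs_ge0. Qed.

Lemma rprod_eq0 rs z : (rprod rs z == 0) = (z \in rs).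
Proof.
rewrite /rprod; elim: rs => [|a rs IH]; first by rewrite big_nil oner_eq0.
by rewrite big_cons mulf_eq0 cabs_eq0 subr_eq0 IH in_cons.
Qed.

Lemma rprod_gt0 rs z : z \notin rs -> 0 < rprod rs z.
Proof. by move=> zrs; rewrite lt_def rprod_ge0 rprod_eq0 zrs. Qed.

Lemma ln_rprod rs z : z \notin rs -> ln (rprod rs z) = \sum_(a <- rs) ln (cabs (z - a)).
Proof.
move=> zrs; apply: ln_prod => a ars; rewrite cabs_gt0 subr_eq0.
by apply: contraNneq zrs => ->.
Qed.

Lemma cont_at_ln_rprod rs z : z \notin rs -> cont_at (fun y => ln (rprod rs y)) z.
Proof.
move=> zrs; have H : cont_at (fun y => \sum_(a <- rs) ln (cabs (y - a))) z.
  elim: rs zrs => [|a rs IH].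
    by move=> _ e e0; apply: nearCW => y; rewrite !big_nil subrr normr0.
  rewrite in_cons negb_or => /andP[za /IH {}IH] e e0.
  have := cont_atD (cont_at_ln_cabs za) IH e0.
  by apply: filterS => y; rewrite !big_cons.
move=> e e0; have nrs : \forall y \near (z : R[i]^o), y \notin rs.
  elim: rs zrs {H} => [|a rs IH]; first by move=> _; apply: nearCW.
  rewrite in_cons negb_or => /andP[za /IH {}IH].
  have : \forall y \near (z : R[i]^o), y != a.
    apply/nbhsCP; exists (cabs (z - a)); first by rewrite cabs_gt0 subr_eq0.
    by move=> y; apply: contraTneq => ->; rewrite cabsC ltxx.
  by apply: filterS2 IH => y h1 h2; rewrite in_cons negb_or h1 h2.
by apply: filterS2 nrs (H _ e0) => y yrs; rewrite !ln_rprod.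
Qed.

Lemma four_mean_ln_rprod rs z : z \notin rs -> four_mean (fun y => ln (rprod rs y)) z.
Proof.
move=> zrs; have [c c0 [r r0 H]] : four_mean (fun y => \sum_(a <- rs) ln (cabs (y - a))) z.
  elim: rs zrs => [|a rs IH].
    move=> _; exists 0 => //; exists 1 => // h _.
    by rewrite /sum4 !big_nil !addr0 mulr0 subr0 normr0 mul0r.
  rewrite in_cons negb_or => /andP[za /IH {}IH].
  have [c c0 [r r0 H]] := four_meanD (four_mean_ln za) IH.
  by exists c => //; exists r => // h /H; rewrite /sum4 !big_cons.
have [r' r'0 nrs] : exists2 r, 0 < r & forall y, cabs (y - z) < r -> y \notin rs.
  elim: rs zrs {H} => [|a rs IH]; first by exists 1.
  rewrite in_cons negb_or => /andP[za /IH[r' r'0 {}IH]].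
  exists (Num.min r' (cabs (z - a))); first by rewrite lt_min r'0 cabs_gt0 subr_eq0.
  move=> y; rewrite lt_min => /andP[/IH yr yz]; rewrite in_cons negb_or yr andbT.
  by apply: contraTneq yz => ->; rewrite cabsC ltxx.
exists c => //; exists (Num.min r r'); first by rewrite lt_min r0.
move=> h; rewrite lt_min => /andP[hr hr'].
have hi : cabs ('i%C * h) = cabs h by rewrite cabsM cabs_i mul1r.
have := H h hr; rewrite /sum4 -!ln_rprod//; apply: nrs;
  by rewrite addrAC subrr add0r ?cabsN ?hi.
Qed.

Lemma cont_at_rprod rs z : cont_at (rprod rs) z.
Proof.
rewrite /rprod; elim: rs => [|a rs IH].
  by move=> e e0; apply: nearCW => y; rewrite !big_nil subrr normr0.
move=> e e0; set p := fun y => \prod_(j <- rs) cabs (y - j).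
pose B := `|p z| + cabs (z - a) + 1.
have B0 : 0 < B by rewrite /B -addrA ltr_wpDl// ltr_wpDl ?cabs_ge0.
have eB : 0 < Num.min 1 (e / (2 * B)) by rewrite lt_min ltr01 divr_gt0// mulr_gt0.
apply: filterS2 (@cont_at_cabs a z _ eB) (IH _ eB) => y; rewrite !big_cons -/(p y) -/(p z).
rewrite !lt_min => /andP[a1 a2] /andP[p1 p2].
have -> : cabs (y - a) * p y - cabs (z - a) * p z =
  (cabs (y - a) - cabs (z - a)) * p z + cabs (y - a) * (p y - p z) by ring.
apply: le_lt_trans (ler_normD _ _) _; rewrite !normrM.
have ya : `|cabs (y - a)| <= B.
  rewrite ger0_norm ?cabs_ge0//; move: a1; rewrite ltr_norml => /andP[_].
  rewrite /B; have := normr_ge0 (p z); lra.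
have pB : `|p z| <= B by rewrite /B; have := cabs_ge0 (z - a); lra.
have e2 : e / (2 * B) * B = e / 2 by field; rewrite gt_eqF.
have h1 : `|cabs (y - a) - cabs (z - a)| * `|p z| <= e / (2 * B) * `|p z|.
  by rewrite ler_wpM2r// ltW.
have h2 : e / (2 * B) * `|p z| <= e / (2 * B) * B.
  by rewrite ler_wpM2l// divr_ge0 ?ltW// mulr_gt0.
have h3 : `|cabs (y - a)| * `|p y - p z| <= B * `|p y - p z| by rewrite ler_wpM2r.
have h4 : B * `|p y - p z| < B * (e / (2 * B)) by rewrite ltr_pM2l.
rewrite (mulrC B (e / _)) e2 in h4; rewrite e2 in h2; lra.
Qed.

Lemma rprod_le rs : exists2 B : R, 0 <= B &
  forall z, rprod rs z <= (cabs z + B) ^+ size rs.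
Proof.
elim: rs => [|a rs [B B0 IH]].
  by exists 0 => // z; rewrite /rprod big_nil expr0.
exists (B + cabs a); first by rewrite addr_ge0 ?cabs_ge0.
move=> z; rewrite /rprod big_cons exprS; apply: ler_pM; rewrite ?cabs_ge0//.
- exact: rprod_ge0.
- by apply: le_trans (cabsD _ _) _; rewrite cabsN; lra.
apply: le_trans (IH z) _; rewrite lerXn2r ?nnegrE ?addr_ge0 ?cabs_ge0//.
by rewrite addrA lerDl cabs_ge0.
Qed.

(** The logarithm tends to -oo at a root. The roots themselves must be left out, since [ln 0] is
    0. *)
Lemma ln_rprod_root rs z (a c m : R) : z \in rs -> 0 < a -> 0 < c ->
  \forall y \near (z : R[i]^o), y \notin rs -> a * (ln (rprod rs y) - ln c) < m.
Proof.
move=> zrs a0 c0; have b0 : 0 < c * expR (m / a) by rewrite mulr_gt0// expR_gt0.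
have : rprod rs z < c * expR (m / a) by rewrite (eqP (_ : rprod rs z == 0))// rprod_eq0.
move=> /(cont_at_lt (@cont_at_rprod rs z)); apply: filterS => y yb yrs.
rewrite mulrC -ltr_pdivlMr// ltrBlDl -[X in _ + X]expRK -lnM ?posrE ?expR_gt0//.
by rewrite ltr_ln ?posrE// rprod_gt0.
Qed.

(** The left-hand side grows at most like (a n - 1) ln|y| with a negative coefficient. Potentials of
    unit mass will be bounded below by ln(|y|/2) far out. *)
Lemma ln_rprod_far rs (a c m : R) : 0 < a -> a * (size rs)%:R < 1 -> exists B : R,
  forall y, B <= cabs y -> y \notin rs ->
    a * (ln (rprod rs y) - ln c) - ln (cabs y / 2) < m.
Proof.
move=> a0; set n : R := (size rs)%:R => an; have n0 : 0 <= n by rewrite ler0n.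
have an0 : 0 < 1 - a * n by rewrite subr_gt0.
have [B B0 HB] := rprod_le rs.
pose C := a * n * ln 2 - a * ln c + ln 2.
pose T := Num.max 1 ((C - m) / (1 - a * n) + 1).
exists (Num.max (expR T) B) => y; rewrite ge_max => /andP[yT yB] yrs.
have y0 : 0 < cabs y by apply: lt_le_trans yT; exact: expR_gt0.
have g2 : ln (rprod rs y) <= n * (ln 2 + ln (cabs y)).
  apply: le_trans (ln_le (rprod_gt0 yrs) (HB y)) _.
  apply: (@le_trans _ _ (ln ((2 * cabs y) ^+ size rs))).
    apply: ln_le; first by rewrite exprn_gt0// ltr_pwDl.
    by rewrite lerXn2r ?nnegrE ?mulr_ge0 ?addr_ge0 ?cabs_ge0//; lra.
  have y20 : 0 < 2 * cabs y by rewrite mulr_gt0.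
  by rewrite (lnXn _ y20) lnM ?posrE// /n mulr_natl.
have g3 : T <= ln (cabs y) by rewrite -[T]expRK ler_ln ?posrE ?expR_gt0.
have : (C - m) / (1 - a * n) < ln (cabs y).
  by apply: lt_le_trans g3; rewrite lt_max; apply/orP; right; rewrite ltrDl.
rewrite ltr_pdivrMr// ln_div ?posrE// => g4.
have : a * ln (rprod rs y) <= a * (n * (ln 2 + ln (cabs y))) by rewrite ler_wpM2l// ltW.
by rewrite /C in g4; lra.
Qed.

End continuity_in_plane.

Section bernstein_walsh.
Context {R : realType}.
Variables (mu : probability (borelC R) R) (K : set R[i]^o) (V M : R).
Hypotheses (cK : compact K) (K0 : mu (~` K) = 0%E) (M1 : 1 <= M).
Hypothesis KM : forall w, K w -> cabs w <= M.
Hypothesis potK : forall z r, K z -> 0 < r -> - V <= pot mu K r z.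

Local Notation KB := (K : set (borelC R)).

Let mK : measurable KB. Proof. by apply: closed_measurableC; exact: compact_closedC. Qed.
Let bK : bounded_by M KB. Proof. exact: KM. Qed.

Lemma off_carrier (z : R[i]) : ~ K z -> exists2 d : R, 0 < d & separated d KB z.
Proof.
move=> nKz; have oK : open (~` K) by apply: closed_openC; exact: compact_closedC.
have /nbhsCP[d d0 dP] : nbhs (z : R[i]^o) (~` K) by exact: open_nbhs_nbhs.
exists d => // w Kw; rewrite leNgt; apply/negP; rewrite cabsC => /dP; exact.
Qed.

Lemma logpot_ge (z : R[i]) : 2 * M <= cabs z -> ln (cabs z / 2) <= logpot mu K z.
Proof.
move=> zM; have z0 : 0 < cabs z / 2 by move: M1 zM; lra.
have sz : separated (cabs z / 2) KB z.
  move=> w Kw; have := KM Kw; have := cabs_dist z w; rewrite ler_norml => /andP[_].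
  move: zM; lra.
rewrite -[leLHS](Rintegral_cst_conull cK K0); apply: le_Rintegral => //.
- by apply: (@bounded_integrable _ _ _ _ `|ln (cabs z / 2)|).
- exact: (integrable_logpot mu mK bK z0 sz).
- by move=> w Kw; apply: ln_le => //; exact: sz.
Qed.

(** The maximum principle is applied off K and off the roots. The comparison function tends to -oo
    at the roots and at infinity. Near K the continuity principle bounds it, and the strict
    inequality on K keeps |p| below c in a neighbourhood of each point of K. *)
Lemma bernstein_walsh_aux (rs : seq R[i]) (a c : R) : 0 < a ->
  a * (size rs)%:R < 1 -> 0 < c -> (forall z, K z -> rprod rs z < c) ->
  forall z, ~ K z -> z \notin rs ->
    a * (ln (rprod rs z) - ln c) <= V + logpot mu K z.
Proof.
move=> a0 an c0 Kc z0 nKz0 z0rs.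
pose D := [set z : R[i]^o | ~ K z /\ z \notin rs].
pose H (z : R[i]) := a * (ln (rprod rs z) - ln c) - logpot mu K z.
have openD z : D z -> \forall y \near (z : R[i]^o), D y.
  move=> [nKz zrs]; have oK : open (~` K) by apply: closed_openC; exact: compact_closedC.
  have n1 : nbhs (z : R[i]^o) (~` K) by exact: open_nbhs_nbhs.
  have n2 : \forall y \near (z : R[i]^o), - rprod rs y < 0.
    apply: (@cont_at_lt _ (fun y => - rprod rs y)); last by rewrite oppr_lt0 rprod_gt0.
    by move=> e e0; have := cont_atZ (-1) (cont_at_rprod rs z) e0;
      apply: filterS => y; rewrite !mulN1r.
  apply: filterS2 n1 n2 => y ? h; split => //.
  by move: h; rewrite oppr_lt0 -rprod_eq0 => h; rewrite gt_eqF.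
have contH z : D z -> cont_at H z.
  move=> [nKz zrs]; have [d d0 sz] := off_carrier nKz.
  have c1 := cont_atZ a (cont_atD (cont_at_ln_rprod zrs) (cont_at_cst (- ln c) z)).
  have c2 : cont_at (logpot mu K) z by exact: logpot_near mK bK d0 sz.
  move=> e e0; have := cont_atD c1 (cont_atZ (-1) c2) e0.
  by apply: filterS => y; rewrite /H !mulN1r.
have fourH z : D z -> four_mean H z.
  move=> [nKz zrs]; have [d d0 sz] := off_carrier nKz.
  have c1 := four_meanZ a (four_meanD (four_mean_ln_rprod zrs) (four_mean_cst (- ln c) z)).
  have [C C0 [r r0 h]] := four_meanD c1 (four_meanZ (-1) (logpot_four_mean mu mK bK d0 sz)).
  exists C => //; exists r => // k /h.
  by rewrite /H /sum4 !mulN1r.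
suff : (forall z, D z -> ((H z)%:E <= V%:E)%E).
  by move=> /(_ z0 (conj nKz0 z0rs)); rewrite lee_fin /H; lra.
apply: (@max_principle _ D (fun z => (H z)%:E) V) => //.
- move=> z Dz; split; first exact: ltry.
  move=> b; rewrite lte_fin => Hb; apply: filterS (cont_at_lt (contH _ Dz) Hb).
  by move=> y h _; rewrite lte_fin.
- move=> z e t Dz e0 [<-] h; apply: (four_mean_no_max (fourH _ Dz) e0).
  by apply: filterS h => y [_]; rewrite lee_fin.
- move=> z s' nDz Vs'.
  have [Kz|nKz] := pselect (K z).
    pose eta := (s' - V) / 2; have eta0 : 0 < eta by rewrite /eta; lra.
    have n1 := continuity_principle cK K0 M1 KM potK Kz eta0.
    have n2 := cont_at_lt (cont_at_rprod rs z) (Kc _ Kz).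
    apply: filterS2 n1 n2 => y h1 h2 [nKy yrs]; rewrite lte_fin /H.
    have h3 : ln (rprod rs y) <= ln c by apply: ln_le; [exact: rprod_gt0|exact: ltW].
    have h4 : a * (ln (rprod rs y) - ln c) <= 0 by rewrite pmulr_rle0// subr_le0.
    have := h1 nKy; rewrite /eta; lra.
  have zrs : z \in rs by apply: contra_notT nDz => zrs; split.
  have [d d0 sz] := off_carrier nKz.
  have n1 := logpot_near mu mK bK d0 sz ltr01.
  have n2 := ln_rprod_root (s' + (logpot mu K z - 1)) zrs a0 c0.
  apply: filterS2 n1 n2 => y h1 h2 [nKy yrs]; rewrite lte_fin /H.
  by move: h1; rewrite ltr_norml => /andP[h1 _]; have := h2 yrs; lra.
- move=> s' Vs'; have [B HB] := ln_rprod_far c s' a0 an.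
  exists (Num.max (2 * M) B) => y [nKy yrs].
  rewrite ge_max => /andP[yM yB]; rewrite lte_fin /H.
  by have := logpot_ge yM; have := HB _ yB yrs; lra.
Qed.

(* The case p = 1 of the Bernstein-Walsh estimate. *)
Lemma frostman_off (z : R[i]) : ~ K z -> - V <= logpot mu K z.
Proof.
move=> nKz; rewrite leNgt; apply/negP => h.
pose e := (- V - logpot mu K z) / 2; have e0 : 0 < e by rewrite /e; lra.
have a1 : 1 * (size ([::] : seq R[i]))%:R < 1 :> R by rewrite mulr0 ltr01.
have H w : K w -> rprod [::] w < expR e by rewrite /rprod big_nil expR_gt1.
have := bernstein_walsh_aux ltr01 a1 (expR_gt0 e) H nKz isT.
by rewrite /rprod big_nil ln1 expRK /e; lra.
Qed.

Lemma logpot_le_pot (z : R[i]) (r : R) : 0 < r -> ~ K z -> logpot mu K z <= pot mu K r z.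
Proof.
move=> r0 nKz; have [d d0 sz] := off_carrier nKz.
apply: le_Rintegral => //.
- exact: (integrable_logpot mu mK bK d0 sz).
- exact: (integrable_lgr mu z mK bK r0).
- move=> w Kw; apply: lgr_ge_ln; apply/eqP => zw; apply: nKz; rewrite zw//.
Qed.

Lemma pot_ge (z : R[i]) (r : R) : 0 < r -> - V <= pot mu K r z.
Proof.
move=> r0; have [Kz|nKz] := pselect (K z); first exact: potK.
exact: le_trans (frostman_off nKz) (logpot_le_pot r0 nKz).
Qed.

Lemma bernstein_walsh (rs : seq R[i]) (c r : R) : 0 < r ->
  (forall z, K z -> rprod rs z < c) ->
  forall z, rprod rs z <= c * expR ((size rs)%:R * (V + pot mu K r z)).
Proof.
move=> r0 Kc z.
have c0 : 0 < c by have [x Kx] := carrier_neq0 cK K0; apply: le_lt_trans (Kc _ Kx); exact: rprod_ge0.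
have [Kz|nKz] := pselect (K z).
  apply: le_trans (ltW (Kc _ Kz)) _; rewrite ler_peMr ?(ltW c0)//.
  rewrite -expR0 ler_expR mulr_ge0// addrC -lerBlDr sub0r; exact: potK.
have [zrs|zrs] := boolP (z \in rs).
  rewrite (eqP (_ : rprod rs z == 0)) ?rprod_eq0// mulr_ge0 ?expR_ge0// ltW//.
have lp := logpot_le_pot r0 nKz.
set n : R := (size rs)%:R; have n0 : 0 <= n by rewrite ler0n.
have key : ln (rprod rs z) - ln c <= n * (V + logpot mu K z).
  rewrite leNgt; apply/negP; set X := _ - _; set Y := V + _ => nYX.
  have aux a : 0 < a -> a * n < 1 -> a * X <= Y.
    by move=> a0 an; exact: (bernstein_walsh_aux a0 an c0 Kc nKz zrs).
  (* Without roots any a > 0 is admissible, and a large one refutes X > 0. *)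
  have [n0'|n1] := eqVneq n 0.
    have X0 : 0 < X by rewrite n0' mul0r in nYX.
    have a0 : 0 < (`|Y| + 1) / X by rewrite divr_gt0// ltr_wpDl.
    have := aux _ a0; rewrite n0' mulr0 => /(_ ltr01).
    by rewrite mulfVK ?gt_eqF//; have := ler_norm Y; lra.
  have {n1}np : 0 < n by rewrite lt_def n1.
  have Y0 : 0 <= Y by have := frostman_off nKz; rewrite /Y; lra.
  have X0 : 0 < X by apply: le_lt_trans nYX; rewrite mulr_ge0.
  (* With a = (1 - e) / n one gets (1 - e) X <= n Y, whereas (1 - e) X is the midpoint of X and n
     Y. *)
  pose e := (X - n * Y) / (2 * X).
  have e0 : 0 < e by rewrite divr_gt0 ?mulr_gt0// subr_gt0.
  have eX : e * (2 * X) = X - n * Y by rewrite mulfVK// gt_eqF// mulr_gt0.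
  have e1 : e < 1.
    rewrite -(@ltr_pM2r _ (2 * X)) ?mulr_gt0// eX.
    have : 0 <= n * Y by rewrite mulr_ge0.
    lra.
  have a0 : 0 < (1 - e) / n by rewrite divr_gt0// subr_gt0.
  have an : (1 - e) / n * n < 1 by rewrite mulfVK ?gt_eqF//; lra.
  have := aux _ a0 an; rewrite mulrAC ler_pdivrMr//; lra.
have h : ln (rprod rs z) <= ln c + n * (V + pot mu K r z).
  have : n * (V + logpot mu K z) <= n * (V + pot mu K r z) by rewrite ler_wpM2l// lerD2l.
  lra.
rewrite -ler_ln ?posrE ?rprod_gt0 ?mulr_gt0 ?expR_gt0// lnM ?posrE ?expR_gt0//.
by rewrite expRK.
Qed.

End bernstein_walsh.

(** * The untruncated potential *)

Section log_potential.
Context {R : realType}.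
Variables (mu : probability (borelC R) R) (K : set R[i]^o) (V M : R).
Hypotheses (cK : compact K) (K0 : mu (~` K) = 0%E) (M1 : 1 <= M).
Hypothesis KM : forall w, K w -> cabs w <= M.
Hypothesis potK : forall z r, K z -> 0 < r -> - V <= pot mu K r z.

Local Notation KB := (K : set (borelC R)).

Let mK : measurable KB. Proof. by apply: closed_measurableC; exact: compact_closedC. Qed.
Let bK : bounded_by M KB. Proof. exact: KM. Qed.

(** Built on [log_dist], whose value at z = w is -oo, so it is the true potential also on K, unlike
    [logpot]. The integral turns out finite for every z, so [fine] loses nothing. *)
Definition upot (z : R[i]) : R := fine (\int[mu]_(w in KB) log_dist z w)%E.

(** The summand 1 lets it dominate [lgr r z w] for all truncation radii r <= 1. *)
Let C (z : R[i]) : R := ln (cabs z + M + 1).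

Let logC z w r : K w -> 0 < r -> r <= 1 -> lgr r z w <= C z.
Proof.
move=> Kw r0 r1; apply: lgr_le => //.
  by have := cabs_ge0 z; move: M1; lra.
by have := cabsD z (- w); rewrite cabsN; have := KM Kw; lra.
Qed.

Let kernE z w r : K w -> 0 < r -> r <= 1 -> kern (C z) r z w = C z - lgr r z w.
Proof. by move=> Kw r0 r1; apply/max_idPr; rewrite subr_ge0 logC. Qed.

Let ekernE' (z w : R[i]) : K w -> ekern (C z) z w = ((C z)%:E - log_dist z w)%E.
Proof.
move=> Kw; apply/max_idPr; rewrite log_distE; case: eqP => [_|/eqP zw]; first by rewrite leey.
rewrite -EFinB lee_fin subr_ge0; apply: ln_le; first by rewrite lt_def zw cabs_ge0.
by have := cabsD z (- w); rewrite cabsN; have := KM Kw; lra.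
Qed.

Let int_kern z r : 0 < r -> r <= 1 ->
  (\int[mu]_(w in KB) (kern (C z) r z w)%:E = (C z - pot mu K r z)%:E)%E.
Proof.
move=> r0 r1; have Il := integrable_lgr mu z mK bK r0.
have Ic : mu.-integrable KB (EFin \o cst (C z)).
  by apply: (@bounded_integrable _ _ _ _ `|C z|).
have If : mu.-integrable KB (EFin \o (fun w => C z - lgr r z w)).
  by have := integrableB mK Ic Il; apply: eq_integrable.
transitivity (\int[mu]_(w in KB) (C z - lgr r z w)%:E)%E.
  by apply: eq_integral => w /set_mem Kw; rewrite kernE.
rewrite -[LHS]fineK; last exact: integrable_fin_num If.
congr (_%:E); rewrite -[LHS]/(Rintegral mu KB (fun w => C z - lgr r z w)).
by rewrite RintegralB// (Rintegral_cst_conull cK K0).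
Qed.

Let int_ekern z : (\int[mu]_(w in KB) (kern (C z) n.+1%:R^-1 z w)%:E)%E @[n --> \oo] -->
  (\int[mu]_(w in KB) ekern (C z) z w)%E.
Proof.
have -> : (\int[mu]_(w in KB) ekern (C z) z w = \int[mu]_(w in KB)
    limn (fun n => (kern (C z) n.+1%:R^-1 z w)%:E))%E.
  by apply: eq_integral => w _; apply/esym/cvg_lim => //; exact: cvg_kern.
apply: cvg_monotone_convergence => //.
- move=> n; apply/measurable_EFinP; apply: measurable_funTS.
  by apply: measurable_maxr => //; apply: measurable_funB => //; exact: measurable_lgr_r.
- by move=> n w _; rewrite lee_fin kern_ge0.
- move=> w _ n m nm; rewrite lee_fin kern_nonincr ?invr_gt0//.
  by rewrite lef_pV2 ?posrE// ler_nat.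
Qed.

Let inv1 n : 0 < n.+1%:R^-1 :> R /\ n.+1%:R^-1 <= 1 :> R.
Proof. by split; rewrite ?invr_gt0 ?invf_le1 ?ler1n. Qed.

Let ekern_ub z b : (forall r, 0 < r -> b <= pot mu K r z) ->
  (\int[mu]_(w in KB) ekern (C z) z w <= (C z - b)%:E)%E.
Proof.
move=> hb; have := int_ekern (z := z); move/cvg_lim => <- //.
apply: lime_le; first by apply/cvg_ex; eexists; exact: int_ekern.
apply: nearW => n; have [n0 n1] := inv1 n.
by rewrite int_kern// lee_fin lerB// hb.
Qed.

Let potge z r : 0 < r -> - V <= pot mu K r z.
Proof. exact: (pot_ge cK K0 M1 KM potK). Qed.

Let Iekern z : mu.-integrable KB (ekern (C z) z).
Proof.
apply/integrableP; split.
  by apply: measurable_funTS; exact: measurable_ekern_r.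
under eq_integral => w _ do rewrite gee0_abs ?ekern_ge0//.
apply: le_lt_trans (ekern_ub (fun r => @potge z r)) _; exact: ltry.
Qed.

Let Icst z : mu.-integrable KB (EFin \o cst (C z)).
Proof. by apply: (@bounded_integrable _ _ _ _ `|C z|). Qed.

Let log_distK (z w : R[i]) : K w -> log_dist z w = ((C z)%:E - ekern (C z) z w)%E.
Proof.
move=> Kw; rewrite ekernE'//; case: (log_dist z w) => [t||] //=.
by rewrite -!EFinB; congr (_%:E); ring.
Qed.

Lemma integrable_log_dist z : mu.-integrable KB (log_dist z).
Proof.
have := integrableB mK (Icst z) (Iekern z); apply: eq_integrable => // w /set_mem Kw.
by rewrite /= -log_distK.
Qed.

Let upotE (z : R[i]) : upot z = C z - fine (\int[mu]_(w in KB) ekern (C z) z w)%E.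
Proof.
have -> : upot z = fine (\int[mu]_(w in KB) ((EFin \o cst (C z)) w - ekern (C z) z w))%E.
  by congr fine; apply: eq_integral => w /set_mem Kw; rewrite /= -log_distK.
rewrite integralB// fineB ?(integrable_fin_num _ (Icst z)) ?(integrable_fin_num _ (Iekern z))//.
by congr (_ - _); exact: (Rintegral_cst_conull cK K0).
Qed.

Lemma integral_log_dist z : (\int[mu]_(w in KB) log_dist z w = (upot z)%:E)%E.
Proof. by rewrite fineK//; apply: integrable_fin_num => //; exact: integrable_log_dist. Qed.

(** Monotone convergence as r tends to 0. This is how bounds uniform in r reach the true potential,
    even on K. *)
Lemma le_upot z b : (forall r, 0 < r -> b <= pot mu K r z) -> b <= upot z.
Proof.
move=> /ekern_ub; rewrite -[X in (X <= _)%E -> _]fineK; last exact: integrable_fin_num (Iekern z).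
by rewrite lee_fin upotE; lra.
Qed.

Lemma upot_le_pot z r : 0 < r -> upot z <= pot mu K r z.
Proof.
move=> r0; rewrite -lee_fin -integral_log_dist /pot.
have Il := integrable_lgr mu z mK bK r0.
rewrite /Rintegral fineK; last exact: integrable_fin_num Il.
apply: le_integral => //; first exact: integrable_log_dist.
move=> w /set_mem _; rewrite log_distE; case: eqP => [_|/eqP zw]; first by rewrite leNye.
by rewrite lee_fin lgr_ge_ln// -subr_eq0 -cabs_eq0.
Qed.

Lemma upot_ge z : - V <= upot z.
Proof. by apply: le_upot => r; exact: potge. Qed.

(** The sum of potentials is the integral of ln|prod (w - z)|. For points equally spaced on a circle
    this plays the part of Fubini's theorem for the circle mean of the potential. If w is one of the
    points the integrand is -oo and the bound is trivial. *)
Lemma sum_upot_le (zs : seq R[i]) (g : borelC R -> R) :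
  mu.-integrable KB (EFin \o g) ->
  (forall w, K w -> rprod zs w <= expR (g w)) ->
  \sum_(z <- zs) upot z <= \int[mu]_(w in KB) g w.
Proof.
move=> Ig zg; rewrite -lee_fin /Rintegral fineK; last exact: integrable_fin_num Ig.
rewrite -sumEFin; under eq_bigr do rewrite -integral_log_dist.
rewrite -integral_sum//; last by move=> z; exact: integrable_log_dist.
apply: le_integral => //.
  by apply: integrable_sum => // z _; exact: integrable_log_dist.
move=> w /set_mem Kw; have {zg} := zg _ Kw.
have [wzs _|wzs] := boolP ((w : R[i]) \in zs).
  suff -> : (\sum_(z <- zs) log_dist z w = -oo)%E by rewrite leNye.
  apply/esum_eqNyP; exists (w : R[i]); split => //.
  by rewrite log_distE subrr cabs0 eqxx.
have -> : (\sum_(z <- zs) log_dist z w = (ln (rprod zs w))%:E)%E.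
  rewrite (ln_rprod wzs) -sumEFin !big_seq; apply: eq_bigr => z zzs.
  rewrite log_distE cabsC cabs_eq0 subr_eq0; case: eqP => // wz.
  by move: wzs; rewrite wz zzs.
by move=> h; rewrite lee_fin -[leRHS]expRK; apply: ln_le => //; exact: rprod_gt0.
Qed.

End log_potential.

(** * Jensen's formula and the upper bound *)

Section jensen.
Context {R : realType}.
Implicit Types (rs s : seq R[i]) (u a : R[i]) (rho r : R).

(* The N-th roots of rho^N stand in for the uniform measure on the circle of
   radius rho. *)
Definition circle_roots N rho s :=
  [/\ size s = N, forall x, x \in s -> cabs x = rho &
      forall a, \prod_(x <- s) (a - x) = a ^+ N - (rho ^+ N)%:C%C].

Lemma circle_roots_exist N rho : (0 < N)%N -> 0 < rho -> exists s, circle_roots N rho s.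
Proof.
move=> N0 r0; set p : {poly R[i]} := 'X^N - ((rho ^+ N)%:C%C)%:P.
have [s sE] := closed_field_poly_normal p.
rewrite lead_coefXnsubC// scale1r in sE.
exists s; split.
- by have := size_XnsubC ((rho ^+ N)%:C%C) N0; rewrite -/p sE size_prod_XsubC => -[].
- move=> x xs; have : root p x by rewrite sE root_prod_XsubC.
  rewrite /p /root !hornerE subr_eq0 => /eqP xN.
  have : cabs x ^+ N = rho ^+ N.
    by rewrite -cabsX xN cabs_real ger0_norm// exprn_ge0// ltW.
  by move/eqP; rewrite eqrXn2 ?cabs_ge0// ?(ltW r0)// => /eqP.
- move=> a; have : p.[a] = (\prod_(x <- s) ('X - x%:P)).[a] by rewrite -sE.
  rewrite horner_prod /p !hornerE => ->.
  by apply: eq_bigr => x _; rewrite !hornerE.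
Qed.

(** The geometric mean of |p| over the circle of radius rho around u, as Jensen's formula computes
    it. *)
Definition maxprod rho rs u : R := \prod_(a <- rs) Num.max rho (cabs (a - u)).

Lemma maxprod_gt0 rho rs u : 0 < rho -> 0 < maxprod rho rs u.
Proof. by move=> r0; apply: prodr_gt0 => a _; rewrite lt_max r0. Qed.

Lemma maxprod_le r rho rs u : 0 < r -> r <= rho -> maxprod r rs u <= maxprod rho rs u.
Proof.
move=> r0 rr; apply: ler_prod => a _.
by rewrite le_max (ltW r0) /= ge_max !le_max rr lexx orbT.
Qed.

Lemma exp_small (t : R) : 0 <= t -> t < 1 -> \forall N \near \oo, t ^+ N <= 1 / 2.
Proof.
move=> t0 t1; have t1' : `|t| < 1 by rewrite ger0_norm.
have /cvgrPdist_le := cvg_expr t1'.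
move=> /(_ (1 / 2)); rewrite divr_gt0// => /(_ isT); apply: filterS => N.
by rewrite sub0r normrN ger0_norm// exprn_ge0.
Qed.

(** The product over the N points equals prod_a |(a - u)^N - rho^N|. As |a - u| differs from rho,
    for large N the smaller of the two powers is at most half the larger, which costs a factor 1/2
    per root. *)
Lemma jensen_lower rs u rho : 0 < rho ->
  (forall a, a \in rs -> cabs (a - u) != rho) ->
  \forall N \near \oo, forall s, circle_roots N rho s ->
    (1 / 2) ^+ size rs * maxprod rho rs u ^+ N <= \prod_(x <- s) rprod rs (u + x).
Proof.
move=> r0 nrs.
have factor a : a \in rs -> \forall N \near \oo,
    1 / 2 * Num.max rho (cabs (a - u)) ^+ N <= cabs ((a - u) ^+ N - (rho ^+ N)%:C%C).
  move=> ars; set b := a - u; have bne := nrs _ ars; rewrite -/b in bne.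
  pose mx := Num.max rho (cabs b); pose mn := Num.min rho (cabs b).
  have mx0 : 0 < mx by rewrite lt_max r0.
  have mnmx : mn < mx.
    rewrite /mn /mx; case: (ltgtP rho (cabs b)) bne => // ->; rewrite eqxx.
  have mn0 : 0 <= mn by rewrite le_min (ltW r0) cabs_ge0.
  have t0 : 0 <= mn / mx by rewrite divr_ge0// ltW.
  have t1 : mn / mx < 1 by rewrite ltr_pdivrMr// mul1r.
  apply: filterS (exp_small t0 t1) => N; rewrite expr_div_n ler_pdivrMr ?exprn_gt0// => h.
  have h2 : mx ^+ N - mn ^+ N <= `|cabs (b ^+ N) - cabs ((rho ^+ N)%:C%C)|.
    rewrite cabsX cabs_real [`|rho ^+ N|]ger0_norm ?exprn_ge0 ?(ltW r0)//.
    rewrite /mx /mn; case: (leP rho (cabs b)) => _; first exact: ler_norm.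
    by rewrite distrC ler_norm.
  apply: le_trans (le_trans h2 (cabs_dist _ _)); rewrite -/mx; lra.
have all_factors : \forall N \near \oo, forall a, a \in rs ->
    1 / 2 * Num.max rho (cabs (a - u)) ^+ N <= cabs ((a - u) ^+ N - (rho ^+ N)%:C%C).
  elim: rs {nrs} factor => [|a rs IH] H; first exact: nearW.
  have Ha := H a (mem_head _ _).
  have Hrs : \forall N \near \oo, forall b, b \in rs ->
    1 / 2 * Num.max rho (cabs (b - u)) ^+ N <= cabs ((b - u) ^+ N - (rho ^+ N)%:C%C).
    by apply: IH => b brs; apply: H; rewrite in_cons brs orbT.
  apply: filterS2 Ha Hrs => N h1 h2 b; rewrite in_cons => /predU1P[->//|]; exact: h2.
apply: filterS all_factors => N hN s [_ _ sP].
have -> : \prod_(x <- s) rprod rs (u + x) =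
    \prod_(a <- rs) cabs ((a - u) ^+ N - (rho ^+ N)%:C%C).
  rewrite /rprod exchange_big /=; apply: eq_bigr => a _.
  rewrite -sP cabs_prod; apply: eq_bigr => x _.
  by rewrite -cabsN; congr cabs; ring.
have -> : (1 / 2) ^+ size rs * maxprod rho rs u ^+ N =
    \prod_(a <- rs) (1 / 2 * Num.max rho (cabs (a - u)) ^+ N).
  by rewrite big_split /= prodrXl big_const_seq count_predT iter_mulr_1.
rewrite !big_seq; apply: ler_prod => a ars; rewrite hN//.
by rewrite mulr_ge0// exprn_ge0// le_max (ltW r0).
Qed.

Lemma circle_prod_le N rho s u (w : R[i]) : 0 < rho -> circle_roots N rho s ->
  rprod [seq u + x | x <- s] w <= 2 * Num.max rho (cabs (u - w)) ^+ N.
Proof.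
move=> r0 [_ _ sP]; rewrite /rprod big_map.
have -> : \prod_(x <- s) cabs (w - (u + x)) = cabs ((w - u) ^+ N - (rho ^+ N)%:C%C).
  by rewrite -sP cabs_prod; apply: eq_bigr => x _; congr cabs; ring.
apply: le_trans (cabsD _ _) _; rewrite cabsN cabsX cabs_real ger0_norm ?exprn_ge0 ?(ltW r0)//.
have h1 : cabs (w - u) ^+ N <= Num.max rho (cabs (u - w)) ^+ N.
  by rewrite lerXn2r ?nnegrE ?cabs_ge0 ?le_max ?(ltW r0)// (cabsC w) lexx orbT.
have h2 : rho ^+ N <= Num.max rho (cabs (u - w)) ^+ N.
  by rewrite lerXn2r ?nnegrE ?le_max ?(ltW r0)// lexx.
lra.
Qed.

(** Provides circles of nearly the prescribed radius that carry no root. *)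
Lemma avoid_finite (l : seq R) (a b : R) : a < b ->
  exists x y : R, [/\ a <= x, x < y, y <= b & forall t, x < t -> t < y -> t \notin l].
Proof.
elim: l a b => [|c l IH] a b ab; first by exists a, b; split.
have [x [y [ax xy yb H]]] := IH a b ab.
pose m := (x + y) / 2.
have [cm|mc] := leP c m.
  exists m, y; split => //; rewrite /m in cm *; try lra.
  move=> t mt ty; rewrite in_cons negb_or H// ?andbT; last by lra.
  by rewrite gt_eqF//; lra.
exists x, m; split => //; rewrite /m in mc *; try lra.
move=> t xt tm; rewrite in_cons negb_or H// ?andbT; last by lra.
by rewrite lt_eqF//; lra.
Qed.

(* A discrete form of Jensen's formula on circles of radius in ]r, r'[. *)
Lemma jensen_bound rs u (r r' L : R) : 0 < r -> r < r' ->
  (forall rho, r < rho -> rho < r' -> exists D : R, forall N s, (0 < N)%N -> circle_roots N rho s ->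
     \prod_(x <- s) rprod rs (u + x) <= expR (N%:R * L + D)) ->
  maxprod r rs u <= expR L.
Proof.
move=> r0 rr' H.
have [x [y [rx xy yr' Hxy]]] := avoid_finite [seq cabs (a - u) | a <- rs] rr'.
pose rho := (x + y) / 2.
have rho1 : x < rho by rewrite /rho; lra.
have rho2 : rho < y by rewrite /rho; lra.
have rho_gt : r < rho by lra.
have rho0 : 0 < rho by lra.
apply: (le_trans (maxprod_le _ _ r0 (ltW rho_gt))).
have nrs a : a \in rs -> cabs (a - u) != rho.
  move=> ars; have := Hxy _ rho1 rho2; apply: contraNneq => <-.
  by apply/mapP; exists a.
have [D HD] := H _ rho_gt (lt_le_trans rho2 yr').
rewrite leNgt; apply/negP => hlt.
set P := maxprod rho rs u in hlt; have P0 : 0 < P by exact: maxprod_gt0.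
have lP : L < ln P by rewrite -[L]expRK ltr_ln ?posrE ?expR_gt0.
(* Beyond B the gap N (ln P - L) exceeds the terms that do not grow with N, namely D and the loss of
   ln 2 per root. *)
pose B := (D + (size rs)%:R * ln 2) / (ln P - L).
near \oo => N.
have N0 : (0 < N)%N by near: N; exact: nbhs_infty_gt.
have [s sP] := circle_roots_exist N0 rho0.
have h1 : (1 / 2) ^+ size rs * P ^+ N <= \prod_(x <- s) rprod rs (u + x).
  move: s sP; near: N; exact: jensen_lower.
have h2 := le_trans h1 (HD _ _ N0 sP).
have NB : B < N%:R by near: N; exact: nbhs_infty_gtr.
have h3 : N%:R * ln P - (size rs)%:R * ln 2 <= N%:R * L + D.
  rewrite -[leRHS]expRK; apply: le_trans (ln_le _ h2).
    rewrite lnM ?posrE ?exprn_gt0// lnXn// lnXn// div1r lnV ?posrE//.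
    by rewrite -[X in _ <= X + _]mulr_natl -[X in _ <= _ + X]mulr_natl mulrN addrC.
  by rewrite mulr_gt0 ?exprn_gt0.
move: NB; rewrite /B ltr_pdivrMr ?subr_gt0//; lra.
Unshelve. all: by end_near. Qed.

End jensen.

Section factor_upper_bound.
Context {R : realType}.
Variables (mu : probability (borelC R) R) (K : set R[i]^o) (V M : R).
Hypotheses (cK : compact K) (K0 : mu (~` K) = 0%E) (M1 : 1 <= M).
Hypothesis KM : forall w, K w -> cabs w <= M.
Hypothesis potK : forall z r, K z -> 0 < r -> - V <= pot mu K r z.

Local Notation KB := (K : set (borelC R)).

Let mK : measurable KB. Proof. by apply: closed_measurableC; exact: compact_closedC. Qed.
Let bK : bounded_by M KB. Proof. exact: KM. Qed.

Lemma bernstein_walsh_upot (rs : seq R[i]) (c : R) : 0 < c ->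
  (forall z, K z -> rprod rs z < c) ->
  forall z, rprod rs z <= c * expR ((size rs)%:R * (V + upot mu K z)).
Proof.
move=> c0 Kc z; have BW r r0 := @bernstein_walsh _ mu K V M cK K0 M1 KM potK rs c r r0 Kc z.
have [zrs|zrs] := boolP (z \in rs).
  by rewrite (eqP (_ : rprod rs z == 0)) ?rprod_eq0// mulr_ge0 ?expR_ge0// ltW.
have [n0|n0] := eqVneq (size rs) 0%N.
  by have := BW 1 ltr01; rewrite n0 !mul0r.
have np : 0 < (size rs)%:R :> R by rewrite ltr0n lt0n.
have rp : 0 < rprod rs z by exact: rprod_gt0.
(* Solved for the potential, the estimate becomes a lower bound that is uniform in r, as [le_upot]
   requires. *)
have lnE y : (rprod rs z <= c * expR ((size rs)%:R * (V + y))) =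
    ((ln (rprod rs z) - ln c) / (size rs)%:R - V <= y).
  rewrite -ler_ln ?posrE ?mulr_gt0 ?expR_gt0// lnM ?posrE ?expR_gt0// expRK.
  by rewrite -lerBlDl mulrC -ler_pdivrMr// -lerBlDl.
rewrite lnE; apply: (le_upot cK K0 M1 KM potK) => r r0; rewrite -lnE; exact: BW.
Qed.

Lemma pot_scale (r rho : R) (u : R[i]) : 0 < r -> r <= rho ->
  pot mu K rho u <= pot mu K r u + ln (rho / r).
Proof.
move=> r0 rr; have rho0 := lt_le_trans r0 rr.
have I1 := integrable_lgr mu u mK bK rho0; have I2 := integrable_lgr mu u mK bK r0.
have Ic : mu.-integrable KB (EFin \o cst (ln (rho / r))).
  by apply: (@bounded_integrable _ _ _ _ `|ln (rho / r)|).
rewrite -[X in _ + X](Rintegral_cst_conull cK K0) -RintegralD//.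
apply: le_Rintegral => //.
  by have := integrableD mK I2 Ic; apply: eq_integrable.
move=> w _; have q0 : 0 < rho / r by rewrite divr_gt0.
rewrite /lgr -lnM ?posrE//; last by rewrite lt_max r0.
apply: ln_le; first by rewrite lt_max rho0.
rewrite maxr_pMl ?(ltW q0)// ge_max !le_max mulrC divfK ?gt_eqF// lexx /=.
apply/orP; right; rewrite mulrC ler_peMl ?cabs_ge0//.
by rewrite ler_pdivlMr// mul1r.
Qed.

Lemma maxprod_upper (rs : seq R[i]) (c : R) (u : R[i]) : 0 < c ->
  (forall z, K z -> rprod rs z < c) ->
  maxprod 1 rs u <= c * expR ((size rs)%:R * (V + pot mu K 1 u)).
Proof.
move=> c0 Kc; set n : R := (size rs)%:R; set X := n * _.
have n0 : 0 <= n by rewrite ler0n.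
(* The radii range over ]1, e^d[ to leave room for avoiding roots. By [pot_scale], going back to
   radius 1 costs d per root. *)
have H d : 0 < d -> maxprod 1 rs u <= expR (ln c + X + n * d).
  move=> d0; have e1 : 1 < expR d by rewrite expR_gt1.
  apply: (jensen_bound ltr01 e1) => rho rho1 rhod.
  have rho0 : 0 < rho by lra.
  (* The factor 2 of [circle_prod_le] occurs once for all N points together, so its contribution
     does not grow with N. *)
  exists (n * ln 2) => N s N0 sP.
  have h1 : \prod_(x <- s) rprod rs (u + x) <=
      \prod_(x <- s) (c * expR (n * (V + upot mu K (u + x)))).
    by apply: ler_prod => x _; rewrite rprod_ge0 bernstein_walsh_upot.
  apply: le_trans h1 _.
  have -> : \prod_(x <- s) (c * expR (n * (V + upot mu K (u + x)))) =
      expR (\sum_(x <- s) (ln c + n * (V + upot mu K (u + x)))).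
    by rewrite expR_sum; apply: eq_bigr => x _; rewrite expRD lnK ?posrE.
  rewrite ler_expR big_split /= -mulr_sumr big_split /= !big_const_seq !count_predT.
  rewrite !iter_addr_0; have [-> _ _] := sP.
  have := @sum_upot_le _ mu K V M cK K0 M1 KM potK [seq u + x | x <- s]
    (fun w => ln 2 + N%:R * lgr rho u w).
  have Il := integrable_lgr mu u mK bK rho0.
  have INl : mu.-integrable KB (EFin \o (fun w => N%:R * lgr rho u w)).
    by have := integrableZl mK N%:R Il; apply: eq_integrable.
  have I2 : mu.-integrable KB (EFin \o cst (ln 2)).
    by apply: (@bounded_integrable _ _ _ _ `|ln 2|).
  have Ig : mu.-integrable KB (EFin \o (fun w => ln 2 + N%:R * lgr rho u w)).
    by have := integrableD mK I2 INl; apply: eq_integrable.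
  move=> /(_ Ig); rewrite RintegralD// (Rintegral_cst_conull cK K0) RintegralZl//.
  have gw w : K w -> rprod [seq u + x | x <- s] w <= expR (ln 2 + N%:R * lgr rho u w).
    move=> _; apply: le_trans (circle_prod_le _ _ rho0 sP) _.
    by rewrite expRD lnK ?posrE// ler_pM2l// mulr_natl /lgr -lnXn ?lt_max ?rho0// lnK// posrE exprn_gt0// lt_max rho0.
  move=> /(_ gw); rewrite big_map => h2.
  have := pot_scale u ltr01 (ltW rho1); rewrite divr1 => h3.
  have h4 : ln rho <= d by rewrite -[leRHS]expRK; apply: ln_le => //; exact: ltW.
  rewrite -[ln c *+ N]mulr_natl -[V *+ N]mulr_natl mulrDr /X.
  rewrite -/(pot mu K rho u) in h2.
  have h5 : N%:R * pot mu K rho u <= N%:R * (pot mu K 1 u + d).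
    by rewrite ler_wpM2l ?ler0n//; lra.
  have h6 : n * (\sum_(x <- s) upot mu K (u + x)) <= n * (ln 2 + N%:R * (pot mu K 1 u + d)).
    by rewrite ler_wpM2l//; lra.
  have -> : N%:R * (ln c + n * (V + pot mu K 1 u) + n * d) + n * ln 2 =
    N%:R * ln c + (n * (N%:R * V) + n * (ln 2 + N%:R * (pot mu K 1 u + d))) by ring.
  by rewrite lerD2l lerD2l.
have P0 := @maxprod_gt0 _ 1 rs u ltr01.
have -> : c * expR X = expR (ln c + X) by rewrite expRD lnK ?posrE.
rewrite -[leLHS]lnK ?posrE// ler_expR; apply/ler_addgt0Pr => e e0.
have n1 : 0 < n + 1 by lra.
have ed : 0 < e / (n + 1) by rewrite divr_gt0.
have := H _ ed; rewrite -[leLHS]lnK ?posrE// ler_expR => /le_trans; apply.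
rewrite lerD2l mulrA ler_pdivrMr//; nra.
Qed.

End factor_upper_bound.

(** * Transfinite diameter *)

Section diagonal_subsequence.
Context {R : realType}.

(** An ultrafilter finer than the tails yields all the limits at once. The index for k is then
    chosen so that the sequences 0, ..., k are within 1/(k+1) of theirs. *)
Lemma diagonal_subsequence (a : nat -> nat -> R) :
  (forall i n, 0 <= a i n <= 1) ->
  exists (phi : nat -> nat) (l : nat -> R), (forall k, (k <= phi k)%N) /\
    forall i (e : R), 0 < e -> exists L, forall k, (L <= k)%N -> `|a i (phi k) - l i| < e.
Proof.
move=> a01.
have [G [GU Goo]] := @ultraFilterLemma nat \oo _.
have GF : ProperFilter G by exact: ultra_proper.
have lim i : exists l, forall e : R, 0 < e -> G [set n | `|a i n - l| < e].
  have [|l [_ cl]] := @segment_compact R 0 1 (a i @ G) (fmap_proper_filter _ _).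
    by apply: nearW => n; rewrite /= in_itv /=.
  exists l => e e0.
  have [//|Gc] := in_ultra_setVsetC [set n | `|a i n - l| < e] GU.
  have [||x [/= xe]] := cl [set x | ~ (`|x - l| < e)] (ball l e) => //.
    by apply: nbhsx_ballx.
  by rewrite -ball_normE /= distrC.
have [l lP] := choice lim.
have Gk k : exists n, (k <= n)%N /\ forall i, (i <= k)%N -> `|a i n - l i| < k.+1%:R^-1.
  have e0 : 0 < k.+1%:R^-1 :> R by rewrite invr_gt0.
  have H m : G [set n | forall i, (i < m)%N -> `|a i n - l i| < k.+1%:R^-1].
    elim: m => [|m IH]; first by apply: nearW => n i.
    apply: filterS2 IH (lP m _ e0) => n h1 h2 i; rewrite ltnS leq_eqVlt.
    by case/predU1P => [->//|]; exact: h1.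
  have H2 : G [set n | (k <= n)%N] by apply: Goo; exact: nbhs_infty_ge.
  by have [n [h1 h2]] := filter_ex (filterI H2 (H k.+1)); exists n.
have [phi phiP] := choice Gk.
exists phi, l; split=> [k|i e e0]; first by have [] := phiP k.
have [L _ HL] := near_infty_natSinv_lt (PosNum e0).
exists (maxn i L) => k; rewrite geq_max => /andP[ik Lk].
have [_ /(_ i ik) h] := phiP k; apply: lt_trans h _; exact: HL.
Qed.

End diagonal_subsequence.

Lemma mixed_radix_inj (a b c d e : nat) : (c < e)%N -> (d < e)%N ->
  (a * e + c = b * e + d)%N -> a = b /\ c = d.
Proof.
move=> ce de h; have e0 : (0 < e)%N by apply: leq_ltn_trans ce.
have ab : a = b.
  have := congr1 (fun t => t %/ e)%N h.
  by rewrite !divnMDl// !divn_small// !addn0.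
by split => //; move: h; rewrite ab => /addnI.
Qed.

(** * Ordering the points of a square by nested grids *)

Section keys.
Context {R : realType}.
Variable M : R.
Hypothesis M0 : 0 < M.
Implicit Types z w : R[i].

Definition cell (k : nat) (x : R) : nat := Num.trunc (k.+1%:R * (x + M)).
Definition ncell (k : nat) : nat := (Num.trunc (k.+1%:R * (2 * M) : R)).+1.
Definition idx k z : nat := (cell k (complex.Re z) * ncell k + cell k (complex.Im z))%N.

(* Lexicographic order of the cells of z in finer and finer grids. *)
Fixpoint key (k : nat) z : nat :=
  if k is k'.+1 then (key k' z * (ncell k' * ncell k') + idx k' z)%N else 0%N.

Fixpoint nkey (k : nat) : nat :=
  if k is k'.+1 then (nkey k' * (ncell k' * ncell k'))%N else 1%N.

Lemma cell_lt k x : x <= M -> (cell k x < ncell k)%N.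
Proof.
move=> xM; rewrite ltnS; apply: le_truncn; rewrite ler_wpM2l//; lra.
Qed.

Lemma idx_lt k z : cabs z <= M -> (idx k z < ncell k * ncell k)%N.
Proof.
move=> zM; have h1 : complex.Re z <= M by have := Re_le_cabs z; rewrite ler_norml; lra.
have h2 : complex.Im z <= M by have := Im_le_cabs z; rewrite ler_norml; lra.
have := cell_lt k h1; have := cell_lt k h2; rewrite /idx.
move: (cell _ _) (cell _ _) (ncell k) => a b c; nia.
Qed.

Lemma key_lt k z : cabs z <= M -> (key k z < nkey k)%N.
Proof.
move=> zM; elim: k => [//|k IH] /=; have := idx_lt k zM; move: IH.
move: (key _ _) (nkey _) (idx _ _) (_ * _)%N => a b c d; nia.
Qed.

Lemma key_ltS k z w : cabs z <= M -> cabs w <= M ->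
  (key k z < key k w)%N -> (key k.+1 z < key k.+1 w)%N.
Proof.
move=> zM wM /=; have := idx_lt k zM; have := idx_lt k wM.
move: (key _ _) (key _ _) (idx _ _) (idx _ _) (_ * _)%N => a b c d e; nia.
Qed.

Lemma cell_eq k x y : - M <= x -> - M <= y -> cell k x = cell k y ->
  `|x - y| <= k.+1%:R^-1.
Proof.
move=> xM yM; have H t : - M <= t -> (cell k t)%:R <= k.+1%:R * (t + M) < (cell k t).+1%:R.
  by move=> tM; apply: truncn_itv; rewrite mulr_ge0//; lra.
have := H _ xM; have := H _ yM; rewrite -(addn1 (cell k x)) -(addn1 (cell k y)).
have q0 : 0 < k.+1%:R :> R by [].
move: (k.+1%:R : R) q0 => q q0 + + e; rewrite e !natrD => /andP[h1 h2] /andP[h3 h4].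
rewrite -[X in _ <= X]mul1r ler_pdivlMr// mulrC -{1}[q]gtr0_norm// -normrM.
rewrite ler_norml mulrBr; apply/andP; split; nra.
Qed.

Lemma key_eq k z w : cabs z <= M -> cabs w <= M -> key k.+1 z = key k.+1 w ->
  cabs (z - w) <= 2 / k.+1%:R.
Proof.
move=> zM wM /= kzw.
have iz := idx_lt k zM; have iw := idx_lt k wM.
have [kE iE] := mixed_radix_inj iz iw kzw.
have bnd t : cabs t <= M -> [/\ - M <= complex.Re t, complex.Re t <= M,
     - M <= complex.Im t & complex.Im t <= M].
  by move=> tM; have := Re_le_cabs t; have := Im_le_cabs t; rewrite !ler_norml; split; lra.
have [z1 z2 z3 z4] := bnd _ zM; have [w1 w2 w3 w4] := bnd _ wM.
have [cR cI] : cell k (complex.Re z) = cell k (complex.Re w) /\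
    cell k (complex.Im z) = cell k (complex.Im w).
  exact: mixed_radix_inj (cell_lt k z4) (cell_lt k w4) iE.
have := cell_eq z1 w1 cR; have := cell_eq z3 w3 cI => h1 h2.
apply: le_trans (cabs_le_ReIm _) _.
have -> : complex.Re (z - w) = complex.Re z - complex.Re w by case: (z) (w) => [? ?] [? ?].
have -> : complex.Im (z - w) = complex.Im z - complex.Im w by case: (z) (w) => [? ?] [? ?].
by rewrite (_ : 2 / _ = k.+1%:R^-1 + k.+1%:R^-1 :> R) ?lerD//; ring.
Qed.

End keys.

Section step_functions.
Context {R : realType}.
Variable M : R.
Hypothesis M0 : 0 < M.
Implicit Types (z w : R[i]) (s : seq R[i]) (t : R).

Definition lek z w : bool := `[< forall k, (key M k z <= key M k w)%N >].

Lemma lek_refl : reflexive lek.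
Proof. by move=> z; apply/asboolP => k. Qed.

Lemma lek_trans : transitive lek.
Proof.
move=> y x z /asboolP xy /asboolP yz; apply/asboolP => k.
exact: leq_trans (xy k) (yz k).
Qed.

(** A strict inequality of keys at one level persists at all finer levels, so two points cannot be
    ordered differently at two levels. *)
Lemma lek_total : {in [pred z | cabs z <= M] &, total lek}.
Proof.
move=> z w zM wM; rewrite !inE in zM wM.
have ltn_mono a b k m : cabs a <= M -> cabs b <= M -> (k <= m)%N ->
    (key M k a < key M k b)%N -> (key M m a < key M m b)%N.
  move=> aM bM /subnK <-; elim: (m - k)%N => [//|i IH] h; rewrite addSn.
  by apply: key_ltS => //; exact: IH.
apply/orP; have [h|/existsNP[k /negP]] := pselect (forall k, (key M k z <= key M k w)%N).
  by left; apply/asboolP.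
rewrite -ltnNge => hk; right; apply/asboolP => m.
have [km|/ltnW mk] := leqP k m; first exact: ltnW (ltn_mono _ _ _ _ wM zM km hk).
rewrite leqNgt; apply/negP => /(ltn_mono _ _ _ _ zM wM mk).
by rewrite ltnNge (ltnW hk).
Qed.

(* The points of s, sorted by keys, listed over [0, 1[: the limit of these step
   functions transports the Lebesgue measure to a limit of counting measures. *)
Definition stepf s t : R[i] := nth 0 s (Num.trunc ((size s)%:R * t)).

(** For sorted s, the proportion of points with level-k key below j: the distribution function of
    the keys. When no key reaches j, [find] returns the size and the value is 1. *)
Definition mfrac s k j : R :=
  (find (fun z => (j <= key M k z)%N) s)%:R / (size s)%:R.

Lemma mfrac01 s k j : 0 <= mfrac s k j <= 1.
Proof.
rewrite /mfrac divr_ge0//=; case: (posnP (size s)) => [->|s0].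
  by rewrite invr0 mulr0.
by rewrite ler_pdivrMr ?ltr0n// mul1r ler_nat find_size.
Qed.

Lemma trunc_lt_size s t : (0 < size s)%N -> 0 <= t -> t < 1 ->
  (Num.trunc ((size s)%:R * t) < size s)%N.
Proof.
move=> s0 t0 t1; rewrite truncn_lt_nat ?mulr_ge0//.
by rewrite -[ltRHS]mulr1 ltr_pM2l// ltr0n.
Qed.

Lemma key_stepf s k j t : sorted lek s -> (0 < size s)%N -> 0 <= t -> t < 1 ->
  (key M k (stepf s t) < j)%N = (t < mfrac s k j).
Proof.
move=> ss s0 t0 t1; have ts := trunc_lt_size s0 t0 t1.
rewrite /mfrac ltr_pdivlMr ?ltr0n// mulrC -truncn_lt_nat ?mulr_ge0//.
rewrite /stepf; set i := Num.trunc _ in ts *; set m := find _ _.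
have [im|mi] := ltnP i m.
  by have := before_find 0 im; rewrite leqNgt => /negbFE.
have ms : (m < size s)%N by apply: leq_ltn_trans mi ts.
have := nth_find 0 (_ : has (fun z => (j <= key M k z)%N) s).
rewrite has_find ms => /(_ isT) h.
have /asboolP/(_ k) := sorted_leq_nth lek_trans lek_refl 0 ss m i ms ts mi.
by move=> h2; apply/negbTE; rewrite -leqNgt; apply: leq_trans h2.
Qed.

Lemma stepf_mem s t : (0 < size s)%N -> 0 <= t -> t < 1 -> stepf s t \in s.
Proof. by move=> s0 t0 t1; apply: mem_nth; exact: trunc_lt_size. Qed.

(** Along a subsequence all the numbers [mfrac] converge. If t is none of their limits, every
    comparison of t with them is eventually constant, so the cell of the step function at t
    stabilises at each level and the values are Cauchy. The excluded t are countably many. *)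
Lemma stepf_converge (E : set R[i]^o) (ss : nat -> seq R[i]) :
  compact E -> (forall z, E z -> cabs z <= M) ->
  (forall n, (0 < size (ss n))%N) -> (forall n z, z \in ss n -> E z) ->
  (forall n, sorted lek (ss n)) ->
  exists (phi : nat -> nat) (f : R -> R[i]) (Q : set R),
    [/\ forall k, (k <= phi k)%N, countable Q, forall t, E (f t) &
        forall t, 0 <= t -> t < 1 -> ~ Q t -> forall e : R, 0 < e ->
          exists L, forall l, (L <= l)%N -> cabs (stepf (ss (phi l)) t - f t) < e].
Proof.
move=> cE EM s0 sE ssort.
(* Enumerates the pairs (level, key). Codes that decode to nothing fall back on (0, 0), which is
   harmless. *)
pose a (i n : nat) := let kj := odflt (0%N, 0%N) (unpickle i) in mfrac (ss n) kj.1 kj.2.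
have [phi [q [phik qP]]] := diagonal_subsequence (a := a) (fun i n => mfrac01 _ _ _).
pose Q := range q.
have cauchy t : 0 <= t -> t < 1 -> ~ Q t -> forall e : R, 0 < e ->
   exists L, forall l l', (L <= l)%N -> (L <= l')%N ->
     cabs (stepf (ss (phi l)) t - stepf (ss (phi l')) t) < e.
  move=> t0 t1 nQ e e0.
  have e20 : 0 < e / 2 by rewrite divr_gt0.
  have [k _ /(_ k (leqnn k))/= Hk] := near_infty_natSinv_lt (PosNum e20).
  have stab J : exists L, forall l, (L <= l)%N -> forall j, (j <= J)%N ->
      (t < mfrac (ss (phi l)) k.+1 j) = (t < q (pickle (k.+1, j))).
    have one j : exists L, forall l, (L <= l)%N ->
        (t < mfrac (ss (phi l)) k.+1 j) = (t < q (pickle (k.+1, j))).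
      set i := pickle (k.+1, j).
      have tq : t != q i by apply/eqP => tq; apply: nQ; exists i.
      have d0 : 0 < `|t - q i| by rewrite normr_gt0 subr_eq0.
      have [L HL] := qP i _ d0; exists L => l /HL; rewrite /a /i pickleK /=.
      rewrite ltr_norml => /andP[h1 h2]; rewrite -/i in h1 h2 *.
      have [tqi|qit] := ltP t (q i).
        by rewrite ltr0_norm ?subr_lt0// in h1 h2; lra.
      by rewrite ger0_norm ?subr_ge0// in h1 h2; apply/negbTE; rewrite -leNgt; lra.
    elim: J => [|J [L1 H1]].
      by have [L HL] := one 0%N; exists L => l /HL h j; rewrite leqn0 => /eqP ->.
    have [L2 H2] := one J.+1; exists (maxn L1 L2) => l.
    rewrite geq_max => /andP[l1 l2] j; rewrite leq_eqVlt => /predU1P[->|]; first exact: H2.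
    by rewrite ltnS; exact: H1.
  have [L HL] := stab (nkey M k.+1); exists L => l l' Ll Ll'.
  set z := stepf _ _; set w := stepf _ _.
  have Ez : cabs z <= M by apply: EM; apply: sE; exact: stepf_mem.
  have Ew : cabs w <= M by apply: EM; apply: sE; exact: stepf_mem.
  have iff j : (j <= nkey M k.+1)%N -> (key M k.+1 z < j)%N = (key M k.+1 w < j)%N.
    by move=> jk; rewrite !key_stepf// !HL.
  have kE : key M k.+1 z = key M k.+1 w.
    case: (ltngtP (key M k.+1 z) (key M k.+1 w)) => // h.
      by have := iff _ (ltnW (key_lt M0 k.+1 Ew)); rewrite h ltnn.
    by have := iff _ (ltnW (key_lt M0 k.+1 Ez)); rewrite h ltnn.
  apply: le_lt_trans (key_eq M0 Ez Ew kE) _.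
  by rewrite mulrC -ltr_pdivlMr.
have [e0 Ee0] : E !=set0.
  exists (nth 0 (ss 0%N) 0); apply: (sE 0%N); exact: mem_nth.
have lim t : exists p, E p /\ (0 <= t -> t < 1 -> ~ Q t -> forall e : R, 0 < e ->
    exists L, forall l, (L <= l)%N -> cabs (stepf (ss (phi l)) t - p) < e).
  have [[[t0 t1] nQ]|nt] := pselect ((0 <= t /\ t < 1) /\ ~ Q t); last first.
    by exists e0; split=> // t0 t1 nQ; case: nt.
  have [|p [Ep cl]] := cE ((fun l => stepf (ss (phi l)) t : R[i]^o) @ \oo) (fmap_proper_filter _ _).
    exists 0%N => // l _; apply: (sE (phi l)); exact: stepf_mem.
  exists p; split => // _ _ _ e e0'.
  have e2 : 0 < e / 2 by rewrite divr_gt0.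
  have [L HL] := cauchy t t0 t1 nQ _ e2; exists L => l Ll.
  have n1 : nbhs (p : R[i]^o) [set y : R[i]^o | cabs (y - p) < e / 2].
    by apply/nbhsCP; exists (e / 2).
  have n2 : ((fun l => stepf (ss (phi l)) t : R[i]^o) @ \oo)
      [set y : R[i]^o | cabs (stepf (ss (phi l)) t - y) < e / 2].
    by exists L => // m /= Lm; exact: HL.
  have [y [/= y1 y2]] := cl _ _ n2 n1.
  by apply: le_lt_trans (cabs_triangle _ y _) _; rewrite (splitr e) ltrD.
have [f fP] := choice lim.
exists phi, f, Q; split => //.
- exact: card_image_le.
- by move=> t; have [] := fP t.
- by move=> t t0 t1 nQ; have [_] := fP t; exact.
Qed.

End step_functions.

Section uniform_steps.
Context {R : realType}.
Implicit Types (s : seq R[i]).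

Local Notation T := (g_sigma_algebraType R.-ocitv.-measurable).

Definition unif : probability T R := uniform_prob (@ltr01 R).

Lemma unifE (A : set T) : measurable A -> unif A = lebesgue_measure (A `&` `[0, 1]).
Proof.
move=> mA; transitivity (\int[unif]_x (\1_A x)%:E)%E.
  by rewrite integral_indic// setIT.
rewrite /unif integral_uniform//; last by apply/measurable_EFinP; exact: measurable_indic.
by rewrite subr0 invr1 mul1e integral_indic.
Qed.

(** A countable union of intervals. As P is arbitrary, preimages of arbitrary plane sets under a
    step function are measurable. *)
Lemma trunc_preimage (N : nat) (P : set nat) : (0 < N)%N ->
  measurable [set t : T | P (Num.trunc (N%:R * t : R))].
Proof.
move=> N0; have N0' : 0 < N%:R :> R by rewrite ltr0n.
have mS i : measurable [set t : T | (Num.trunc (N%:R * t : R) <= i)%N].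
  rewrite (_ : [set t | _] = [set` `]-oo, (i.+1%:R / N%:R : R)[ ])//.
  by apply/seteqP; split => t /=; rewrite in_itv /= truncn_le_nat ltr_pdivlMr// mulrC.
have mE i : measurable [set t : T | Num.trunc (N%:R * t : R) = i].
  case: i => [|i].
    rewrite (_ : [set t | _] = [set t : T | (Num.trunc (N%:R * t : R) <= 0)%N])//.
    by apply/seteqP; split => t /=; [move=> ->|rewrite leqn0 => /eqP].
  rewrite (_ : [set t | _] = [set t : T | (Num.trunc (N%:R * t : R) <= i.+1)%N] `\`
     [set t : T | (Num.trunc (N%:R * t : R) <= i)%N]); first exact: measurableD.
  apply/seteqP; split => t /=; first by move=> ->; rewrite ltnn.
  by move=> [h1 /negP]; rewrite -ltnNge => h2; apply/eqP; rewrite eqn_leq h1.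
rewrite (_ : [set t | _] = \bigcup_(i in P) [set t : T | Num.trunc (N%:R * t : R) = i]).
  by apply: bigcup_measurable => i _.
by apply/seteqP; split => [t /= Pt|t [i Pi /= ->]//]; exists (Num.trunc (N%:R * t : R)).
Qed.

Lemma stepf_preimage s (A : set R[i]) : (0 < size s)%N -> measurable ((stepf s : T -> R[i]) @^-1` A).
Proof. by move=> s0; exact: (trunc_preimage (fun i => A (nth 0 s i))). Qed.

Lemma measurable_stepf s : (0 < size s)%N -> measurable_fun setT (stepf s : T -> borelC R).
Proof. by move=> s0 _ A _; rewrite setTI; exact: stepf_preimage. Qed.

Lemma integral_step (N : nat) (h : nat -> R) : (0 < N)%N -> (forall i, 0 <= h i) ->
  (\int[unif]_t (h (Num.trunc (N%:R * t : R)))%:E = (N%:R^-1 * \sum_(i < N) h i)%:E)%E.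
Proof.
move=> N0 h0; have N0' : 0 < N%:R :> R by rewrite ltr0n.
have mh : measurable_fun setT (fun t : T => h (Num.trunc (N%:R * t : R))).
  by move=> _ A _; rewrite setTI; exact: (trunc_preimage (fun i => A (h i)) N0).
pose I (i : nat) : set T := [set t | Num.trunc (N%:R * t : R) = i].
have mI i : measurable (I i) by exact: (trunc_preimage (fun j => j = i) N0).
rewrite /unif integral_uniform//; last 2 first.
- exact/measurable_EFinP.
- by move=> t; rewrite lee_fin.
rewrite subr0 invr1 mul1e.
transitivity (\int[lebesgue_measure]_(t in `[0%R, 1%R]) (\sum_(i < N) (h i)%:E * (\1_(I i) t)%:E))%E.
  apply: ae_eq_integral => //.
  - by apply/measurable_EFinP; exact: measurable_funTS.
  - apply: emeasurable_sum => i; apply: measurable_funeM.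
    by apply/measurable_EFinP; exact: measurable_indic.
  (* At t = 1 the index is N, which the sum over [i < N] misses. *)
  - exists [set 1]; split => //; first exact: lebesgue_measure_set1.
    move=> t /=; apply: contra_notP => t1 /=; rewrite in_itv /= => /andP[t0 t1'].
    have {}t1 : t < 1 by rewrite lt_neqAle t1' andbT; apply/eqP.
    have tN : (Num.trunc (N%:R * t) < N)%N.
      by rewrite truncn_lt_nat ?mulr_ge0//; rewrite -[ltRHS]mulr1 ltr_pM2l.
    rewrite (bigD1 (Ordinal tN))//= indicE mem_set// mule1 big1 ?adde0// => i ineq.
    rewrite indicE memNset ?mule0// /I /= => h1; move/eqP: ineq; apply.
    by apply: val_inj => /=.
rewrite ge0_integral_sum//; last 2 first.
- by move=> i; apply: measurable_funeM; apply/measurable_EFinP; exact: measurable_indic.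
- by move=> i t _; rewrite mule_ge0 ?lee_fin.
rewrite mulr_sumr -sumEFin; apply: eq_bigr => i _.
rewrite ge0_integralZl//; last 2 first.
- by apply/measurable_EFinP; exact: measurable_indic.
- by rewrite lee_fin.
rewrite integral_indic// EFinM muleC; congr (_ * _)%E.
rewrite (_ : I i `&` _ = [set` `[(i%:R / N%:R : R), (i.+1%:R / N%:R)[ ]).
  have hi0 : i%:R / N%:R <= (i.+1%:R / N%:R : R) by rewrite ler_pM2r ?invr_gt0// ler_nat.
  have := @lebesgue_measure_itv R `[(i%:R / N%:R : R), (i.+1%:R / N%:R)[.
  move=> /= ->; rewrite lte_fin ltr_pM2r ?invr_gt0// ltr_nat ltnSn.
  by rewrite -EFinB -mulrBl -natrB// subSnn mul1r.
apply/seteqP; split => t /=; rewrite !in_itv /= /I /=.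
  move=> [h1 /andP[t0 t1]]; have /truncn_itv : 0 <= N%:R * t by rewrite mulr_ge0// ltW.
  by rewrite h1 => /andP[h2 h3]; rewrite ler_pdivrMr// ltr_pdivlMr// mulrC h2 h3.
move=> /andP[h1 h2].
have t0 : 0 <= t by apply: le_trans h1; rewrite divr_ge0.
move: h1 h2; rewrite ler_pdivrMr// ltr_pdivlMr// [t * _]mulrC => h1 h2; split.
  by apply: truncn_def; rewrite h1.
rewrite t0 /= -(@ler_pM2l _ N%:R)// mulr1 (le_trans (ltW h2))// ler_nat; exact: ltn_ord.
Qed.


End uniform_steps.

(** * Limits of counting measures *)

Section weak_limit.
Context {R : realType}.

Local Notation T := (g_sigma_algebraType R.-ocitv.-measurable).

(** The limit is in U exactly when, for some m, the h l t are eventually in the set of points whose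
    ball of radius 1/(m+1) lies in U. Demanding all preimages to be measurable spares a proof that
    this set is Borel. *)
Lemma measurable_limit (D : set T) (h : nat -> T -> R[i]) (f : T -> R[i]) :
  measurable D -> (forall l (A : set R[i]), measurable (h l @^-1` A)) ->
  (forall t, D t -> forall e : R, 0 < e ->
     exists L, forall l, (L <= l)%N -> cabs (h l t - f t) < e) ->
  measurable_fun D (f : T -> borelC R).
Proof.
move=> mD mh hf; apply: (@measurability _ _ T (borelC R) D f (@open (R[i]^o))) => //.
move=> _ [U oU <-].
pose Um (m : nat) := [set z : R[i] | forall y, cabs (y - z) < m.+1%:R^-1 -> U y].
rewrite (_ : D `&` f @^-1` U = D `&` \bigcup_m \bigcup_L \bigcap_(l in [set l | (L <= l)%N]) (h l @^-1` Um m)).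
  apply: measurableI => //; apply: bigcupT_measurable => m; apply: bigcupT_measurable => L.
  by apply: bigcap_measurable => [|l _]; [exists L => /=|exact: mh].
apply/seteqP; split => t [Dt] /=.
  move=> Uft; split => //.
  have /nbhsCP[d d0 dU] : nbhs (f t : R[i]^o) U by exact: open_nbhs_nbhs.
  have d20 : 0 < d / 2 by rewrite divr_gt0.
  have [m _ /(_ m (leqnn m))/= Hm] := near_infty_natSinv_lt (PosNum d20).
  have [L HL] := hf _ Dt _ d20.
  exists m => //; exists L => // l /= Ll y yh; apply: dU.
  have := cabs_triangle y (h l t) (f t); have := HL _ Ll; have := lt_trans yh Hm; lra.
move=> [m _ [L _ HL]]; split => //.
have m0 : 0 < m.+1%:R^-1 :> R by rewrite invr_gt0.
have [L' HL'] := hf _ Dt _ m0.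
have /= := HL (maxn L L') (leq_maxl _ _); apply.
by rewrite cabsC; apply: HL'; rewrite leq_maxr.
Qed.

(** Weak compactness in transported form: the counting measures and their limit are laws of
    functions on one probability space that converge in mean, so the energies of Lipschitz kernels
    converge with an explicit error. *)
Lemma weak_limit (E : set R[i]^o) (M : R) (ss : nat -> seq R[i]) :
  compact E -> 0 < M -> (forall z, E z -> cabs z <= M) ->
  (forall n, (0 < size (ss n))%N) -> (forall n z, z \in ss n -> E z) ->
  exists (phi : nat -> nat) (g : T -> borelC R),
    [/\ forall k, (k <= phi k)%N, measurable_fun setT g, forall t, E (g t) &
        (\int[unif]_t (cabs (stepf (sort (lek M) (ss (phi l))) t - g t))%:E)%E @[l --> \oo] --> 0%E].
Proof.
move=> cE M0 EM s0 sE.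
pose S n := sort (lek M) (ss n).
have S0 n : (0 < size (S n))%N by rewrite size_sort.
have SE n z : z \in S n -> E z by rewrite mem_sort; exact: sE.
have Ssort n : sorted (lek M) (S n).
  apply: (sort_sorted_in (lek_total M0)); apply/allP => z zs.
  by rewrite inE; apply: EM; exact: (sE n).
have [phi [f [Q [phik cQ Ef fP]]]] := stepf_converge M0 cE EM S0 SE Ssort.
have mQ : measurable (Q : set T) by exact: countable_measurable.
pose D : set T := [set` `[0%R, 1%R[ ] `\` Q.
have mD : measurable D by apply: measurableD.
have mDC : measurable (~` D) by exact: measurableC.
have [e0 Ee0] : E !=set0 by exists (f 0).
(* Off D the limit f is not controlled. A constant of E there makes the function measurable with all
   values in E. *)
pose g (t : T) : borelC R := if t \in D then f t else e0.
have gE t : E (g t) by rewrite /g; case: ifP.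
have fD t : D t -> forall e : R, 0 < e ->
    exists L, forall l, (L <= l)%N -> cabs (stepf (S (phi l)) t - f t) < e.
  by rewrite /D /= in_itv /= => -[/andP[t0 t1] nQ]; exact: fP.
have mg : measurable_fun setT g.
  rewrite -(setUv D); apply/measurable_funU => //; split.
    apply: (eq_measurable_fun (f : T -> borelC R)).
      by move=> t tD; rewrite /g tD.
    apply: (@measurable_limit D (fun l => stepf (S (phi l))) f) => // l A.
    exact: stepf_preimage.
  apply: (eq_measurable_fun (cst (e0 : borelC R))) => //.
  by move=> t; rewrite inE => tD; rewrite /g memNset.
exists phi, g; split => //.
have D0 : unif (~` D) = 0%E.
  rewrite unifE//; apply/eqP; rewrite eq_le measure_ge0 andbT.
  have Q0 : lebesgue_measure (Q `|` [set 1] : set R) = 0%E.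
    apply/eqP; rewrite measureU0//; last exact: lebesgue_measure_set1.
    by apply/eqP; exact: countable_lebesgue_measure0.
  rewrite -Q0; apply: le_measure; rewrite ?inE//.
  - exact: measurableI.
  - exact: measurableU.
  move=> t [nDt]; rewrite /= in_itv /= => /andP[t0 t1].
  have [Qt|nQt] := pselect (Q t); [by left|right].
  apply/eqP; rewrite eq_le t1 leNgt; apply/negP => t1'; apply: nDt.
  by rewrite /D /= in_itv /= t0 t1'.
have bstep n t : cabs (stepf (S n) t) <= M.
  rewrite /stepf; have [lt|ge] := ltnP (Num.trunc ((size (S n))%:R * t)) (size (S n)).
    by apply: EM; apply: (SE n); exact: mem_nth.
  by rewrite nth_default// cabs0 ltW.
pose h l (t : T) : \bar R := (cabs (stepf (S (phi l)) t - g t))%:E.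
have mhl l : measurable_fun setT (h l).
  apply/measurable_EFinP.
  have mpair : measurable_fun [set: T] (fun t : T => (stepf (S (phi l)) t : borelC R, g t)).
    by apply: measurable_fun_pair => //; exact: measurable_stepf.
  exact: (measurableT_comp measurable_cabs_diff mpair).
have [|||||_ _] := @dominated_convergence _ _ _ unif setT measurableT h (cst 0%E) (cst (2 * M)%:E).
- exact: mhl.
- exact: measurable_cst.
- exists (~` D); split => // t /=; apply: contra_notP => /contrapT Dt _.
  apply: cvg_EFin; first by apply: nearW.
  apply/cvgrPdist_lt => /= e e00; have [L HL] := fD _ Dt _ e00.
  exists L => // l /= Ll; rewrite sub0r normrN ger0_norm ?cabs_ge0//.
  by rewrite /g mem_set//; exact: HL.
- apply/integrableP; split; first exact: measurable_cst.
  under eq_integral do rewrite /= ger0_norm ?mulr_ge0 ?(ltW M0)//.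
  rewrite (_ : (fun=> _) = cst (2 * M)%:E)// integral_cst_probability; exact: ltry.
- apply: aeW => t l _ /=; rewrite ger0_norm ?cabs_ge0// lee_fin.
  apply: le_trans (cabsD _ _) _; rewrite cabsN.
  by have := bstep (phi l) t; have := EM _ (gE t); lra.
by rewrite integral0; apply: cvg_trans.
Qed.

End weak_limit.

Section step_energy.
Context {R : realType}.
Implicit Types (x y z w : R[i]).

Local Notation T := (g_sigma_algebraType R.-ocitv.-measurable).

Lemma kern_dist c r x y x' y' : 0 < r ->
  kern c r x y <= kern c r x' y' + (cabs (x - x') + cabs (y - y')) / r.
Proof.
move=> r0.
have h1 : lgr r x' y - lgr r x y <= cabs (x - x') / r.
  by rewrite (le_trans (ler_norm _))// (cabsC x); exact: lgr_lipschitz.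
have h2 : lgr r x' y' - lgr r x' y <= cabs (y - y') / r.
  rewrite (le_trans (ler_norm _))// (lgrC r x') (lgrC r x' y) (cabsC y); exact: lgr_lipschitz.
have k0 := kern_ge0 c r x' y'; have k1 : c - lgr r x' y' <= kern c r x' y'.
  by rewrite le_max lexx orbT.
rewrite mulrDl {1}/kern ge_max addr_ge0 ?addr_ge0 ?divr_ge0 ?cabs_ge0 ?(ltW r0)//=.
move: (cabs (x - x') / r) (cabs (y - y') / r) (kern c r x' y') h1 h2 k0 k1 => A B K.
by move: (lgr r x y) (lgr r x' y) (lgr r x' y') => a a' a''; lra.
Qed.

Lemma measurable_kern c r : measurable_fun setT
  (fun p : borelC R * borelC R => kern c r (p.1 : R[i]) p.2).
Proof.
apply: measurable_maxr => //; apply: measurable_funB => //; exact: measurable_lgr.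
Qed.

Lemma measurable_kern_r c r z : measurable_fun setT (fun w : borelC R => kern c r z w).
Proof. by apply: measurable_maxr => //; apply: measurable_funB => //; exact: measurable_lgr_r. Qed.

(** Monotone convergence in the inner and then in the outer integral, along the truncation radii
    1/(n+1). *)
Lemma ekern_integral_le (nu : probability (borelC R) R) c (A : \bar R) :
  (forall n : nat, (\int[nu]_z \int[nu]_w (kern c n.+1%:R^-1 z w)%:E <= A)%E) ->
  (\int[nu]_z \int[nu]_w ekern c z w <= A)%E.
Proof.
move=> H.
have k0 n (z w : R[i]) : (0 <= (kern c n.+1%:R^-1 z w)%:E)%E by rewrite lee_fin kern_ge0.
have nd z w : {homo (fun n : nat => (kern c n.+1%:R^-1 z w)%:E) : m n / (m <= n)%N >-> (m <= n)%E}.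
  move=> m n mn; rewrite lee_fin kern_nonincr ?invr_gt0//.
  by rewrite lef_pV2 ?posrE// ler_nat.
have mk n z : measurable_fun setT (fun w : borelC R => (kern c n.+1%:R^-1 z w)%:E).
  by apply/measurable_EFinP; exact: measurable_kern_r.
have inner (z : R[i]) : (\int[nu]_w (kern c n.+1%:R^-1 z w)%:E)%E @[n --> \oo] -->
    (\int[nu]_w ekern c z w)%E.
  have -> : (\int[nu]_w ekern c z w = \int[nu]_w limn (fun n => (kern c n.+1%:R^-1 z w)%:E))%E.
    by apply: eq_integral => w _; apply/esym/cvg_lim => //; exact: cvg_kern.
  by apply: cvg_monotone_convergence => // w _; exact: nd.
have -> : (\int[nu]_z \int[nu]_w ekern c z w =
    \int[nu]_z limn (fun n => \int[nu]_w (kern c n.+1%:R^-1 z w)%:E))%E.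
  by apply: eq_integral => z _; apply/esym/cvg_lim => //; exact: inner.
have mint n : measurable_fun setT (fun z : borelC R => \int[nu]_w (kern c n.+1%:R^-1 (z : R[i]) w)%:E)%E.
  apply: (measurable_kernel_integral nu (k := fun z w : borelC R => (kern c n.+1%:R^-1 (z : R[i]) w)%:E)) => //.
  by apply/measurable_EFinP; exact: measurable_kern.
have ndint z : {homo (fun n => \int[nu]_w (kern c n.+1%:R^-1 z w)%:E)%E : m n / (m <= n)%N >-> (m <= n)%E}.
  by move=> m n mn; apply: ge0_le_integral => // w _; exact: nd.
rewrite monotone_convergence//; last by move=> n z _; exact: integral_ge0.
apply: lime_le; last exact: nearW.
apply: ereal_nondecreasing_is_cvgn => m n mn.
by apply: ge0_le_integral => // z _; [exact: integral_ge0|exact: ndint].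
Qed.

Lemma integral_step_kern (s : seq R[i]) (k : R[i] -> R[i] -> R) : (0 < size s)%N ->
  (forall z w, 0 <= k z w) ->
  (\int[unif]_x \int[unif]_y (k (stepf s x) (stepf s y))%:E =
   ((size s)%:R^-1 ^+ 2 * \sum_(z <- s) \sum_(w <- s) k z w)%:E)%E.
Proof.
move=> s0 k0.
have H (h : R[i] -> R) : (forall z, 0 <= h z) ->
    (\int[unif]_t (h (stepf s t))%:E = ((size s)%:R^-1 * \sum_(z <- s) h z)%:E)%E.
  move=> h0; rewrite (big_nth 0) big_mkord.
  exact: (@integral_step _ (size s) (fun i => h (nth 0 s i))).
under eq_integral do rewrite H//.
rewrite (H (fun z => (size s)%:R^-1 * \sum_(w <- s) k z w)).
  by rewrite -mulr_sumr expr2 mulrA.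
by move=> z; rewrite mulr_ge0// sumr_ge0.
Qed.

(** The truncated kernel is 1/r-Lipschitz in each variable, and each variable contributes d/r. *)
Lemma integral_kern_close c r (f g : T -> borelC R) (d : R) : 0 < r ->
  measurable_fun setT f -> measurable_fun setT g ->
  (\int[unif]_t (cabs (f t - g t : R[i]))%:E <= d%:E)%E ->
  (\int[unif]_x \int[unif]_y (kern c r (g x) (g y))%:E <=
   \int[unif]_x \int[unif]_y (kern c r (f x) (f y))%:E + (2 * d / r)%:E)%E.
Proof.
move=> r0 mf mg fgd.
have mpair (h : T -> borelC R) : measurable_fun setT h ->
    measurable_fun setT (fun p : T * T => (kern c r (h p.1) (h p.2))%:E).
  move=> mh; apply/measurable_EFinP.
  have mp : measurable_fun [set: T * T] (fun p : T * T => (h p.1, h p.2)).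
    by apply: measurable_fun_pair; apply: measurableT_comp.
  exact: (measurableT_comp (measurable_kern c r) mp).
have md : measurable_fun setT (fun t : T => cabs (f t - g t : R[i])).
  have mp : measurable_fun [set: T] (fun t : T => (f t, g t)) by exact: measurable_fun_pair.
  exact: (measurableT_comp measurable_cabs_diff mp).
have mdr : measurable_fun setT (fun t : T => (cabs (f t - g t : R[i]) / r)%:E).
  by apply/measurable_EFinP; exact: measurable_funM.
have dr0 t : (0 <= (cabs (f t - g t : R[i]) / r)%:E)%E.
  by rewrite lee_fin divr_ge0 ?cabs_ge0// ltW.
have id : (\int[unif]_t (cabs (f t - g t : R[i]) / r)%:E <= (d / r)%:E)%E.
  under eq_integral do rewrite mulrC EFinM.
  rewrite ge0_integralZl//; last 3 first.
  - exact/measurable_EFinP.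
  - by move=> t _; rewrite lee_fin cabs_ge0.
  - by rewrite lee_fin invr_ge0 ltW.
  by rewrite mulrC EFinM lee_pmul2l// lte_fin invr_gt0.
have k0 (h : T -> borelC R) (x y : T) : (0 <= (kern c r (h x) (h y))%:E)%E by rewrite lee_fin kern_ge0.
have mk1 (h : T -> borelC R) (x : T) : measurable_fun setT h -> measurable_fun setT (fun y : T => (kern c r (h x) (h y))%:E).
  move=> mh; apply/measurable_EFinP.
  exact: (measurableT_comp (measurable_kern_r c r (h x)) mh).
have mk2 (h : T -> borelC R) : measurable_fun setT h -> measurable_fun setT (fun x : T => \int[unif]_y (kern c r (h x) (h y))%:E)%E.
  move=> mh; apply: (measurable_kernel_integral unif (k := fun x y : T => (kern c r (h x) (h y))%:E)) => //.
  exact: mpair.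
have K0 (h : T -> borelC R) (x : T) : (0 <= \int[unif]_y (kern c r (h x) (h y))%:E)%E by exact: integral_ge0.
apply: (@le_trans _ _ (\int[unif]_x (\int[unif]_y (kern c r (f x) (f y))%:E +
    ((cabs (f x - g x : R[i]) / r)%:E + (d / r)%:E)))%E); last first.
  rewrite ge0_integralD//; last 3 first.
  - exact: mk2.
  - by move=> x _; rewrite adde_ge0// (le_trans _ id)//; exact: integral_ge0.
  - exact: emeasurable_funD.
  apply: leeD2l; rewrite ge0_integralD//; last first.
  - by move=> x _; rewrite (le_trans _ id)//; exact: integral_ge0.
  rewrite integral_cst_probability (_ : 2 * d / r = d / r + d / r); last by lra.
  by rewrite EFinD leeD2r.
apply: ge0_le_integral => //.
- exact: mk2.
- by apply: emeasurable_funD; [exact: mk2|exact: emeasurable_funD].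
move=> x _.
apply: (@le_trans _ _ (\int[unif]_y ((kern c r (f x) (f y))%:E +
    ((cabs (f x - g x : R[i]) / r)%:E + (cabs (f y - g y : R[i]) / r)%:E)))%E); last first.
  rewrite ge0_integralD//; last 3 first.
  - exact: mk1.
  - by move=> y _; rewrite adde_ge0.
  - exact: emeasurable_funD.
  apply: leeD2l; rewrite ge0_integralD//.
  rewrite integral_cst_probability; exact: leeD2l.
apply: ge0_le_integral => //.
- exact: mk1.
- by apply: emeasurable_funD; [exact: mk1|exact: emeasurable_funD].
move=> y _; rewrite -!EFinD lee_fin -mulrDl.
rewrite (cabsC (f x)) (cabsC (f y)); exact: kern_dist.
Qed.


End step_energy.

(** * Discretisation of the equilibrium measure *)

Section pairs.
Context {R : realType}.
Implicit Types (s : seq R[i]) (x y z : R[i]).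

Fixpoint pairs s : seq (R[i] * R[i]) :=
  if s is x :: s' then [seq (x, y) | y <- s'] ++ pairs s' else [::].

(** The modulus of the Vandermonde determinant of s. *)
Definition vdm s : R := \prod_(p <- pairs s) cabs (p.1 - p.2).

Lemma size_pairs s : (2 * size (pairs s) = size s * (size s).-1)%N.
Proof.
elim: s => //= x s IH; rewrite size_cat size_map mulnDr IH.
by case: (size s) => //= n; lia.
Qed.

Lemma mem_pairs s p : p \in pairs s -> p.1 \in s /\ p.2 \in s.
Proof.
elim: s => //= x s IH; rewrite mem_cat => /orP[/mapP[y ys ->]|/IH[h1 h2]] /=.
  by rewrite !inE eqxx ys orbT.
by rewrite !inE h1 h2 !orbT.
Qed.

Lemma vdm_cons x s : vdm (x :: s) = rprod s x * vdm s.
Proof. by rewrite /vdm /= big_cat big_map. Qed.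

Lemma vdm_ge0 s : 0 <= vdm s.
Proof. by apply: prodr_ge0 => p _; exact: cabs_ge0. Qed.

Lemma vdm_rem x s : x \in s -> vdm s = rprod (rem x s) x * vdm (rem x s).
Proof.
elim: s => //= y s IH; rewrite inE; case: eqVneq => [-> _|xy /= xs].
  by rewrite vdm_cons.
rewrite !vdm_cons IH// {1}/rprod (big_rem _ xs)/= {2}/rprod big_cons.
rewrite -/(rprod _ _) -/(rprod _ _) (cabsC y); ring.
Qed.

Lemma vdm_uniq s : 0 < vdm s -> uniq s.
Proof.
elim: s => //= x s IH; rewrite vdm_cons => h.
have v0 : 0 < vdm s.
  by rewrite lt_def vdm_ge0 andbT; apply: contraTneq h => ->; rewrite mulr0 ltxx.
rewrite (IH v0) andbT; apply/negP => xs.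
suff : rprod s x = 0 by move=> h0; move: h; rewrite h0 mul0r ltxx.
by rewrite /rprod (big_rem _ xs)/= subrr cabs0 mul0r.
Qed.

(** Each pair is counted from both of its ends. Uniqueness matters because [rem] deletes a single
    occurrence. *)
Lemma prod_rprod_rem s : uniq s -> \prod_(x <- s) rprod (rem x s) x = vdm s ^+ 2.
Proof.
elim: s => [_|y s IH /= /andP[ys us]].
  by rewrite big_nil /vdm big_nil expr1n.
rewrite big_cons /= eqxx vdm_cons exprMn expr2 -mulrA; congr (_ * _).
rewrite -IH//= {1}/rprod -big_split; apply: eq_big_seq => x xs /=.
case: eqVneq => [yx|xy]; first by rewrite yx xs in ys.
by rewrite {1}/rprod big_cons cabsC.
Qed.

Lemma rprod_rem_small s (c : R) : (0 < size s)%N -> 0 < vdm s -> 0 < c ->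
  vdm s ^+ 2 <= c ^+ size s -> exists2 x, x \in s & rprod (rem x s) x <= c.
Proof.
move=> s0 v0 c0 vc; apply: contrapT => no.
have big x : x \in s -> c < rprod (rem x s) x.
  by move=> xs; rewrite ltNge; apply/negP => h; apply: no; exists x.
move: vc; rewrite -prod_rprod_rem ?vdm_uniq// leNgt => /negP; apply.
have -> : c ^+ size s = \prod_(x <- s) c by rewrite big_const_seq count_predT -Monoid.iteropE.
rewrite !big_seq; apply: ltr_prod => [|x xs]; last by rewrite (ltW c0) big.
by case: (s) s0 => // x s' _; apply/hasP; exists x; rewrite inE eqxx.
Qed.

Lemma sum_pairs_sym (f : R[i] -> R[i] -> R) s : (forall x y, f x y = f y x) ->
  \sum_(x <- s) \sum_(y <- s) f x y =
  \sum_(x <- s) f x x + 2 * \sum_(p <- pairs s) f p.1 p.2.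
Proof.
move=> fC; elim: s => [|x s IH]; first by rewrite !big_nil mulr0 addr0.
rewrite !big_cons big_cat big_map /=.
under [X in _ + X = _]eq_bigr do rewrite big_cons.
rewrite big_split IH/= -/(pairs s).
have -> : \sum_(y <- s) f y x = \sum_(y <- s) f x y by apply: eq_bigr => y _; rewrite fC.
ring.
Qed.

Lemma sum_pairs_add (g : R[i] -> R) s :
  \sum_(p <- pairs s) (g p.1 + g p.2) = (size s).-1%:R * \sum_(x <- s) g x.
Proof.
elim: s => [|x s IH]; first by rewrite !big_nil mulr0.
rewrite big_cat big_map IH big_cons /= big_split /= big_const_seq count_predT iter_addr addr0.
case: s {IH} => [|y s]; first by rewrite !big_nil /= mulr0n; ring.
rewrite -mulr_natl (_ : size (y :: s) = (size s).+1)//= -natr1; ring.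
Qed.

End pairs.

Section derandomisation.
Context {R : realType} (mu : probability (borelC R) R).
Variable k : borelC R -> borelC R -> \bar R.
Hypothesis mk : measurable_fun setT (fun p : borelC R * borelC R => k p.1 p.2).
Hypothesis k0 : forall z w, (0 <= k z w)%E.
Hypothesis kC : forall z w, k z w = k w z.
Variables (A : set R[i]) (J : R).
Hypotheses (mA : measurable (A : set (borelC R))) (A0 : mu (~` A) = 0%E).
Hypothesis kJ : (\int[mu]_z \int[mu]_w k z w <= J%:E)%E.

Lemma exists_le_integral (f : borelC R -> \bar R) (I e : R) : measurable_fun setT f ->
  (forall z, (0 <= f z)%E) -> (\int[mu]_z f z <= I%:E)%E -> 0 < e ->
  exists2 z, A z & (f z <= (I + e)%:E)%E.
Proof.
move=> mf f0 fI e0; apply: contrapT => no.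
have I0 : 0 <= I by rewrite -lee_fin (le_trans _ fI)//; exact: integral_ge0.
have : ((I + e)%:E <= \int[mu]_z f z)%E.
  rewrite -(integral_cst_probability mu (I + e)%:E).
  apply: ae_ge0_le_integral => //.
  - by move=> x _; rewrite lee_fin addr_ge0// ltW.
  - exists (~` A); split => //; first exact: measurableC.
    move=> z /= h; apply: contra_not h => Az _.
    by rewrite leNgt; apply/negP => h; apply: no; exists z => //; exact: ltW.
by move=> /le_trans /(_ fI); rewrite lee_fin; move: e0; lra.
Qed.

(* Method of conditional expectations; c is the number of points still to be
   drawn. *)
Lemma exists_sum_pairs_le (e : R) : 0 < e -> forall n (c : nat), exists s : seq R[i],
  [/\ size s = n, (forall z, z \in s -> A z) &
   (\sum_(p <- pairs s) k p.1 p.2 + c%:R%:E * \sum_(z <- s) \int[mu]_w k z w <=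
    (('C(n, 2) + c * n)%:R * J + n%:R * e)%:E)%E].
Proof.
move=> e0.
have mq : measurable_fun setT (fun z : borelC R => \int[mu]_w k z w)%E.
  exact: (measurable_kernel_integral mu mk).
have q0 z : (0 <= \int[mu]_w k z w)%E by exact: integral_ge0.
elim=> [|n IH] c.
  by exists [::]; split => //; rewrite !big_nil mule0 adde0 muln0 mul0r add0r mul0r.
have [s [sn sA sE]] := IH c.+1.
(* What a new point z adds: its pairs with the points already drawn, and the expected pairs with the
   c points still to come. *)
pose f z : \bar R := (\sum_(w <- s) k w z + c%:R%:E * \int[mu]_w k z w)%E.
have mf1 : measurable_fun setT (fun z => \sum_(w <- s) k w z)%E.
  by apply: emeasurable_sum => w; exact: (measurable_kernel_section mk).
have mf2 : measurable_fun setT (fun z => c%:R%:E * \int[mu]_w k z w)%E.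
  exact: measurable_funeM.
have f10 z : (0 <= \sum_(w <- s) k w z)%E by exact: sume_ge0.
have c0 : (0 <= c%:R%:E :> \bar R)%E by rewrite lee_fin.
have f20 z : (0 <= c%:R%:E * \int[mu]_w k z w)%E by rewrite mule_ge0.
have S0 : (0 <= \sum_(z <- s) \int[mu]_w k z w)%E by exact: sume_ge0.
have P0 : (0 <= \sum_(p <- pairs s) k p.1 p.2)%E by exact: sume_ge0.
have If : (\int[mu]_z f z = \sum_(z <- s) \int[mu]_w k z w + c%:R%:E * \int[mu]_z \int[mu]_w k z w)%E.
  rewrite ge0_integralD//; congr (_ + _)%E; last by rewrite ge0_integralZl.
  by rewrite ge0_integral_sum// => w; exact: (measurable_kernel_section mk).
(* The induction hypothesis is used at c + 1. This coefficient is positive, so the bound forces the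
   sum to be finite. *)
have [Sq SqE] : exists Sq : R, (\sum_(z <- s) \int[mu]_w k z w = Sq%:E)%E.
  case: (\sum_(z <- s) _)%E S0 sE => [r _ _|_|//]; first by exists r.
  by rewrite gt0_muley ?lte_fin ?ltr0n// addey ?gt_eqF// (lt_le_trans _ P0).
have [Sp SpE] : exists Sp : R, (\sum_(p <- pairs s) k p.1 p.2 = Sp%:E)%E.
  case: (\sum_(p <- _) _)%E P0 sE => [r _ _|_|//]; first by exists r.
  by rewrite SqE.
have [z Az fz] : exists2 z, A z & (f z <= (Sq + c%:R * J + e)%:E)%E.
  apply: exists_le_integral => //; first exact: emeasurable_funD.
    by move=> z; rewrite adde_ge0.
  by rewrite If SqE EFinD leeD2l// EFinM; exact: lee_wpmul2l.
exists (z :: s); split; first by rewrite /= sn.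
  by move=> x; rewrite inE => /orP[/eqP ->|]//; exact: sA.
rewrite /= big_cat big_map big_cons /= SpE SqE.
move: sE; rewrite SpE SqE -EFinM -EFinD lee_fin => sE.
move: fz; rewrite /f (eq_bigr (fun w => k z w)); last by move=> w _; rewrite kC.
set a := (\sum_(w <- s) k z w)%E; set b := (\int[mu]_w k z w)%E => fz.
have Sq0 : 0 <= Sq by rewrite -lee_fin -SqE.
have -> : (a + Sp%:E + c%:R%:E * (b + Sq%:E) = (a + c%:R%:E * b) + (Sp + c%:R * Sq)%:E)%E.
  by rewrite ge0_muleDr ?lee_fin// ?q0// addeACA EFinD EFinM.
apply: le_trans (leeD2r _ fz) _; rewrite -EFinD lee_fin.
move: sE; rewrite binS bin1 -!natr1 !natrD !natrM -!natr1; nra.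
Qed.

End derandomisation.

(** * Comparison of the transfinite diameter with the capacity *)

Section transfinite_diameter.
Context {R : realType}.
Implicit Types (x y z w : R[i]).

Local Notation T := (g_sigma_algebraType R.-ocitv.-measurable).

(** The double sum contains the diagonal, where the truncated logarithm is bounded below by ln r.
    This accounts for the extra term on the left. *)
Lemma vdm_lgr s (r L : R) : 0 < r -> expR L < vdm s ->
  2 * L + (size s)%:R * ln r <= \sum_(x <- s) \sum_(y <- s) lgr r x y.
Proof.
move=> r0 HL; rewrite sum_pairs_sym; last by move=> x y; exact: lgrC.
rewrite addrC lerD//.
  have -> : (size s)%:R * ln r = \sum_(x <- s) ln r.
    by rewrite big_const_seq count_predT iter_addr addr0 mulr_natl.
  by apply: ler_sum => x _; exact: lgr_ge.
rewrite ler_pM2l// -ler_expR (le_trans (ltW HL))// expR_sum; apply: ler_prod => p _.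
rewrite cabs_ge0/= /lgr lnK; first by rewrite le_max lexx orbT.
by rewrite posrE lt_max r0.
Qed.

(** If every n > n0 failed, the counting measures of the violating lists would have a limit law on
    E. Its truncated energies would be at most V - e for all small r, hence so would its energy,
    against the minimality of V. One good n beyond any bound is all that is needed later. *)
Theorem transfinite_diameter_le (E : set R[i]^o) (M V : R) :
  compact E -> 1 <= M -> (forall z, E z -> cabs z <= M) ->
  (forall nu : probability (borelC R) R, supported_on E nu -> (V%:E <= energy nu)%E) ->
  forall e n0, 0 < e -> exists2 n, (n0 < n)%N &
    forall s, size s = n -> (forall z, z \in s -> E z) ->
    vdm s <= expR (- (V - e) * n%:R * (n%:R - 1) / 2).
Proof.
move=> cE M1 EM EV e n0 e0; apply: contrapT => noN.
have M0 : 0 < M by exact: lt_le_trans M1.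
have /choice[ss ssP] : forall n, exists s : seq R[i],
    [/\ size s = (n0 + n).+2, (forall z, z \in s -> E z) &
      forall r, 0 < r -> - (V - e) * (n0 + n).+2%:R * ((n0 + n).+2%:R - 1) + (n0 + n).+2%:R * ln r <=
        \sum_(x <- s) \sum_(y <- s) lgr r x y].
  move=> n; apply: contrapT => no; apply: noN; exists (n0 + n).+2; first by lia.
  move=> s sn sE; rewrite leNgt; apply/negP => slt; apply: no; exists s; split => // r r0.
  apply: le_trans (vdm_lgr r0 slt); rewrite sn lerD2r mulrCA divff// mulr1//.
pose c := Num.max 0 (ln (2 * M)).
have c0 : 0 <= c by rewrite le_max lexx.
have cM : ln (2 * M) <= c by rewrite le_max lexx orbT.
have s0 n : (0 < size (ss n))%N by have [-> _ _] := ssP n.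
have sE n z : z \in ss n -> E z by have [_ + _] := ssP n; apply.
have [phi [g [phik mg gE dcvg]]] := weak_limit cE M0 EM s0 sE.
have mX : g \in mfun by rewrite inE.
pose X : {mfun T >-> borelC R} := mfun_Sub mX.
pose nu : probability (borelC R) R := distribution unif X.
have nuE : supported_on E nu.
  rewrite /supported_on /nu /distribution /pushforward /= (_ : _ @^-1` _ = set0) ?measure0//.
  by apply/seteqP; split => t //= ; apply; exact: gE.
(* The diagonal of the discrete energy contributes at most |ln r| / N, which vanishes for fixed r as
   the number N of points grows. *)
have stepE l r : 0 < r -> r <= 1 ->
   ((size (ss l))%:R^-1 ^+ 2 * \sum_(z <- ss l) \sum_(w <- ss l) kern c r z w : R) <=
   c + V - e + (`|V - e| + `|ln r|) / (n0 + l).+2%:R.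
  move=> r0 r1; have [sz sE' /(_ _ r0) Hs] := ssP l.
  have -> : \sum_(z <- ss l) \sum_(w <- ss l) kern c r z w =
      c * (n0 + l).+2%:R ^+ 2 - \sum_(x <- ss l) \sum_(y <- ss l) lgr r x y.
    transitivity (\sum_(x <- ss l) \sum_(y <- ss l) (c - lgr r x y)).
      apply: eq_big_seq => x xs; apply: eq_big_seq => y ys.
      apply/max_idPr; rewrite subr_ge0 (le_trans _ cM)//; apply: lgr_le => //.
        by move: M1 r1; lra.
      apply: le_trans (cabsD _ _) _; rewrite cabsN.
      by have := EM _ (sE' _ xs); have := EM _ (sE' _ ys); lra.
    under eq_bigr do rewrite sumrB big_const_seq count_predT iter_addr addr0 sz.
    rewrite sumrB big_const_seq count_predT iter_addr addr0 sz; congr (_ - _).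
    by rewrite -mulrnA -[LHS]mulr_natr natrM expr2.
  rewrite sz; have N0 : 0 < (n0 + l).+2%:R :> R by rewrite ltr0n.
  set N := (n0 + l).+2%:R in Hs N0 *.
  rewrite -ler_pdivlMl ?exprn_gt0 ?invr_gt0//.
  have -> : (N^-1 ^+ 2)^-1 * (c + V - e + (`|V - e| + `|ln r|) / N) =
     N ^+ 2 * (c + V - e) + N * (`|V - e| + `|ln r|) by field; rewrite gt_eqF.
  have h1 : - (V - e) * N <= `|V - e| * N by rewrite ler_pM2r// -normrN ler_norm.
  have h2 : - ln r * N <= `|ln r| * N by rewrite ler_pM2r// -normrN ler_norm.
  move: Hs h1 h2; move: (\sum_(_ <- _) _) (`|V - e|) (`|ln r|) (ln r) => S A B l'.
  by nra.
have main n : (\int[nu]_z \int[nu]_w (kern c n.+1%:R^-1 z w)%:E <= (c + V - e)%:E)%E.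
  set r : R := n.+1%:R^-1.
  have r0 : 0 < r by rewrite invr_gt0.
  have r1 : r <= 1 by rewrite invf_le1// ler1n.
  have mkr z : measurable_fun setT (fun w : borelC R => (kern c r z w)%:E).
    by apply/measurable_EFinP; exact: measurable_kern_r.
  rewrite ge0_integral_distribution//; last 2 first.
  - apply: (measurable_kernel_integral nu (k := fun z w : borelC R => (kern c r (z : R[i]) w)%:E)) => //.
      by apply/measurable_EFinP; exact: measurable_kern.
    by move=> x y; rewrite lee_fin kern_ge0.
  - by move=> z; apply: integral_ge0 => w _; rewrite lee_fin kern_ge0.
  under eq_integral => x _.
    rewrite /= ge0_integral_distribution//; last by move=> w; rewrite lee_fin kern_ge0.
    over.
  rewrite /=; apply/lee_addgt0Pr => d d0.
  (* The tolerance d splits in two: transport costs 2 (d r / 4) / r = d/2, and the terms of order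
     1/N take the other half. *)
  have rd0 : 0 < d * r / 4 by rewrite !mulr_gt0.
  have B0 : 0 <= `|V - e| + `|ln r| by rewrite addr_ge0.
  have [L HL] : exists L, forall l, (L <= l)%N ->
     (\int[unif]_t (cabs (stepf (sort (lek M) (ss (phi l))) t - g t))%:E <= (d * r / 4)%:E)%E.
    have := dcvg _ (@nbhs_open_ereal_lt _ 0 (fun=> d * r / 4) rd0).
    by move=> [L _ HL]; exists L => l Ll; exact: ltW (HL l Ll).
  have [L' HL'] : exists L, forall l, (L <= l)%N -> (`|V - e| + `|ln r|) / (n0 + l).+2%:R <= d / 2.
    set B := _ + _ in B0 *; exists (Num.trunc (2 * B / d)) => l Ll.
    have : 2 * B / d < (n0 + l).+2%:R.
      rewrite -truncn_lt_nat ?divr_ge0 ?mulr_ge0 ?(ltW d0)//.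
      by rewrite ltnS (leq_trans Ll)// (leq_trans (leq_addl n0 l))//.
    by rewrite ltr_pdivrMr// ler_pdivrMr ?ltr0n//; lra.
  pose l := maxn L L'.
  have mst : measurable_fun setT (stepf (sort (lek M) (ss (phi l))) : T -> borelC R).
    by apply: measurable_stepf; rewrite size_sort.
  have := integral_kern_close c r0 mst mg (HL l (leq_maxl _ _)).
  move=> /le_trans; apply.
  rewrite (@integral_step_kern _ _ (kern c r)) ?size_sort//; last exact: kern_ge0.
  rewrite -EFinD lee_fin (perm_big (ss (phi l))) ?perm_sort//=.
  under eq_bigr do rewrite (perm_big (ss (phi l))) ?perm_sort//=.
  apply: le_trans (lerD (stepE (phi l) r r0 r1) (lexx _)) _.
  have h1 : 2 * (d * r / 4) / r = d / 2 by field; rewrite gt_eqF.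
  have := HL' (phi l) (leq_trans (leq_maxr _ _) (phik l)).
  by rewrite h1 -addrA lerD2l; move: (_ / _.+2%:R) => Y h; move: h d0; lra.
have := ekern_integral_le main; have := EV _ nuE.
rewrite (energy_ekern (compact_closedC cE) M0 EM cM c0 nuE).
move: (\int[nu]_z _)%E => [I|//|//]; rewrite -EFinB !lee_fin; move: e0; lra.
Qed.

End transfinite_diameter.

Section discretisation.
Context {R : realType}.
Variables (E : set R[i]^o) (M V : R) (mu : probability (borelC R) R).
Hypotheses (cE : compact E) (M1 : 1 <= M) (EM : forall z, E z -> cabs z <= M).
Hypothesis EV : forall nu : probability (borelC R) R, supported_on E nu -> (V%:E <= energy nu)%E.
Hypotheses (muE : supported_on E mu) (muV : energy mu = V%:E).
Implicit Types (s : seq R[i]) (x z w : R[i]).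

Let mE : measurable (E : set (borelC R)).
Proof. by apply: closed_measurableC; exact: compact_closedC. Qed.

(** Points are drawn from mu for the kernel c - ln|z - w| + g(z) + g(w). Summed over the pairs, the
    weights give (n - 1) times the sum of g, because each point lies in n - 1 pairs. *)
Lemma exists_weighted_vdm (g : borelC R -> R) (B : R) n (e : R) : measurable_fun setT g ->
  (forall z, 0 <= g z <= B) -> 0 < e ->
  exists s, [/\ size s = n, forall z, z \in s -> E z &
    expR (- ((size (pairs s))%:R * (V + 2 * fine (\int[mu]_z (g z)%:E)%E) + n%:R * e)) <=
    vdm s * expR (- (n.-1%:R * \sum_(z <- s) g z))].
Proof.
move=> mg gB e0.
have M0 : 0 < M by exact: lt_le_trans M1.
have g0 z : 0 <= g z by have /andP[] := gB z.
pose c := Num.max 0 (ln (2 * M)).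
have c0 : 0 <= c by rewrite le_max lexx.
have cM : ln (2 * M) <= c by rewrite le_max lexx orbT.
have mgE : measurable_fun setT (fun z : borelC R => (g z)%:E) by exact/measurable_EFinP.
have gE0 z : (0 <= (g z)%:E)%E by rewrite lee_fin.
have [G GE] : exists G : R, (\int[mu]_z (g z)%:E = G%:E)%E.
  have : (\int[mu]_z (g z)%:E <= B%:E)%E.
    rewrite -[leRHS](integral_cst_probability mu); apply: ge0_le_integral => //.
    by move=> z _; rewrite lee_fin; have /andP[] := gB z.
  have : (0 <= \int[mu]_z (g z)%:E)%E by exact: integral_ge0.
  by case: (\int[mu]_z (g z)%:E)%E => // r _ _; exists r.
rewrite GE /=.
pose k (z w : borelC R) : \bar R := (ekern c z w + ((g z)%:E + (g w)%:E))%E.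
have mek (z : borelC R) : measurable_fun setT (fun w : borelC R => ekern c z w) by exact: measurable_ekern_r.
have k0 z w : (0 <= k z w)%E by rewrite !adde_ge0 ?ekern_ge0.
have mg2 : measurable_fun setT (fun p : borelC R * borelC R => ((g p.1)%:E + (g p.2)%:E)%E).
  by apply: emeasurable_funD; [exact: (measurableT_comp mgE measurable_fst)|exact: (measurableT_comp mgE measurable_snd)].
have mk : measurable_fun setT (fun p : borelC R * borelC R => k p.1 p.2).
  by apply: emeasurable_funD => //; exact: measurable_ekern.
have kC z w : k z w = k w z by rewrite /k ekernC [X in (_ + X)%E]addeC.
have mgc z : measurable_fun setT (fun w : borelC R => ((g z)%:E + (g w)%:E)%E).
  exact: emeasurable_funD.
have kJ : (\int[mu]_z \int[mu]_w k z w <= (V + c + 2 * G)%:E)%E.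
  have in1 z : (\int[mu]_w k z w = \int[mu]_w ekern c z w + ((g z)%:E + G%:E))%E.
    rewrite ge0_integralD//; last 2 first.
    - by move=> w _; exact: ekern_ge0.
    - by move=> w _; rewrite adde_ge0.
    by rewrite ge0_integralD// integral_cst_probability GE.
  under eq_integral do rewrite in1.
  have G0 : (0 <= G%:E)%E by rewrite -GE; exact: integral_ge0.
  rewrite ge0_integralD//; last 4 first.
  - by move=> z _; apply: integral_ge0 => w _; exact: ekern_ge0.
  - apply: (measurable_kernel_integral mu (measurable_ekern c)) => //.
    by move=> *; exact: ekern_ge0.
  - by move=> z _; rewrite adde_ge0.
  - exact: emeasurable_funD.
  rewrite ge0_integralD// integral_cst_probability GE.
  have := energy_ekern (compact_closedC cE) M0 EM cM c0 muE; rewrite muV.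
  move: (\int[mu]_z _)%E => [I|//|//]; rewrite -!EFinD lee_fin => -[->]; lra.
have [s [sn sE sJ]] := exists_sum_pairs_le mk k0 kC mE muE kJ e0 n 0.
exists s; split => //.
rewrite mul0e adde0 mul0n addn0 in sJ.
(* A coincident pair would contribute [+oo] to a sum with a finite bound, so the drawn points are
   distinct. *)
have sd p : p \in pairs s -> 0 < cabs (p.1 - p.2).
  move=> ps; rewrite lt_def cabs_ge0 andbT; apply/eqP => h.
  move: sJ; rewrite (big_rem _ ps)/= {1}/k /ekern log_distE h eqxx.
  rewrite (_ : maxe _ _ = +oo%E); last by apply/max_idPr; rewrite leey.
  have h0 : (0 <= \sum_(q <- rem p (pairs s)) k q.1 q.2)%E by exact: sume_ge0.
  rewrite (_ : (+oo + _)%E = +oo%E)// addye ?leye_eq//.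
  by rewrite gt_eqF// (lt_le_trans _ h0)// ltNy0.
have sk : (\sum_(p <- pairs s) k p.1 p.2 =
   ((size (pairs s))%:R * c - ln (vdm s) + n.-1%:R * \sum_(z <- s) g z)%:E)%E.
  transitivity (\sum_(p <- pairs s) (c - ln (cabs (p.1 - p.2)) + (g p.1 + g p.2))%:E)%E.
    apply: eq_big_seq => p ps; have [p1 p2] := mem_pairs ps.
    have -> : k p.1 p.2 = (c%:E - log_dist p.1 p.2 + ((g p.1)%:E + (g p.2)%:E))%E.
      by congr (_ + _)%E; apply: (@ekernE _ c M) => //; apply: EM; exact: sE.
    by rewrite log_distE gt_eqF ?sd.
  rewrite sumEFin big_split sum_pairs_add sn sumrB/=; congr (_ - _ + _)%:E.
    by rewrite big_const_seq count_predT iter_addr addr0 mulr_natl.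
  by rewrite /vdm ln_prod.
have v0 : 0 < vdm s by rewrite /vdm big_seq; apply: prodr_gt0 => p /sd.
rewrite -[X in _ <= X * _](lnK v0) -expRD ler_expR.
move: sJ; rewrite sk lee_fin.
have := size_pairs s; rewrite sn => h.
have -> : 'C(n, 2) = size (pairs s) by rewrite bin2 -h mul2n doubleK.
lra.
Qed.
(** Settling for half of the supremum avoids compactness of the n-fold product of E and any
    continuity of h. The factor 2 vanishes after taking n-th roots. *)
Lemma exists_near_maximizer (h : R[i] -> R) (B a : R) n :
  (forall z, h z <= B) -> 0 <= a ->
  (exists2 s, size s = n & forall z, z \in s -> E z) ->
  exists s, [/\ size s = n, forall z, z \in s -> E z &
    forall s', size s' = n -> (forall z, z \in s' -> E z) ->
      vdm s' * expR (a * \sum_(z <- s') h z) <= 2 * (vdm s * expR (a * \sum_(z <- s) h z))].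
Proof.
move=> hB a0 [s0 s0n s0E].
pose F s := vdm s * expR (a * \sum_(z <- s) h z).
pose D := [set s | size s = n /\ forall z, z \in s -> E z].
have F0 s : 0 <= F s by rewrite mulr_ge0 ?vdm_ge0// expR_ge0.
have Fb s : D s -> F s <= \prod_(p <- pairs s0) (2 * M) * expR (a * (n%:R * B)).
  move=> [sn sE]; apply: ler_pM => //; first exact: vdm_ge0.
  - have -> : \prod_(p <- pairs s0) (2 * M) = \prod_(p <- pairs s) (2 * M) :> R.
      rewrite !big_const_seq !count_predT; congr (iter _ _ _).
      have := size_pairs s0; have := size_pairs s; rewrite sn s0n; lia.
    rewrite /vdm !big_seq; apply: ler_prod => p /mem_pairs[p1 p2].
    rewrite cabs_ge0/=; apply: le_trans (cabsD _ _) _; rewrite cabsN.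
    by have := EM (sE _ p1); have := EM (sE _ p2); lra.
  - rewrite ler_expR ler_wpM2l//.
    have -> : n%:R * B = \sum_(z <- s) B by rewrite big_const_seq count_predT iter_addr addr0 mulr_natl sn.
    exact: ler_sum.
have supF : has_sup [set F s | s in D].
  split; first by exists (F s0), s0.
  by eexists => _ [s Ds <-]; exact: Fb.
have [S0|S0] := ltP 0 (sup [set F s | s in D]); last first.
  exists s0; split => // s sn sE; apply: (@le_trans _ _ 0); last by apply: mulr_ge0 => //; exact: F0.
  apply: le_trans S0; apply: ub_le_sup; first by case: supF.
  by exists s.
have S20 : 0 < sup [set F s | s in D] / 2 by rewrite divr_gt0.
have [_ [s [sn sE] <-] Fs] := sup_adherent S20 supF.
exists s; split => // s' s'n s'E.
have : F s' <= sup [set F s | s in D].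
  by apply: ub_le_sup; [case: supF|exists s'].
by rewrite -/(F s) -/(F s') => h1; move: Fs h1; lra.
Qed.

(* Let s be a near-maximiser and x in s.  Comparing s with w :: rem x s bounds
   rprod (rem x s) on E by its value at x, and over x in s these values have
   product (vdm s)^2. *)
Theorem discretisation (h : borelC R -> R) (B eta : R) : measurable_fun setT h ->
  (forall z, `|h z| <= B) -> 0 < eta ->
  exists rs : seq R[i], [/\ (0 < size rs)%N, forall z, z \in rs -> E z,
    forall w, E w -> rprod rs w <= expR ((size rs)%:R * (- V + eta)) &
    (size rs)%:R * (\int[mu]_z h z - eta) <= \sum_(z <- rs) h z].
Proof.
move=> mh hB eta0.
have B0 : 0 <= B by exact: le_trans (hB 0).
have h1 z : - B <= h z by have := hB z; rewrite ler_norml => /andP[].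
have h2 z : h z <= B by have := hB z; rewrite ler_norml => /andP[].
(* The tilt changes the bound on E by at most exp(m t B), so t B <= eta/4 is wanted. *)
pose t := eta / (4 * (B + 1)).
have t0 : 0 < t by rewrite divr_gt0// mulr_gt0// ltr_pwDr.
(* Small against eta, for the bound on E, and against t eta, because recovering the mean of h
   divides the error by t. *)
pose e := eta * t / (8 * (1 + t)).
have t1 : 0 < 1 + t by rewrite addr_gt0.
have e0 : 0 < e by rewrite divr_gt0// mulr_gt0.
have e1 : e <= eta / 8.
  rewrite /e ler_pdivrMr ?mulr_gt0//; nra.
have e2 : e <= t * (eta / 8).
  rewrite /e ler_pdivrMr ?mulr_gt0//; nra.
have tB : t * B <= eta / 4.
  have B1 : 0 < B + 1 by rewrite ltr_pwDr.
  have : t * (4 * (B + 1)) = eta by rewrite /t divfK// gt_eqF// mulr_gt0.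
  by move: t0; lra.
(* Large enough to absorb the factor 2 of the near-maximiser, which becomes 2/t in the sum of h, and
   the value of h at the removed point. *)
pose n0 := (Num.trunc ((4 / t + 4 * B + 2) / eta)).+1.
have [n n0n Tn] := transfinite_diameter_le cE M1 EM EV n0 e0.
pose m := n.-1.
have nm : n = m.+1 by rewrite /m prednK// (leq_trans _ n0n).
have m0 : (0 < m)%N by rewrite -ltnS -nm (leq_ltn_trans _ n0n).
have mlarge : 4 / t + 4 * B + 2 <= m%:R * eta.
  rewrite -ler_pdivrMr//; apply: ltW; rewrite -truncn_lt_nat; last first.
    have it0 : 0 <= 4 / t by rewrite divr_ge0// ltW.
    by apply: divr_ge0 => //; [move: (4 / t) it0 B0 => X; lra|exact: ltW].
  by move: n0n; rewrite nm ltnS.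
(* The tilt written as a nonnegative weight. With m = n - 1, exp(- m sum g) is exp(a sum h) up to
   the constant exp(- a n B), where a = t m / 2. *)
pose g (z : borelC R) := t / 2 * (B - h z).
have mg : measurable_fun setT g by apply: measurable_funM => //; apply: measurable_funB.
have gB z : 0 <= g z <= t * B.
  rewrite /g; apply/andP; split.
    by rewrite mulr_ge0 ?subr_ge0 ?h2// divr_ge0// ltW.
  have := h1 z; have := h2 z; move: t0; nra.
have [s0 [s0n s0E F0]] := exists_weighted_vdm n mg gB (divr_gt0 e0 (ltr0n _ 2)).
have a0 : 0 <= t * m%:R / 2 by rewrite divr_ge0// mulr_ge0// ltW.
have [s [sn sE smax]] := @exists_near_maximizer h B (t * m%:R / 2) n h2 a0 (ex_intro2 _ _ s0 s0n s0E).
set a := t * m%:R / 2 in a0 smax.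
set P : R := (size (pairs s0))%:R in F0.
have mR0 : 1 <= m%:R :> R by rewrite ler1n.
have nR : n%:R = m%:R + 1 :> R by rewrite nm natr1.
have PE : 2 * P = n%:R * m%:R.
  by rewrite /P -[2]/(2%:R) -natrM size_pairs s0n natrM.
have aP : a * n%:R = P * t.
  transitivity (t / 2 * (n%:R * m%:R)); first by rewrite /a; ring.
  by rewrite -PE; field.
have ih : mu.-integrable setT (EFin \o h) by apply: (@bounded_integrable _ _ _ _ B).
have HB : - B <= \int[mu]_z h z.
  have := @Rintegral_dist _ mu setT h (cst 0) B measurableT ih.
  rewrite Rintegral_cst// mul0r subr0 => /(_ _ B0) H.
  have : `|\int[mu]_z h z| <= B.
    by apply: H => [|w _]; [apply: (@bounded_integrable _ _ _ _ 0) => // w _; rewrite normr0|rewrite subr0].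
  by rewrite ler_norml => /andP[].
have GE : fine (\int[mu]_z (g z)%:E)%E = t / 2 * (B - \int[mu]_z h z).
  have icB : mu.-integrable setT (EFin \o cst B).
    by apply: (@bounded_integrable _ _ _ _ `|B|).
  have iBh : mu.-integrable setT (EFin \o (fun z => B - h z)).
    apply: (@bounded_integrable _ _ _ _ (B + B)) => //; first exact: measurable_funB.
    by move=> w _; apply: le_trans (ler_normB _ _) _; rewrite lerD// ger0_norm.
  have := @RintegralZl _ _ _ mu setT _ (t / 2) measurableT iBh.
  rewrite (RintegralB measurableT icB ih) Rintegral_cst//.
  have -> : fine (mu setT) = 1 by rewrite -[RHS]/(fine 1%E); congr fine; exact: probability_setT.
  by rewrite mulr1.
have sg : \sum_(z <- s0) g z = t / 2 * (n%:R * B - \sum_(z <- s0) h z).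
  rewrite -mulr_sumr sumrB big_const_seq count_predT iter_addr addr0 s0n; congr (_ * (_ - _)).
  by rewrite mulr_natl.
have two : 2 <= expR 1 :> R by rewrite (le_trans _ (expR_ge1Dx 1)).
have F1 : expR (P * (t * \int[mu]_z h z - V) - P * e) <= 2 * (vdm s * expR (a * \sum_(z <- s) h z)).
  apply: le_trans (smax s0 s0n s0E).
  have -> : expR (P * (t * \int[mu]_z h z - V) - P * e) =
      expR (- (P * (V + t * (B - \int[mu]_z h z)) + P * e)) * expR (a * n%:R * B).
    rewrite -expRD; congr expR.
    by rewrite aP; ring.
  have -> : vdm s0 * expR (a * \sum_(z <- s0) h z) =
      vdm s0 * expR (- (n.-1%:R * \sum_(z <- s0) g z)) * expR (a * n%:R * B).
    rewrite -mulrA -expRD sg -/m; congr (_ * expR _); rewrite /a; ring.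
  rewrite ler_wpM2r ?expR_ge0//; apply: le_trans F0; rewrite ler_expR GE lerN2.
  have -> : t * (B - \int[mu]_z h z) = 2 * (t / 2 * (B - \int[mu]_z h z)) by field.
  rewrite lerD2l; have : n%:R * 1 <= n%:R * m%:R :> R by rewrite ler_wpM2l.
  rewrite mulr1 -PE => hn; rewrite [e / 2]mulrC mulrA ler_wpM2r ?(ltW e0)//.
  by rewrite ler_pdivrMr// mulrC.
have v0 : 0 < vdm s.
  rewrite lt_def vdm_ge0 andbT; apply: contraTneq F1 => ->.
  by rewrite mul0r mulr0 -ltNge expR_gt0.
have Vs : vdm s <= expR (- (V - e) * P).
  apply: le_trans (Tn s sn sE) _.
  rewrite (_ : n%:R - 1 = m%:R); last by rewrite nR addrK.
  by rewrite -(mulrA (- (V - e))) -PE -mulrA (mulrC 2) mulfK.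
have F2 : P * t * \int[mu]_z h z - 2 * P * e - 1 <= a * \sum_(z <- s) h z.
  have : expR (P * (t * \int[mu]_z h z - V) - P * e) <=
      expR (1 + (- (V - e) * P + a * \sum_(z <- s) h z)).
    apply: le_trans F1 _; rewrite !expRD; apply: ler_pM => //.
      by rewrite mulr_ge0 ?vdm_ge0 ?expR_ge0.
    by rewrite ler_wpM2r ?expR_ge0.
  by rewrite ler_expR; move: (\sum_(z <- s) h z) (\int[mu]_z h z) => S H; lra.
have F3 : n%:R * (\int[mu]_z h z - eta / 4) - 2 / t <= \sum_(z <- s) h z.
  have apos : 0 < a by rewrite /a divr_gt0// mulr_gt0// (lt_le_trans ltr01).
  rewrite -(ler_pM2l apos); apply: le_trans F2.
  have at2 : a * (2 / t) = m%:R by rewrite /a; field; rewrite gt_eqF.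
  rewrite mulrBr at2 mulrA aP; have P0 : 0 <= P by [].
  have : P * e <= P * (t * (eta / 8)) by rewrite ler_wpM2l.
  by move: (\int[mu]_z h z) => H; lra.
have c0 : 0 < expR (- (V - e) * m%:R) by rewrite expR_gt0.
have s0' : (0 < size s)%N by rewrite sn nm.
(* Since 2 P = n m, the square of the bound on [vdm s] is the n-th power of exp(-(V - e) m). *)
have [|x xs rx] := rprod_rem_small s0' v0 c0.
  rewrite sn -expRM_natl; apply: le_trans (_ : expR (- (V - e) * P) ^+ 2 <= _).
    by rewrite ler_pXn2r ?nnegrE ?vdm_ge0// expR_ge0.
  by rewrite -expRM_natl ler_expR mulrCA PE [leRHS]mulrCA.
have srs : size (rem x s) = m by rewrite size_rem// sn.
exists (rem x s); rewrite srs; split => //.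
- by move=> z /mem_rem; exact: sE.
- move=> w Ew; have /smax : size (w :: rem x s) = n by rewrite /= srs nm.
  have wE : forall z, z \in w :: rem x s -> E z.
    by move=> z; rewrite inE => /orP[/eqP ->//|/mem_rem]; exact: sE.
  move=> /(_ wE); rewrite vdm_cons (vdm_rem xs) big_cons (big_rem _ xs)/=.
  move=> hw; have v1 : 0 < vdm (rem x s).
    rewrite lt_def vdm_ge0 andbT; apply: contraTneq v0 => v00.
    by rewrite (vdm_rem xs) v00 mulr0 ltxx.
  set S := \sum_(z <- rem x s) h z in hw.
  have q0 : 0 < vdm (rem x s) * expR (a * (h w + S)) by rewrite mulr_gt0// expR_gt0.
  rewrite -(ler_pM2r q0) mulrA; apply: le_trans hw _.
  have -> : expR (a * (h x + S)) = expR (a * h x - a * h w) * expR (a * (h w + S)).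
    by rewrite -expRD; congr expR; ring.
  rewrite (_ : 2 * _ = (2 * rprod (rem x s) x * expR (a * h x - a * h w)) *
    (vdm (rem x s) * expR (a * (h w + S)))); last by ring.
  rewrite ler_wpM2r ?(ltW q0)//.
  apply: le_trans (_ : expR 1 * expR (- (V - e) * m%:R) * expR (m%:R * (eta / 4)) <= _).
    apply: ler_pM; rewrite ?expR_ge0 ?mulr_ge0 ?rprod_ge0//.
      by apply: ler_pM; rewrite ?rprod_ge0.
    rewrite ler_expR; have := ler_wpM2l (le_trans ler01 mR0) tB; rewrite /a.
    have : t * m%:R * (h x - h w) <= t * m%:R * (B + B).
      apply: ler_wpM2l; first by apply: mulr_ge0 => //; exact: ltW.
      by apply: lerD => //; rewrite lerNl.
    by move: (h x) (h w) => hx hw; lra.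
  rewrite -!expRD ler_expR.
  have : m%:R * e <= m%:R * (eta / 8) by rewrite ler_wpM2l.
  have it0 : 0 <= 4 / t by rewrite divr_ge0// ltW.
  by move: mlarge B0; move: (4 / t) it0 => X; lra.
- have : \sum_(z <- s) h z = h x + \sum_(z <- rem x s) h z by rewrite (big_rem _ xs).
  have := h2 x; move: F3 HB mlarge; rewrite nR; move: (\sum_(z <- s) h z) (\sum_(z <- rem x s) h z) (\int[mu]_z h z) => S S' H.
  have -> : 4 / t = 2 * (2 / t) by ring.
  have : eta <= m%:R * eta by rewrite ler_peMl// ltW.
  by move: (h x) (2 / t) => hx it; lra.
Qed.

End discretisation.

(** * Norms of factors *)

Section maximum_modulus.
Context {R : realType}.
Implicit Types (rs : seq R[i]) (z y : R[i]).

(** ln|p| is compared on the part of D where |p| > s, which contains no root. Points off D with a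
    neighbourhood off D need no bound, so only the frontier of D counts. *)
Lemma maximum_modulus (D : set R[i]^o) (B s : R) rs : 0 < s ->
  (forall z, D z -> \forall y \near (z : R[i]^o), D y) ->
  (forall z, D z -> cabs z <= B) ->
  (forall z, ~ D z -> rprod rs z <= s \/ \forall y \near (z : R[i]^o), ~ D y) ->
  forall z, D z -> rprod rs z <= s.
Proof.
move=> s0 openD DB bdD z Dz; rewrite leNgt; apply/negP => sz.
pose D' := [set z | D z /\ s < rprod rs z].
have nrs y : D' y -> y \notin rs.
  by move=> [_ sy]; rewrite -rprod_eq0 gt_eqF// (lt_trans s0).
suff : ((ln (rprod rs z))%:E <= (ln s)%:E)%E.
  by rewrite lee_fin ler_ln ?posrE// ?(lt_trans s0 sz)// leNgt sz.
apply: (@max_principle R D' (fun y => (ln (rprod rs y))%:E) (ln s)) => //.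
- move=> x Dx; split; first exact: ltry.
  move=> a; rewrite lte_fin => xa.
  by apply: filterS (cont_at_lt (cont_at_ln_rprod (nrs _ Dx)) xa) => y ya _; rewrite lte_fin.
- move=> x e t Dx e0 [xt] near_x.
  apply: (four_mean_no_max (four_mean_ln_rprod (nrs _ Dx)) e0).
  by apply: filterS near_x => y [_]; rewrite lee_fin xt.
- move=> x s' nDx ss'; have [xs|sx] := leP (rprod rs x) s.
    have xs' : rprod rs x < expR s'.
      by rewrite (le_lt_trans xs)// -[ltLHS]lnK ?posrE// ltr_expR.
    apply: filterS (cont_at_lt (cont_at_rprod rs x) xs') => y ys' [_ sy].
    by rewrite lte_fin -ltr_expR lnK// posrE (lt_trans s0).
  have nDx' : ~ D x by move=> Dx; apply: nDx.
  have [/le_lt_trans /(_ sx)|] := bdD _ nDx'; first by rewrite ltxx.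
  by apply: filterS => y nDy [/nDy].
- move=> s' ss'; exists (B + 1) => y [/DB yB _] By.
  by have := le_trans By yB; rewrite gerDl ler10.
- move=> y [Dy sy]; have nsy : - rprod rs y < - s by rewrite ltrN2.
  have := cont_at_lt (cont_atZ (-1) (cont_at_rprod rs y)) (_ : -1 * rprod rs y < - s).
  rewrite mulN1r => /(_ nsy) h; apply: filterS2 (openD _ Dy) h => x Dx.
  by rewrite mulN1r ltrN2.
Qed.

Lemma maximum_modulus_boundary (E : set R[i]^o) (s : R) rs : compact E -> 0 < s ->
  (forall u, boundary E u -> rprod rs u <= s) -> forall z, E z -> rprod rs z <= s.
Proof.
move=> cE s0 bE z Ez; have [M M0 EM] := compact_bounded_cabs cE.
have clE := compact_closedC cE.
have bdE y : E y -> ~ interior E y -> rprod rs y <= s.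
  by move=> Ey nEy; apply: bE; split => //; exact: subset_closure.
have [iEz|] := pselect (interior E z); last exact: bdE.
apply: (@maximum_modulus (interior E) M) iEz => //.
- by move=> y; exact: nbhs_interior.
- by move=> y /interior_subset; exact: EM.
move=> y nEy; have [Ey|nE] := pselect (E y); [left; exact: bdE|right].
have : nbhs (y : R[i]^o) (~` E) by apply: open_nbhs_nbhs; split => //; exact: closed_openC.
by apply: filterS => x nEx /interior_subset.
Qed.

(** With an empty boundary the maximum modulus principle would hold vacuously with bound 1/2, but
    the polynomial with root z + 1 has modulus 1 at z. *)
Lemma boundary_neq0 (E : set R[i]^o) : compact E -> E !=set0 -> boundary E !=set0.
Proof.
move=> cE [z Ez]; apply: contrapT => /set0P/negP; rewrite negbK => /eqP b0.
have := @maximum_modulus_boundary E (1 / 2) [:: z + 1] cE _ _ _ Ez.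
rewrite /rprod big_seq1 opprD addrA subrr add0r cabsN cabs1 => /(_ _ _)/wrap[] //.
- by move=> u; rewrite b0.
- lra.
Qed.

Lemma compact_boundary (E : set R[i]^o) : compact E -> compact (boundary E).
Proof.
move=> cE; apply: (subclosed_compact _ cE) => [|x [+ _]].
  by rewrite /boundary setDE; apply: closedI; [exact: closed_closure|apply: open_closedC; exact: open_interior].
by rewrite -(closure_id E).1//; exact: compact_closedC.
Qed.

End maximum_modulus.

Section polynomial_norms.
Context {R : realType}.
Implicit Types (E : set R[i]^o) (rs : seq R[i]) (p : {poly R[i]}).

Lemma cabs_horner_prod rs z : cabs (\prod_(a <- rs) ('X - a%:P)).[z] = rprod rs z.
Proof. by rewrite horner_prod cabs_prod; apply: eq_bigr => a _; rewrite hornerXsubC. Qed.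

Lemma monic_rootsP p : p \is monic -> exists rs, p = \prod_(a <- rs) ('X - a%:P).
Proof.
move=> /monicP p1; have [rs prs] := closed_field_poly_normal p.
by exists rs; rewrite prs p1 scale1r.
Qed.

Lemma sup_norm_le E f c : E !=set0 -> (forall z, E z -> cabs (f z) <= c) -> sup_norm E f <= c.
Proof.
move=> [z0 Ez0] fc; apply: ge_sup; first by exists (cabs (f z0)), z0.
by move=> _ [z Ez <-]; exact: fc.
Qed.

Lemma rprod_le_sup_norm E rs z : compact E -> E z ->
  rprod rs z <= sup_norm E (horner (\prod_(a <- rs) ('X - a%:P))).
Proof.
move=> cE Ez; have [M M0 EM] := compact_bounded_cabs cE.
rewrite -cabs_horner_prod; apply: ub_le_sup; last by exists z.
have [B B0 HB] := rprod_le rs; exists ((M + B) ^+ size rs) => _ [w Ew <-].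
rewrite cabs_horner_prod; apply: le_trans (HB w) _.
by rewrite lerXn2r ?nnegrE ?addr_ge0 ?cabs_ge0 ?(ltW M0)// lerD2r EM.
Qed.

End polynomial_norms.

(** * Attainment and optimality of the constant *)

Section extremal_constant.
Context {R : realType}.
Variables (E K : set R[i]^o) (mu : probability (borelC R) R) (V M : R).
Hypotheses (cE : compact E) (M1 : 1 <= M) (EM : forall z, E z -> cabs z <= M).
Hypothesis EV : forall nu : probability (borelC R) R, supported_on E nu -> (V%:E <= energy nu)%E.
Hypotheses (muE : supported_on E mu) (muV : energy mu = V%:E).
Hypotheses (cK : compact K) (KE : K `<=` E) (K0 : mu (~` K) = 0%E).
Hypothesis potK : forall z r, K z -> 0 < r -> - V <= pot mu K r z.

Local Notation KB := (K : set (borelC R)).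

Let mK : measurable KB. Proof. by apply: closed_measurableC; exact: compact_closedC. Qed.
Let KM w : K w -> cabs w <= M. Proof. by move=> /KE; exact: EM. Qed.
Let bK : bounded_by M KB. Proof. exact: KM. Qed.

Let E0 : E !=set0.
Proof.
have [z Kz] := carrier_neq0 cK K0.
by exists z; exact: KE.
Qed.

Lemma integral_conull (f : borelC R -> \bar R) : measurable_fun setT f ->
  (\int[mu]_z f z = \int[mu]_(z in KB) f z)%E.
Proof.
move=> mf; rewrite [RHS]integral_mkcond; apply: ae_eq_integral => //.
  by apply/(measurable_restrictT _ mK); exact: measurable_funTS.
exists (~` KB); split => //; first exact: measurableC.
by move=> z /= h Kz; apply: h => _; rewrite patchE mem_set.
Qed.

Lemma integral_far u :
  expeR (\int[mu]_(z in [set z : R[i] | 1 <= cabs (z - u)]%R) log_dist z u)%E =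
  (expR (pot mu K 1 u))%:E.
Proof.
transitivity (expeR (\int[mu]_z (lgr 1 u (z : R[i]))%:E)).
  congr expeR; rewrite integral_mkcond; apply: eq_integral => z _.
  rewrite patchE lgrC; case: ifPn => [/set_mem /= z1|/negP nz].
    by rewrite lgr_eq// log_distE gt_eqF// (lt_le_trans ltr01).
  rewrite /lgr (_ : Num.max _ _ = 1) ?ln1//; apply/max_idPl; rewrite leNgt; apply/negP => h.
  by apply: nz; rewrite inE /=; exact: ltW.
rewrite integral_conull; last by apply/measurable_EFinP; exact: measurable_lgr_r.
have Il := integrable_lgr mu u mK bK ltr01.
by rewrite -[X in expeR X]fineK//; exact: integrable_fin_num Il.
Qed.

(** The function [lgr 1 u] is the part of the logarithm outside the unit disc around u. Subtracting
    it from the full logarithm leaves the part inside. *)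
Lemma integral_near u :
  expeR (- \int[mu]_(z in [set z : R[i] | cabs (z - u) <= 1]%R) log_dist z u)%E =
  (expR (pot mu K 1 u - upot mu K u))%:E.
Proof.
have Il := integrable_lgr mu u mK bK ltr01.
have Iu := integrable_log_dist cK K0 M1 KM potK u.
have mlg : measurable_fun setT (fun z : borelC R => (lgr 1 u (z : R[i]))%:E).
  by apply/measurable_EFinP; exact: measurable_lgr_r.
rewrite (_ : (\int[mu]_(z in _) _)%E = (\int[mu]_z (log_dist u (z : R[i]) - (lgr 1 u (z : R[i]))%:E))%E); last first.
  rewrite integral_mkcond; apply: eq_integral => z _.
  rewrite patchE !log_distE lgrC (cabsC u); case: ifPn => [/set_mem /= z1|/negP nz].
    rewrite (_ : lgr 1 z u = 0) ?sube0//.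
    by rewrite /lgr (_ : Num.max _ _ = 1) ?ln1//; apply/max_idPl.
  have z1 : 1 < cabs (z - u) by rewrite ltNge; apply/negP => h; apply: nz; rewrite inE.
  by rewrite gt_eqF ?(lt_trans ltr01)// lgr_eq ?(ltW z1)// subee.
rewrite integral_conull; last by apply: emeasurable_funB => //; exact: measurable_log_dist_r.
rewrite integralB// (integral_log_dist cK K0 M1 KM potK).
rewrite (_ : (\int[mu]_(z in KB) (lgr 1 u z)%:E)%E = (pot mu K 1 u)%:E).
  by rewrite -EFinB -EFinN opprB.
by rewrite [RHS]fineK//; exact: integrable_fin_num Il.
Qed.

Lemma pot_near (u : R[i]) (a : R) : pot mu K 1 u < a -> \forall y \near (u : R[i]^o), pot mu K 1 y < a.
Proof.
move=> ua; apply/nbhsCP; exists (a - pot mu K 1 u) => [|y yu]; first by rewrite subr_gt0.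
have := pot_lipschitz mu y u mK bK ltr01; rewrite divr1 ler_norml => /andP[_].
by move: yu; lra.
Qed.

Lemma exists_extremal_point : exists2 u, boundary E u &
  forall v, boundary E v -> pot mu K 1 v <= pot mu K 1 u.
Proof.
apply: usc_attains_max; [exact: compact_boundary|exact: boundary_neq0|].
by move=> x a _; exact: pot_near.
Qed.

Lemma boundary_sub u : boundary E u -> E u.
Proof. by move=> [+ _]; rewrite -(closure_id E).1//; exact: compact_closedC. Qed.

Lemma extremal_factor_constant u : boundary E u ->
  (forall v, boundary E v -> pot mu K 1 v <= pot mu K 1 u) ->
  factor_constants E (expR (V + pot mu K 1 u)).
Proof.
move=> bu umax; split; first exact: expR_gt0.
move=> p q r mp /monic_rootsP[qs ->] /monic_rootsP[rs ->] ->.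
rewrite -big_cat size_prod_XsubC /=; set C := expR _; set n := size (qs ++ rs).
apply: sup_norm_le => // z Ez; rewrite cabs_horner_prod.
set P := sup_norm E _.
have P0 : 0 <= P by apply: le_trans (rprod_le_sup_norm (qs ++ rs) cE Ez); exact: rprod_ge0.
have Cn0 : 0 < C ^+ n by rewrite exprn_gt0// expR_gt0.
(* The upper bound asks for a strict inequality on K, so the norm P is enlarged by d. This also
   covers P = 0 before it is known to be impossible. *)
suff H d : 0 < d -> rprod qs z <= C ^+ n * (P + d).
  apply/ler_addgt0Pr => e e0.
  have := H (e / C ^+ n) (divr_gt0 e0 Cn0).
  by rewrite mulrDr (mulrC _ (e / _)) divfK// gt_eqF.
move=> d0; have Pd0 : 0 < P + d by rewrite ltr_wpDl.
apply: (maximum_modulus_boundary cE _ _ Ez) => [|v bv]; first by rewrite mulr_gt0.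
have Kc w : K w -> rprod (qs ++ rs) w < P + d.
  move=> /KE Ew; apply: le_lt_trans (_ : P < _); last by rewrite ltrDl.
  exact: rprod_le_sup_norm.
have := maxprod_upper cK K0 M1 KM potK v Pd0 Kc.
rewrite -/n => H; apply: (@le_trans _ _ (maxprod 1 (qs ++ rs) v)).
  rewrite /maxprod big_cat /= -[leLHS]mulr1; apply: ler_pM => //; first exact: rprod_ge0.
    by apply: ler_prod => a _; rewrite cabs_ge0 cabsC le_max lexx orbT.
  by elim: (rs) => [|a l IH]; rewrite ?big_nil// big_cons mulr_ege1// le_max lexx.
apply: le_trans H _; rewrite mulrC ler_wpM2r ?(ltW Pd0)//.
rewrite /C -expRM_natl ler_expR ler_wpM2l// lerD2l; exact: umax.
Qed.

(** Radius 1 serves the lower bound for the constant. Small radii serve the regular case, where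
    [pot] must be close to the potential at u. *)
Lemma exists_small_polynomial (r eta : R) u : 0 < r -> r <= 1 -> E u -> 0 < eta ->
  exists rs, [/\ (0 < size rs)%N,
    forall w, E w -> rprod rs w <= expR ((size rs)%:R * (- V + eta)) &
    (size rs)%:R * (pot mu K r u - eta) <= ln (maxprod r rs u)].
Proof.
move=> r0 r1 Eu eta0.
(* The cut at ln(2M) makes h bounded on the plane and is inactive on E. *)
pose h (z : borelC R) := Num.min (lgr r u (z : R[i])) (ln (2 * M)).
have lM0 : 0 <= ln (2 * M) by rewrite ln_ge0//; move: M1; lra.
have hB z : `|h z| <= `|ln r| + ln (2 * M).
  have := lgr_ge u z r0; have := ler_norm (- ln r); rewrite normrN /h => h1 h2.
  rewrite ler_norml ge_min le_min; apply/andP; split.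
    by apply/andP; split; have := normr_ge0 (ln r); lra.
  by apply/orP; right; have := normr_ge0 (ln r); lra.
have mh : measurable_fun setT h by apply: measurable_minr => //; exact: measurable_lgr_r.
have hE z : E z -> h z = lgr r u z.
  move=> Ez; apply/min_idPl; apply: lgr_le => //; first by move: M1 r1; lra.
  by apply: le_trans (cabsD _ _) _; rewrite cabsN; have := EM Ez; have := EM Eu; lra.
have hI : \int[mu]_z h z = pot mu K r u.
  have Ih : mu.-integrable setT (EFin \o h) by exact: bounded_integrable (fun w _ => hB w).
  rewrite (Rintegral_conull mK measurableT _ K0 Ih)//.
  by apply: eq_Rintegral => z /set_mem/KE; exact: hE.
have [rs [s0 rsE rsU rsL]] := discretisation cE M1 EM EV muE muV mh hB eta0.
exists rs; split => //; rewrite -hI; apply: le_trans rsL _.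
rewrite /maxprod ln_prod; last by move=> a _; rewrite lt_max r0.
by rewrite le_eqVlt; apply/orP; left; apply/eqP/eq_big_seq => a /rsE/hE ->; rewrite /lgr cabsC.
Qed.

Lemma extremal_lower u C : E u -> factor_constants E C -> expR (V + pot mu K 1 u) <= C.
Proof.
move=> Eu [C0 HC].
rewrite -[leRHS]lnK ?posrE// ler_expR; apply/ler_addgt0Pr => e e0.
have [rs [s0 rsU rsL]] := exists_small_polynomial ltr01 (lexx 1) Eu (divr_gt0 e0 (ltr0n _ 2)).
pose far := fun a : R[i] => 1 <= cabs (a - u).
have mon (l : seq R[i]) : \prod_(a <- l) ('X - a%:P) \is monic by exact: monic_prod_XsubC.
have := HC _ _ _ (mon rs) (mon [seq a <- rs | far a]) (mon [seq a <- rs | ~~ far a]).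
have pE : \prod_(a <- rs) ('X - a%:P) = \prod_(a <- [seq a <- rs | far a]) ('X - a%:P) *
    \prod_(a <- [seq a <- rs | ~~ far a]) ('X - a%:P) by rewrite !big_filter; exact: bigID.
move=> /(_ pE).
rewrite size_prod_XsubC /=; set n := size rs in s0 rsU rsL *.
have fu : expR (n%:R * (pot mu K 1 u - e / 2)) <= rprod [seq a <- rs | far a] u.
  rewrite -ler_expR lnK ?posrE ?maxprod_gt0// in rsL; apply: le_trans rsL _.
  rewrite /maxprod /rprod big_filter [leRHS]big_mkcond; apply: ler_prod => a _.
  rewrite le_max ler01/= /far (cabsC u).
  by case: ifPn => [/max_idPr ->//|]; rewrite -ltNge => /ltW/max_idPl ->.
have pu : sup_norm E (horner (\prod_(a <- rs) ('X - a%:P))) <= expR (n%:R * (- V + e / 2)).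
  by apply: sup_norm_le => // z Ez; rewrite cabs_horner_prod; exact: rsU.
move=> H; have := le_trans fu (le_trans (rprod_le_sup_norm _ cE Eu) (le_trans H _)).
have Cn : C ^+ n = expR (n%:R * ln C) by rewrite expRM_natl lnK.
move=> /(_ (expR (n%:R * ln C) * expR (n%:R * (- V + e / 2)))).
rewrite {1}Cn ler_wpM2l ?expR_ge0// => /(_ isT).
rewrite -expRD ler_expR -mulrDr ler_pM2l ?ltr0n//; lra.
Qed.

End extremal_constant.

(** * Regular points *)

Section outer_domain.
Context {R : realType}.
Variable E : set R[i]^o.
Hypothesis cE : compact E.
Implicit Types (z y : R[i]).

Local Notation Om := (outer_domain E).
Local Notation sph := (riemann_sphere R).

Lemma outer_not z : Om (Some z) -> ~ E z.
Proof. by move=> /connected_component_sub h Ez; apply: h; exists z. Qed.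

Lemma continuous_line z y : continuous (fun t : R => z + t%:C%C * (y - z) : R[i]^o).
Proof.
move=> t U /nbhsCP[r r0 rU]; have c0 : 0 < cabs (y - z) + 1 by rewrite ltr_wpDl ?cabs_ge0.
apply/nbhs_ballP; exists (r / (cabs (y - z) + 1)); first by rewrite /= divr_gt0.
move=> s; rewrite /ball /= ltr_pdivlMr// => h; apply: rU.
rewrite opprD addrACA subrr add0r -mulrBl cabsM -raddfB /= cabs_real distrC.
by apply: le_lt_trans h; rewrite ler_wpM2l// lerDl.
Qed.

Lemma connected_line z y (I : set R) : connected I ->
  connected [set (Some (z + t%:C%C * (y - z)) : sph) | t in I].
Proof.
move=> cI; apply: connected_continuous_connected => //.
apply: continuous_subspaceT => t U nU.
exact: (continuous_line nU).
Qed.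

Lemma outer_ball z y (d : R) : (forall x, cabs (x - z) < d -> ~ E x) -> cabs (y - z) < d ->
  Om (Some z) <-> Om (Some y).
Proof.
move=> dE yz.
suff h : connected_component (~` [set (Some z : sph) | z in E]) (Some z) (Some y).
  split => [|h']; first by move=> /connected_component_trans; apply.
  by apply: connected_component_trans h' _; exact: connected_component_sym.
have cseg : connected [set` `[(0 : R), 1]] by apply/connected_intervalP; exact: interval_is_interval.
exists [set (Some (z + t%:C%C * (y - z)) : sph) | t in [set` `[(0 : R), 1]]]; last first.
  by exists 1; rewrite /= ?in_itv /= ?lexx ?ler01// mul1r addrC subrK.
split; last exact: connected_line.
  by exists 0; rewrite /= ?in_itv /= ?lexx ?ler01// mul0r addr0.
move=> _ [t /= + <-] [x Ex [xt]]; rewrite in_itv /= => /andP[t0 t1].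
apply: (dE x) Ex; rewrite xt addrC addKr cabsM cabs_real ger0_norm//.
by apply: le_lt_trans yz; rewrite ler_piMl ?cabs_ge0.
Qed.

Lemma outer_far (M : R) z : 0 < M -> (forall x, E x -> cabs x <= M) -> M < cabs z -> Om (Some z).
Proof.
move=> M0 EM Mz; have z0 : 0 < cabs z by exact: lt_trans Mz.
(* The radial ray from z outwards. Its closure adds the point at infinity and stays connected. *)
pose B : set sph := [set (Some (0 + t%:C%C * (z - 0)) : sph) | t in [set` `[1, +oo[%R]].
have cB : connected B.
  by apply: connected_line; apply/connected_intervalP; exact: interval_is_interval.
have clB : closure B `<=` ~` [set (Some z : sph) | z in [set y | cabs y < cabs z]].
  rewrite closureE; apply: smallest_sub.
    apply: open_closedC; apply: one_point_compactification_open_some.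
    rewrite openE => y /= yz; apply/nbhsCP; exists (cabs z - cabs y); first by rewrite subr_gt0.
    by move=> x xy /=; have := cabsD (x - y) y; rewrite subrK; lra.
  move=> _ [t + <-] [y /= yz [yt]]; rewrite /= in_itv /= andbT => t1.
  move: yz; rewrite yt subr0 add0r cabsM cabs_real ger0_norm ?(le_trans ler01)//.
  by apply/negP; rewrite -leNgt ler_peMl// cabs_ge0.
exists (closure B); last first.
  by apply: subset_closure; exists 1; rewrite /= ?in_itv /= ?lexx// mul1r subr0 add0r.
split; last exact: connected_closure.
  move=> U [W [cW _] WU].
  have [MW MW0 WM] := compact_bounded_cabs cW.
  pose t := Num.max 1 (MW / cabs z + 1).
  have t1 : 1 <= t by rewrite le_max lexx.
  exists (Some (0 + t%:C%C * (z - 0))); split.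
    by exists t => //=; rewrite in_itv /= t1.
  apply: WU; left; exists (0 + t%:C%C * (z - 0)) => //.
  move=> /WM; rewrite subr0 add0r cabsM cabs_real ger0_norm ?(le_trans ler01)//.
  rewrite -ler_pdivlMr// leNgt => /negP; apply.
  by rewrite lt_max ltrDl ltr01 orbT.
move=> x /clB nx [y Ey xy]; apply: nx; rewrite -xy; exists y => //=.
by apply: le_lt_trans Mz; exact: EM.
Qed.

End outer_domain.

(** * Circle means and Perron competitors *)

Section circle_integral.
Context {R : realType}.
Implicit Types (q : R -> R) (a b c h : R).
Local Notation mu := lebesgue_measure.

Lemma continuous_integrable_itv q a b : continuous q ->
  mu.-integrable `[a, b] (EFin \o q).
Proof.
move=> cq; apply: continuous_compact_integrable; first exact: segment_compact.
exact: continuous_subspaceT.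
Qed.

Lemma Rintegral_itv_split q a b c : continuous q -> a <= b -> b <= c ->
  \int[mu]_(t in `[a, c]) q t = \int[mu]_(t in `[a, b]) q t + \int[mu]_(t in `[b, c]) q t.
Proof.
move=> cq ab bc; have := @Rintegral_itvB R q (BLeft a) (BRight c) b.
rewrite !bnd_simp => /(_ (continuous_integrable_itv a c cq) ab bc).
rewrite Rintegral_itv_obnd_cbnd; first by move=> <-; rewrite addrC subrK.
apply: integrableS (continuous_integrable_itv a c cq) => //.
by apply: subset_itvr => /=; rewrite bnd_simp.
Qed.

Lemma Rintegral_itv_shift q a b h : continuous q -> 0 <= h -> b = a + h ->
  \int[mu]_(t in `[a, b]) q t = \int[mu]_(t in `[0, h]) q (t + a).
Proof.
move=> cq h0 ->; rewrite /Rintegral; congr fine.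
have dF : (fun t : R => t + a)^`()%classic = cst 1.
  by apply/funext => x; rewrite derive1E deriveD// derive_id derive_cst addr0.
have := @integration_by_substitution_increasing R (fun t => t + a) q 0 h h0.
rewrite dF add0r addrC => ->.
- by apply: eq_integral => x _ /=; rewrite mulr1.
- by move=> x y _ _; rewrite ltrD2r.
- by move=> x _; exact: cst_continuous.
- exact: is_cvg_cst.
- exact: is_cvg_cst.
- split => //.
  + by apply: cvg_at_right_filter; apply: cvgD => //; exact: cvg_cst.
  + by apply: cvg_at_left_filter; apply: cvgD => //; exact: cvg_cst.
- exact: continuous_subspaceT.
Qed.

(** Links circle means to four-point sums: the integral over the circle is that of the sum over four
    points a quarter turn apart. *)
Lemma Rintegral_quarters q B : continuous q ->
  (forall t, q t + q (t + pi / 2) + q (t + pi) + q (t + 3 * (pi / 2)) <= B) ->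
  \int[mu]_(t in `[0, 2 * pi]) q t <= pi / 2 * B.
Proof.
move=> cq qB; have p0 : 0 < pi / 2 :> R by rewrite divr_gt0// pi_gt0.
have hp : 0 <= pi / 2 :> R by exact: ltW.
rewrite (@Rintegral_itv_split q 0 (pi / 2))//; [|lra].
rewrite (@Rintegral_itv_split q (pi / 2) pi)//; [|lra|lra].
rewrite (@Rintegral_itv_split q pi (3 * (pi / 2)))//; [|lra|lra].
have E1 : \int[mu]_(t in `[pi / 2, pi]) q t = \int[mu]_(t in `[0, pi / 2]) q (t + pi / 2).
  by apply: Rintegral_itv_shift => //; lra.
have E2 : \int[mu]_(t in `[pi, 3 * (pi / 2)]) q t = \int[mu]_(t in `[0, pi / 2]) q (t + pi).
  by apply: Rintegral_itv_shift => //; lra.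
have E3 : \int[mu]_(t in `[3 * (pi / 2), 2 * pi]) q t =
    \int[mu]_(t in `[0, pi / 2]) q (t + 3 * (pi / 2)).
  by apply: Rintegral_itv_shift => //; lra.
have cs a : continuous (fun t => q (t + a)).
  move=> t; apply: (@continuous_comp _ _ _ (fun t => t + a) q); last exact: cq.
  by apply: cvgD => //; exact: cvg_cst.
have I a : mu.-integrable `[0, pi / 2] (EFin \o (fun t => q (t + a))).
  exact: continuous_integrable_itv.
have I0 : mu.-integrable `[0, pi / 2] (EFin \o q) by exact: continuous_integrable_itv.
have ID (f g : R -> R) : mu.-integrable `[0, pi / 2] (EFin \o f) ->
    mu.-integrable `[0, pi / 2] (EFin \o g) ->
    mu.-integrable `[0, pi / 2] (EFin \o (fun t => f t + g t)).
  by move=> If Ig; apply: (integrableD _ If Ig).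
have I2 := ID _ _ I0 (I (pi / 2)); have I3 := ID _ _ I2 (I pi).
have I4 := ID _ _ I3 (I (3 * (pi / 2))).
rewrite E1 E2 E3 !addrA -RintegralD// -(RintegralD _ I2 (I _))// -(RintegralD _ I3 (I _))//.
rewrite (_ : pi / 2 * B = \int[mu]_(t in `[0, pi / 2]) B).
  apply: le_Rintegral => //.
  by apply: continuous_integrable_itv => t; exact: cst_continuous.
rewrite Rintegral_cst// mulrC; congr (_ * _).
have := @lebesgue_measure_itv R `[0, pi / 2].
by rewrite /= lte_fin p0 sube0 => ->.
Qed.

End circle_integral.

(** The integrals of the positive and negative parts are suprema over simple functions below them,
    and these are monotone without measurability. Perron competitors can thus be compared on circles
    without proving them measurable there. *)
Lemma le_integral_nonmeasurable d (T : measurableType d) (R : realType)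
    (mu : {measure set T -> \bar R}) (D : set T) (f g : T -> \bar R) :
  (forall x, D x -> (f x <= g x)%E) ->
  (\int[mu]_(x in D) f x <= \int[mu]_(x in D) g x)%E.
Proof.
move=> fg; have fgD x : ((f \_ D) x <= (g \_ D) x)%E.
  by rewrite !patchE; case: ifPn => // /set_mem; exact: fg.
rewrite /integral; apply: leeB.
  apply: ereal_sup_le => _ [h hf <-]; exists h => // x; apply: le_trans (hf x) _.
  by rewrite !funeposE ge_max !le_max fgD lexx orbT.
apply: ereal_sup_le => _ [h hf <-]; exists h => // x; apply: le_trans (hf x) _.
by rewrite !funenegE ge_max !le_max leeN2 fgD lexx orbT.
Qed.

Section submean.
Context {R : realType}.
Implicit Types (z y : R[i]) (r t : R) (v : riemann_sphere R -> \bar R).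

Local Notation arc r t := (r%:C%C * unit_circle t).

Lemma cabs_arc r t : 0 <= r -> cabs (arc r t) = r.
Proof.
move=> r0; rewrite cabsM cabs_real ger0_norm// (_ : cabs _ = 1) ?mulr1//.
by rewrite /cabs normc_def /= cos2Dsin2 sqrtr1.
Qed.

Lemma arcDpihalf r t : arc r (t + pi / 2) = 'i%C * arc r t.
Proof. by rewrite /unit_circle cosDpihalf sinDpihalf; apply/eqP; rewrite eq_complex /=; apply/andP; split; apply/eqP; ring. Qed.

Lemma arcDpi r t : arc r (t + pi) = - arc r t.
Proof. by rewrite /unit_circle cosDpi sinDpi; apply/eqP; rewrite eq_complex /=; apply/andP; split; apply/eqP; ring. Qed.

Lemma continuous_arc (Q : R[i] -> R) z r : 0 < r ->
  (forall t, cont_at Q (z + arc r t)) -> continuous (fun t => Q (z + arc r t)).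
Proof.
move=> r0 cQ t; apply/cvgrPdist_lt => e e0.
have /nbhsCP[d d0 dQ] := cQ t e e0.
have d20 : 0 < d / (2 * r) by rewrite divr_gt0// mulr_gt0.
have cc := @continuous_cos R t; have cs := @continuous_sin R t.
move: cc cs => /cvgrPdist_lt /(_ _ d20) cc /cvgrPdist_lt /(_ _ d20) cs.
apply: filterS2 cc cs => s cc cs; rewrite distrC; apply: dQ.
rewrite opprD addrACA subrr add0r -mulrBr cabsM cabs_real gtr0_norm//.
have : cabs (unit_circle s - unit_circle t) < d / r.
  apply: le_lt_trans (cabs_le_ReIm _) _ => /=.
  rewrite (distrC (cos s)) (distrC (sin s)) (_ : d / r = d / (2 * r) + d / (2 * r)).
    exact: ltrD.
  by field; rewrite gt_eqF.
by rewrite ltr_pdivlMr// mulrC.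
Qed.

(** Otherwise the mean of v over a small circle would be at most that of the right-hand side, which
    is T - H z - e r^2 + O(r^4) and hence below v at z. *)
Lemma submean_no_max v z (H : R[i] -> R) (T e : R) : four_mean H z ->
  (\forall y \near (z : R[i]^o), cont_at H y) -> 0 < e ->
  (exists2 rho : R, 0 < rho & forall r, 0 < r -> r < rho -> (v (Some z) <= circle_mean v (Some z) r)%E) ->
  v (Some z) = (T - H z)%:E ->
  ~ \forall y \near (z : R[i]^o), (v (Some y) <= (T - H y + e * (cabs z ^+ 2 - cabs y ^+ 2))%:E)%E.
Proof.
move=> [c c0 [r1 r10 four]] nearH e0 [rho rho0 sub] vz near_le.
have nb : \forall y \near (z : R[i]^o), cont_at H y /\
    (v (Some y) <= (T - H y + e * (cabs z ^+ 2 - cabs y ^+ 2))%:E)%E by exact: filterI.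
move/nbhsCP: nb => [r2 r20 r2P].
pose r := Num.min (Num.min (r1 / 2) (r2 / 2)) (Num.min (Num.min 1 (rho / 2)) (e / (c + 1))).
have c1 : 0 < c + 1 by rewrite ltr_wpDl.
have r0 : 0 < r by rewrite /r !lt_min !divr_gt0// ltr01.
have rr1 : r < r1 by rewrite /r !gt_min ltr_pdivrMr// ltr_pMr// ltr1n.
have rr2 : r < r2 by rewrite /r !gt_min (@ltr_pdivrMr _ 2 _ r2)// (ltr_pMr _ r20) ltr1n ?orbT.
have rrho : r < rho by rewrite /r !gt_min (@ltr_pdivrMr _ 2 _ rho)// (ltr_pMr _ rho0) ltr1n ?orbT.
have r_le1 : r <= 1 by rewrite /r !ge_min lexx ?orbT.
have rec : r <= e / (c + 1) by rewrite /r !ge_min lexx !orbT.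
pose Q y := T - H y + e * (cabs z ^+ 2 - cabs y ^+ 2).
have arcd t : cabs (z + arc r t - z) < r2 by rewrite addrC addKr cabs_arc// ltW.
have cq : continuous (fun t => Q (z + arc r t)).
  apply: continuous_arc => // t d d0; have [cH _] := r2P _ (arcd t).
  have := cont_atD (cont_atD (cont_at_cst T _) (cont_atZ (-1) cH))
    (cont_atD (cont_at_cst (e * cabs z ^+ 2) _) (cont_atZ (- e) (cont_at_rprod [:: 0; 0] _))) d0.
  apply: filterS => y; rewrite /Q /rprod !big_cons !big_nil !mulr1 !subr0 -!expr2.
  by rewrite !mulN1r !mulrBr !mulNr.
have := sub r r0 rrho; rewrite vz.
apply/negP; rewrite -ltNge.
set B := 4 * (T - H z) - 4 * e * r ^+ 2 + c * r ^+ 4.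
have QB t : Q (z + arc r t) + Q (z + arc r (t + pi / 2)) + Q (z + arc r (t + pi)) + Q (z + arc r (t + 3 * (pi / 2))) <= B.
  rewrite (_ : t + 3 * (pi / 2) = t + pi / 2 + pi); last by field.
  rewrite !arcDpi !arcDpihalf; set h := arc r t.
  have hr : cabs h = r by rewrite cabs_arc// ltW.
  have := four h; rewrite hr => /(_ rr1); rewrite ler_norml => /andP[f4 _].
  have := sum4_sqr z h; rewrite hr /sum4 /Q => s4; move: f4; rewrite /sum4 /B.
  move: (H (z + h)) (H (z - h)) (H (z + 'i%C * h)) (H (z - 'i%C * h)) => h1 h2 h3 h4.
  move: s4; move: (cabs (z + h) ^+ 2) (cabs (z - h) ^+ 2) (cabs (z + 'i%C * h) ^+ 2)
    (cabs (z - 'i%C * h) ^+ 2) => a1 a2 a3 a4.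
  move: (cabs z ^+ 2) (r ^+ 2) (c * r ^+ 4) (H z) => Z r2' cr Hz s4 f4.
  have -> : a4 = 4 * Z + 4 * r2' - a1 - a2 - a3 by rewrite -s4; ring.
  by move: f4; lra.
have Bt : B < 4 * (T - H z).
  rewrite /B; have : c * r ^+ 4 < 4 * e * r ^+ 2.
    rewrite (exprD r 2 2) mulrA ltr_pM2r ?exprn_gt0//.
    rewrite ler_pdivlMr// in rec; have : r ^+ 2 <= r by rewrite expr2 ler_piMl// ltW.
    by move=> h; have : c * r ^+ 2 <= c * r by [rewrite ler_wpM2l]; move: rec e0 r0; lra.
  lra.
have int_le := Rintegral_quarters cq QB.
have p2 : 0 < 2 * pi :> R by rewrite mulr_gt0// pi_gt0.
rewrite /circle_mean; apply: (@le_lt_trans _ _ ((2 * pi)^-1%:E *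
    \int[lebesgue_measure]_(t in `[0%R, (2 * pi)%R]) (Q (z + arc r t))%:E)%E).
  rewrite lee_pmul2l ?lte_fin ?invr_gt0//; apply: le_integral_nonmeasurable => t _ /=.
  by have [_] := r2P _ (arcd t).
have Iq := continuous_integrable_itv 0 (2 * pi) cq.
rewrite -[X in (_ * X)%E]fineK; last by apply: integrable_fin_num.
rewrite -EFinM lte_fin mulrC ltr_pdivrMr//.
apply: le_lt_trans int_le _.
have : pi / 2 * B < pi / 2 * (4 * (T - H z)) by rewrite ltr_pM2l// divr_gt0// pi_gt0.
lra.
Qed.

End submean.

Section perron_comparison.
Context {R : realType}.
Variables (E : set R[i]^o) (M : R).
Hypotheses (cE : compact E) (M1 : 1 <= M) (EM : forall z, E z -> cabs z <= M).
Implicit Types (z y : R[i]) (rs : seq R[i]) (v : riemann_sphere R -> \bar R).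

Local Notation Om := (outer_domain E).

Lemma near_Some z (P : set (riemann_sphere R)) : nbhs (Some z : riemann_sphere R) P ->
  \forall y \near (z : R[i]^o), P (Some y).
Proof. by []. Qed.

Lemma near_None (P : set (riemann_sphere R)) : nbhs (None : riemann_sphere R) P ->
  exists B : R, forall y, B < cabs y -> P (Some y).
Proof.
move=> [W [cW _] WP]; have [B B0 WB] := compact_bounded_cabs cW.
exists B => y By; apply: WP; left; exists y => // /WB.
by rewrite leNgt By.
Qed.

Lemma off_compact z : ~ E z -> exists2 d : R, 0 < d & forall y, cabs (y - z) < d -> ~ E y.
Proof.
move=> nEz; have oE : open (~` E) by apply: closed_openC; exact: compact_closedC.
by have /nbhsCP : nbhs (z : R[i]^o) (~` E) by exact: open_nbhs_nbhs.
Qed.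

Lemma near_outer z : Om (Some z) -> \forall y \near (z : R[i]^o), Om (Some y).
Proof.
move=> Oz; have [d d0 dE] := off_compact (outer_not Oz).
by apply/nbhsCP; exists d => // y yz; apply/(outer_ball dE yz).
Qed.

Lemma near_not_outer z : ~ E z -> ~ Om (Some z) -> \forall y \near (z : R[i]^o), ~ Om (Some y).
Proof.
move=> nEz nOz; have [d d0 dE] := off_compact nEz.
by apply/nbhsCP; exists d => // y yz /(outer_ball dE yz).
Qed.

(** Off E and off the outer domain lie only the bounded components of the complement, where the
    maximum modulus principle applies. *)
Lemma rprod_off_outer rs (c : R) z : 0 < c -> (forall y, E y -> rprod rs y <= c) ->
  ~ Om (Some z) -> rprod rs z <= c.
Proof.
move=> c0 Ec nOz; have [Ez|nEz] := pselect (E z); first exact: Ec.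
have M0 : 0 < M by exact: lt_le_trans M1.
apply: (@maximum_modulus R [set y | ~ E y /\ ~ Om (Some y)] M) (conj nEz nOz) => //.
- move=> y [nEy nOy]; have [d d0 dE] := off_compact nEy.
  have near_E : \forall x \near (y : R[i]^o), ~ E x by apply/nbhsCP; exists d.
  exact: filterI near_E (near_not_outer nEy nOy).
- move=> y [nEy nOy]; rewrite leNgt; apply/negP => My; apply: nOy.
  exact: (outer_far M0 EM).
- move=> y nD; have [Ey|nEy] := pselect (E y); [by left; exact: Ec|right].
  have Oy : Om (Some y) by apply: contrapT => nOy; exact: nD.
  by apply: filterS (near_outer Oy) => x Ox [].
Qed.

Variables (phi : riemann_sphere R -> R) (s : R[i] -> R) (B0 : R).
Hypothesis cont_s : forall z, Om (Some z) -> cont_at s z.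
Hypothesis four_s : forall z, Om (Some z) -> four_mean s z.
Hypothesis phi_s : forall z d, E z -> 0 < d ->
  \forall y \near (z : R[i]^o), Om (Some y) -> phi (Some z) <= s y + d.
Hypothesis s_far : forall y, B0 <= cabs y -> ln (cabs y / 2) <= s y.

(* The strict inequality a * size rs < 1 makes the left-hand side tend to -oo at
   infinity. *)
Lemma perron_comparison v rs (a c : R) z : perron_family Om phi v -> 0 < a ->
  a * (size rs)%:R < 1 -> 0 < c -> (forall y, E y -> rprod rs y < c) ->
  Om (Some z) -> z \notin rs ->
  (v (Some z) + (a * (ln (rprod rs z) - ln c) - s z)%:E <= 0)%E.
Proof.
move=> [sub bd] a0 an c0 Ec Oz zrs.
pose D : set R[i]^o := [set y | Om (Some y) /\ y \notin rs].
(* v + H has limits at most 0 at E, since s stays asymptotically above phi, and -oo at roots and at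
   infinity, where v is bounded above by semicontinuity at [None]. *)
pose H y := a * (ln (rprod rs y) - ln c) - s y.
have contH y : D y -> cont_at H y.
  move=> [Oy yrs] e e0.
  have c1 := cont_atZ a (cont_atD (cont_at_ln_rprod yrs) (cont_at_cst (- ln c) y)).
  have := cont_atD c1 (cont_atZ (-1) (cont_s Oy)) e0.
  by apply: filterS => x; rewrite /H !mulN1r.
have fourH y : D y -> four_mean H y.
  move=> [Oy yrs].
  have c1 := four_meanZ a (four_meanD (four_mean_ln_rprod yrs) (four_mean_cst (- ln c) y)).
  have [C C0 [r r0 h]] := four_meanD c1 (four_meanZ (-1) (four_s Oy)).
  exists C => //; exists r => // k /h.
  by rewrite /H /sum4 !mulN1r.
have openD y : D y -> \forall x \near (y : R[i]^o), D x.
  move=> [Oy yrs]; have nsy : -1 * rprod rs y < 0 by rewrite mulN1r oppr_lt0 rprod_gt0.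
  apply: filterS2 (near_outer Oy) (cont_at_lt (cont_atZ (-1) (cont_at_rprod rs y)) nsy) => x Ox.
  by rewrite mulN1r oppr_lt0 => h; split => //; rewrite -rprod_eq0 gt_eqF.
have bound_real (y : riemann_sphere R) : (v y < +oo)%E -> exists t : R, (v y < t%:E)%E.
  by case: (v y) => [t _|//|_]; [exists (t + 1); rewrite lte_fin ltrDl|exists 0; exact: ltNy0].
apply: (@max_principle R D (fun y => (v (Some y) + (H y)%:E)%E) 0) (conj Oz zrs) => //.
- move=> y Dy; have [vfin usc _] := sub _ Dy.1; split.
    by case: (v (Some y)) vfin => // t _; exact: ltry.
  move=> b yb; have [t vt tb] : exists2 t : R, (v (Some y) < t%:E)%E & t + H y < b.
    case: (v (Some y)) vfin yb => [t _|//|_ _].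
      rewrite -EFinD lte_fin => h; exists ((t + (b - H y)) / 2); last by lra.
      by rewrite lte_fin; lra.
    by exists (b - H y - 1); [exact: ltNyr|lra].
  have Hy : H y < b - t by lra.
  apply: filterS2 (near_Some (usc _ vt)) (cont_at_lt (contH _ Dy) Hy) => x h1 h2 _.
  case: (v (Some x)) h1 => [p|//|_]; last by rewrite ltNyr.
  by rewrite -EFinD !lte_fin; lra.
- move=> y e t Dy e0 yt near_y; have [_ _ mean] := sub _ Dy.1.
  have vy : v (Some y) = (t - H y)%:E.
    by case: (v (Some y)) yt => // p; rewrite -EFinD => -[<-]; rewrite addrK.
  apply: (submean_no_max (fourH _ Dy) _ e0 mean vy).
    by apply: filterS (openD _ Dy) => x; exact: contH.
  apply: filterS near_y => x [_]; case: (v (Some x)) => [p||]; rewrite ?leNye//.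
  by rewrite -EFinD !lee_fin; lra.
- move=> y s' nDy s'0; have [Oy|nOy] := pselect (Om (Some y)).
    have yrs : y \in rs by apply: contra_notT nDy => yrs; split.
    have [vfin usc _] := sub _ Oy; have [t vt] := bound_real (Some y) vfin.
    have n1 := cont_s Oy ltr01.
    have n2 := ln_rprod_root (s' - t + (s y - 1)) yrs a0 c0.
    apply: filterS3 (near_Some (usc _ vt)) n1 n2 => x h0 h1 h2 [Ox /h2 h4].
    move: h1; rewrite ltr_norml => /andP[h1 _]; rewrite /H.
    case: (v (Some x)) h0 => [p|//|_]; last by rewrite ltNyr.
    by rewrite -EFinD !lte_fin; lra.
  have [Ey|nEy] := pselect (E y); last first.
    by apply: filterS (near_not_outer nEy nOy) => x nOx [].
  have [cl|ncl] := pselect (closure Om (Some y)); last first.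
    move: ncl => /existsNP[U /not_implyP[nU hU]].
    by apply: filterS (near_Some nU) => x Ux [Ox _]; case: hU; exists (Some x).
  have bdy : boundary Om (Some y) by split => // /interior_subset.
  have s30 : 0 < s' / 3 by rewrite divr_gt0.
  have n1 : \forall x \near (y : R[i]^o), Om (Some x) -> (v (Some x) < (phi (Some y) + s' / 3)%:E)%E.
    have : (limf_esup v (within Om (nbhs (Some y : riemann_sphere R))) < (phi (Some y) + s' / 3)%:E)%E.
      by apply: le_lt_trans (bd _ bdy) _; rewrite lte_fin ltrDl.
    move=> /ereal_inf_lt[_ [U nU <-] supU].
    apply: filterS (near_Some nU) => x Ux Ox; apply: le_lt_trans supU.
    by apply: ereal_sup_ubound; exists (Some x) => //; exact: Ux.
  apply: filterS3 n1 (phi_s Ey s30) (cont_at_lt (cont_at_rprod rs y) (Ec _ Ey)) => x h1 h2 h3 [Ox xrs].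
  have h4 : a * (ln (rprod rs x) - ln c) <= 0.
    by rewrite pmulr_rle0// subr_le0; apply: ln_le; [exact: rprod_gt0|exact: ltW].
  move: (h1 Ox) (h2 Ox) => {}h1 {}h2; rewrite /H.
  case: (v (Some x)) h1 => [p|//|_]; last by rewrite ltNyr.
  by rewrite -EFinD !lte_fin; lra.
- move=> s' s'0; have ON : Om None by apply: connected_component_refl => -[].
  have [vfin usc _] := sub _ ON; have [t vt] := bound_real None vfin.
  have [B1 HB1] := near_None (usc _ vt).
  have [B HB] := ln_rprod_far c (s' - t) a0 an.
  exists (Num.max B0 (Num.max (B1 + 1) B)) => y [Oy yrs].
  rewrite !ge_max => /andP[yB0 /andP[yB1 yB]]; rewrite /H.
  have := s_far yB0; have := HB _ yB yrs.
  have g6 : B1 < cabs y by move: yB1; lra.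
  move: (HB1 _ g6); case: (v (Some y)) => [p|//|_]; last by rewrite ltNyr.
  by rewrite -EFinD !lte_fin; lra.
Qed.

End perron_comparison.

Section regular_points.
Context {R : realType}.
Variables (E K : set R[i]^o) (mu : probability (borelC R) R) (V M : R).
Hypotheses (cE : compact E) (M1 : 1 <= M) (EM : forall z, E z -> cabs z <= M).
Hypotheses (cK : compact K) (KE : K `<=` E) (K0 : mu (~` K) = 0%E).
Hypothesis potK : forall z r, K z -> 0 < r -> - V <= pot mu K r z.
Implicit Types (z y u : R[i]) (rs : seq R[i]).

Local Notation KB := (K : set (borelC R)).
Local Notation Om := (outer_domain E).

Let mK : measurable KB. Proof. by apply: closed_measurableC; exact: compact_closedC. Qed.
Let KM w : K w -> cabs w <= M. Proof. by move=> /KE; exact: EM. Qed.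
Let bK : bounded_by M KB. Proof. exact: KM. Qed.

(** Removing a ball around u of mass at most 1/2 leaves a part of mu whose potential is continuous
    near u. *)
Lemma exists_far_mass u : exists r (A : set (borelC R)),
  [/\ 0 < r, measurable A, A `<=` KB, separated r A u & 1 / 2 <= fine (mu A)].
Proof.
have KE1 : fine (mu KB) = 1 by exact: (f_equal fine (conull_probability mK K0)).
have [Ku|nKu] := pselect (K u); last first.
  have [d d0 sd] := off_carrier cK nKu.
  by exists d, KB; split => //; rewrite KE1; lra.
have h0 : 0 < 1 / 2 :> R by lra.
have [r /andP[r0 _]] := small_ball_mass cK K0 M1 KM potK Ku h0.
set B := [set w | _] => mB.
have mBb : measurable B.
  rewrite /B (_ : [set w | _] = (fun w : borelC R => cabs (u - w)) @^-1` [set` `]-oo, r[ ]).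
    by rewrite -[X in measurable X]setTI; apply: measurable_cabs_sub.
  by apply/seteqP; split => w /=; rewrite in_itv.
exists r, (KB `\` B); split => //; first exact: measurableD.
  by move=> w [_ /= h]; rewrite leNgt; exact/negP.
have := measureDI mu mK mBb; move=> /(congr1 fine).
rewrite KE1 fineD ?fin_num_measure//; last 2 first.
- exact: measurableD.
- exact: measurableI.
by rewrite (setIC KB); move: mB; lra.
Qed.

Section far_part.
Variables (A : set (borelC R)).
Hypotheses (mA : measurable A) (AK : A `<=` KB) (A2 : 1 / 2 <= fine (mu A)).

Let bA : bounded_by M A. Proof. by move=> w /AK; exact: KM. Qed.

(* Normalised to grow like ln|z| at infinity. *)
Definition far_pot z : R := (fine (mu A))^-1 * logpot mu A z.

Let m0 : 0 < fine (mu A). Proof. by apply: lt_le_trans A2. Qed.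

Lemma cont_at_far_pot d z : 0 < d -> separated d A z -> cont_at far_pot z.
Proof. by move=> d0 sA; apply: cont_atZ => e; exact: (logpot_near mu mA bA d0 sA). Qed.

Lemma four_mean_far_pot d z : 0 < d -> separated d A z -> four_mean far_pot z.
Proof. by move=> d0 sA; apply: four_meanZ; exact: (logpot_four_mean mu mA bA d0 sA). Qed.

Lemma far_pot_far z : 2 * M <= cabs z -> ln (cabs z / 2) <= far_pot z.
Proof.
move=> zM; have z0 : 0 < cabs z / 2 by move: M1 zM; lra.
have sz : separated (cabs z / 2) A z.
  move=> w Aw; have := bA Aw; have := cabs_dist z w; rewrite ler_norml => /andP[_].
  by move: zM; lra.
rewrite /far_pot ler_pdivlMl// mulrC -Rintegral_cst//; apply: le_Rintegral => //.
- by apply: (@bounded_integrable _ _ _ _ `|ln (cabs z / 2)|).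
- exact: (integrable_logpot mu mA bA z0 sz).
- by move=> w Aw; apply: ln_le => //; exact: sz.
Qed.

(** The rest K \ A contributes at most ln(2M + 1) to a potential that is at least -V. The factor 2
    comes from dividing by a mass of at least 1/2. *)
Lemma far_pot_ge z : ~ K z -> cabs z <= M + 1 ->
  - (2 * (`|V| + ln (2 * M + 1))) <= far_pot z.
Proof.
move=> nKz zM; have [d d0 sd] := off_carrier cK nKz.
have l0 : 0 <= ln (2 * M + 1) by apply: ln_ge0; move: M1; lra.
have mD : measurable (KB `\` A) by exact: measurableD.
have IK := integrable_logpot mu mK bK d0 sd.
have H : - V <= logpot mu A z + ln (2 * M + 1).
  apply: le_trans (frostman_off cK K0 M1 KM potK nKz) _.
  rewrite /logpot -{1}(setDUK AK) Rintegral_setU//; last 2 first.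
  - by rewrite setDUK.
  - by apply/disj_setPS => w [Aw []].
  rewrite lerD2l; apply: (@le_trans _ _ (\int[mu]_(w in KB `\` A) ln (2 * M + 1))).
    apply: le_Rintegral => //.
    - by apply: integrableS IK => // w [].
    - by apply: (@bounded_integrable _ _ _ _ `|ln (2 * M + 1)|).
    move=> w [Kw _]; apply: ln_le; first by apply: lt_le_trans d0 _; exact: sd.
    by apply: le_trans (cabsD _ _) _; rewrite cabsN; have := KM Kw; move: zM; lra.
  rewrite Rintegral_cst// ler_piMr//; have /andP[_] := fine_prob_le1 mu mD; exact.
rewrite /far_pot ler_pdivlMl//.
have V1 : - `|V| <= - V by rewrite lerN2 ler_norm.
have : 1 * (`|V| + ln (2 * M + 1)) <= 2 * fine (mu A) * (`|V| + ln (2 * M + 1)).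
  by rewrite ler_wpM2r ?addr_ge0//; move: A2; lra.
by move: H V1; move: (fine (mu A)) (`|V|) (ln _) => x y z'; lra.
Qed.

End far_part.

(** The function is constant outside the disc of radius r around u, whence its continuity at
    infinity. *)
Lemma continuous_barrier u (L Mp r : R) : 0 < r -> 0 <= Mp ->
  continuous (fun x : riemann_sphere R => if x is Some y then
    L - Mp * Num.min 1 (cabs (y - u) / r) else L - Mp : R).
Proof.
move=> r0 Mp0 [y|] U /nbhs_ballP[e /= e0 eU]; last first.
  exists [set w | cabs w <= cabs u + r].
    by split; [exact: compact_disc|apply: compact_closedC; exact: compact_disc].
  move=> _ [[w /= /negP wr <-]|->]; apply: eU; rewrite /ball /=; last by rewrite subrr normr0.
  rewrite (_ : Num.min _ _ = 1) ?mulr1 ?subrr ?normr0//; apply/min_idPl.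
  rewrite ler_pdivlMr// mul1r; have := cabsD (w - u) u; rewrite subrK.
  by move: wr; rewrite -ltNge; lra.
have h0 : 0 < e * r / (Mp + 1) by rewrite divr_gt0 ?mulr_gt0// ltr_wpDl.
suff : \forall w \near (y : R[i]^o), `|L - Mp * Num.min 1 (cabs (y - u) / r) -
    (L - Mp * Num.min 1 (cabs (w - u) / r))| < e.
  by move=> near_w; change (\forall w \near (y : R[i]^o), U (L - Mp * Num.min 1 (cabs (w - u) / r))); apply: filterS near_w => w; exact: eU.
apply: filterS (cont_at_cabs u y h0) => w; rewrite distrC => h.
rewrite opprB addrCA addrAC subrr add0r -mulrBr normrM (ger0_norm Mp0).
have minl (a b : R) : `|Num.min 1 a - Num.min 1 b| <= `|a - b|.
  wlog ab : a b / a <= b.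
    by move=> H; have [|/ltW] := leP a b; [exact: H|rewrite distrC (distrC a); exact: H].
  rewrite distrC (distrC a) !ger0_norm ?subr_ge0//; last by rewrite le_min !ge_min lexx ab orbT.
  by case: (leP 1 a); case: (leP 1 b); lra.
apply: (@le_lt_trans _ _ (Mp * (`|cabs (y - u) - cabs (w - u)| / r))).
  rewrite ler_wpM2l// distrC; apply: le_trans (minl _ _) _.
  by rewrite -mulrBl normrM [`|r^-1|]ger0_norm ?invr_ge0// ltW.
apply: (@le_lt_trans _ _ (Mp * (e / (Mp + 1)))).
  by rewrite ler_wpM2l// ler_pdivrMr// mulrAC ltW.
by rewrite mulrA ltr_pdivrMr ?ltr_wpDl// [ltLHS]mulrC ltr_pM2l// ltrDl.
Qed.

Lemma regular_local_bound u eta : regular_compact E -> E u -> 0 < eta ->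
  exists2 r : R, 0 < r & forall rs c, 0 < c -> (forall y, E y -> rprod rs y < c) ->
    forall z, cabs (z - u) < r -> rprod rs z <= c * expR ((size rs)%:R * eta).
Proof.
move=> reg Eu eta0.
have off rs c z : 0 < c -> (forall y, E y -> rprod rs y < c) -> ~ Om (Some z) ->
    rprod rs z <= c * expR ((size rs)%:R * eta).
  move=> c0 Ec nOz; have Ec' y : E y -> rprod rs y <= c by move=> /Ec/ltW.
  apply: le_trans (rprod_off_outer cE M1 EM c0 Ec' nOz) _.
  by rewrite ler_peMr ?(ltW c0)// -[leLHS]expR0 ler_expR mulr_ge0// ltW.
have nOu : ~ Om (Some u) by move=> /outer_not.
have [cl|ncl] := pselect (closure Om (Some u)); last first.
  move: ncl => /existsNP[U /not_implyP[nU hU]].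
  have /nbhsCP[r r0 rU] := near_Some nU.
  exists r => // rs c c0 Ec z zr; apply: off => // Oz; apply: hU.
  by exists (Some z); split => //; exact: rU.
have bdu : boundary Om (Some u) by split => // /interior_subset.
have [r [A [r0 mA AK sA A2]]] := exists_far_mass u.
(* Three losses of eta/3: s varies by one near u, the boundary value at u lies one below s u, and
   the Perron solution drops at most one below it. *)
pose s := far_pot A; pose L := s u - eta / 3.
have e30 : 0 < eta / 3 by rewrite divr_gt0.
pose S := 2 * (`|V| + ln (2 * M + 1)).
have S0 : 0 <= S by rewrite /S mulr_ge0// addr_ge0// ln_ge0//; move: M1; lra.
have cs : cont_at s u by exact: (cont_at_far_pot mA AK r0 sA).
have /nbhsCP[r1 r10 r1P] := cs _ e30.
(* Makes the boundary data L - Mp at most -S away from u, below the lower bound of s there. *)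
pose Mp := `|L| + S.
have Mp0 : 0 <= Mp by rewrite addr_ge0.
pose phi (x : riemann_sphere R) : R :=
  if x is Some y then L - Mp * Num.min 1 (cabs (y - u) / r1) else L - Mp.
have cphi : {within boundary Om, continuous phi}.
  by apply: continuous_subspaceT; exact: continuous_barrier.
have sepz z : Om (Some z) -> exists2 d : R, 0 < d & separated d A z.
  move=> Oz; have nKz : ~ K z by move=> /KE; exact: outer_not.
  by have [d d0 sd] := off_carrier cK nKz; exists d => // w /AK; exact: sd.
have phi_s z d : E z -> 0 < d ->
    \forall y \near (z : R[i]^o), Om (Some y) -> phi (Some z) <= s y + d.
  move=> Ez d0; have [zr|rz] := ltP (cabs (z - u)) r1.
    apply/nbhsCP; exists (r1 - cabs (z - u)) => [|y yz _]; first by rewrite subr_gt0.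
    have yu : cabs (y - u) < r1 by have := cabs_triangle y z u; move: yz; lra.
    have := r1P _ yu; rewrite ltr_norml => /andP[h _].
    have : 0 <= Mp * Num.min 1 (cabs (z - u) / r1).
      by rewrite mulr_ge0// le_min ler01 divr_ge0 ?cabs_ge0// ltW.
    by rewrite /phi /L; move: h d0; lra.
  apply/nbhsCP; exists 1 => // y yz Oy.
  have ym : cabs y <= M + 1 by have := cabsD (y - z) z; rewrite subrK; have := EM Ez; move: yz; lra.
  have nKy : ~ K y by move=> /KE; exact: outer_not.
  have := far_pot_ge mA AK A2 nKy ym; rewrite -/S -/(s y) => h.
  rewrite /phi (_ : Num.min _ _ = 1); last first.
    by apply/min_idPl; rewrite ler_pdivlMr// mul1r.
  by rewrite mulr1 /Mp; have := ler_norm L; move: h d0; lra.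
have phiu : phi (Some u) = L.
  by rewrite /phi subrr cabs0 mul0r (_ : Num.min _ _ = 0) ?mulr0 ?subr0//; apply/min_idPr.
have := reg _ bdu phi cphi; rewrite phiu => hP.
have Lr : L - eta / 3 < L by lra.
have := hP _ (@nbhs_open_ereal_gt _ L (fun=> L - eta / 3) Lr) => /= nP.
have /nbhsCP[r2 r20 r2P] := near_Some nP.
exists (Num.min r1 r2); first by rewrite lt_min r10.
move=> rs c c0 Ec z; rewrite lt_min => /andP[zr1 zr2].
have [Oz|] := pselect (Om (Some z)); last exact: off.
have [zrs|zrs] := boolP (z \in rs).
  rewrite (eqP (_ : rprod rs z == 0)) ?rprod_eq0//.
  by rewrite mulr_ge0 ?expR_ge0// ltW.
have [_ [v pv <-] Lv] := ereal_sup_gt (r2P _ zr2 Oz).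
rewrite -[X in X * _](lnK c0) -expRD -[leLHS](lnK (rprod_gt0 zrs)) ler_expR -lerBlDl.
rewrite leNgt; apply/negP => big.
set X := ln (rprod rs z) - ln c in big.
have n0 : 0 <= (size rs)%:R * eta by rewrite mulr_ge0// ltW.
have X0 : 0 < X by exact: le_lt_trans big.
(* The exponent eta / X is admissible exactly because X exceeds n eta. The comparison then gives eta
   <= s - v at z, while s - v < eta there. *)
have a0 : 0 < eta / X by rewrite divr_gt0.
have an : eta / X * (size rs)%:R < 1 by rewrite mulrAC ltr_pdivrMr// mul1r mulrC.
have cs' y : Om (Some y) -> cont_at s y.
  by move=> /sepz[d d0 sd]; exact: (cont_at_far_pot mA AK d0 sd).
have fs' y : Om (Some y) -> four_mean s y.
  by move=> /sepz[d d0 sd]; exact: (four_mean_far_pot mA AK d0 sd).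
have := perron_comparison cE cs' fs' phi_s (far_pot_far mA AK A2) pv a0 an c0 Ec Oz zrs.
rewrite -/X divfK ?gt_eqF//; move: Lv.
have := r1P _ zr1; rewrite ltr_norml => /andP[_ h].
case: (v (Some z)) => [p|//|//]; rewrite -EFinD lee_fin lte_fin /L.
by move: h; lra.
Qed.

Hypothesis EV : forall nu : probability (borelC R) R, supported_on E nu -> (V%:E <= energy nu)%E.
Hypotheses (muE : supported_on E mu) (muV : energy mu = V%:E).

Lemma regular_upot u : regular_compact E -> E u -> upot mu K u <= - V.
Proof.
move=> reg Eu; apply/ler_addgt0Pr => eta eta0.
have e30 : 0 < eta / 3 by rewrite divr_gt0.
have [r0' r00 loc] := regular_local_bound reg Eu e30.
pose r := Num.min 1 (r0' / 2); have r0 : 0 < r by rewrite lt_min ltr01 divr_gt0.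
have r1 : r <= 1 by rewrite ge_min lexx.
have rr' : r < r0' by rewrite gt_min (@ltr_pdivrMr _ 2 _ r0')// (ltr_pMr _ r00) ltr1n orbT.
apply: le_trans (upot_le_pot cK K0 M1 KM potK u r0) _.
have e90 : 0 < eta / 9 by rewrite divr_gt0.
have [rs [s0 rsU rsL]] := exists_small_polynomial cE M1 EM EV muE muV cK KE K0 r0 r1 Eu e90.
set n : R := (size rs)%:R in rsU rsL.
have n1 : 1 <= n by rewrite /n ler1n.
have n0 : 0 < n by exact: lt_le_trans n1.
(* The second eta/9 only makes the bound on E strict. The total loss is 3 (eta/9) + eta/3, below
   eta. *)
pose c := expR (n * (- V + eta / 9 + eta / 9)).
have c0 : 0 < c by exact: expR_gt0.
have Ec y : E y -> rprod rs y < c.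
  by move=> Ey; apply: le_lt_trans (rsU _ Ey) _; rewrite ltr_expR ltr_pM2l// ltrDl.
have J : maxprod r rs u <= expR (ln c + n * (eta / 3)).
  apply: (jensen_bound r0 rr') => rho rho0 rhor; exists 0 => N l N0 [sl lr _].
  rewrite addr0 expRM_natl expRD lnK// -sl.
  have -> : (c * expR (n * (eta / 3))) ^+ size l = \prod_(x <- l) (c * expR (n * (eta / 3))).
    by rewrite big_const_seq count_predT -Monoid.iteropE.
  rewrite !big_seq; apply: ler_prod => x xl; rewrite rprod_ge0/=.
  by apply: loc => //; rewrite addrC addKr lr.
have : n * (pot mu K r u - eta / 9) <= ln c + n * (eta / 3).
  by apply: le_trans rsL _; rewrite -[leRHS]expRK; apply: ln_le => //; exact: maxprod_gt0.
by rewrite /c expRK -mulrDr ler_pM2l//; lra.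
Qed.

End regular_points.

Lemma capacity_gt0 (R : realType) (E : set R[i]^o) (mu : probability (borelC R) R) :
  0 < capacity E -> equilibrium_measure E mu ->
  exists2 V, energy mu = V%:E & capacity E = expR (- V).
Proof.
rewrite /capacity => h [_ ->]; move: h.
(* At -oo the exponential is [+oo], which [fine] sends to 0, so positivity of the capacity excludes
   both infinite values. *)
by case: (robin_constant E) => [V _||] /=; [exists V|rewrite ltxx|rewrite ltxx].
Qed.

Theorem theorem3p1 (R : realType) (E : set R[i]^o) (hE : compact E)
    (hcap : 0 < capacity E) (mu : probability (borelC R) R)
    (hmu : equilibrium_measure E mu) :
  exists2 CE : R, is_min (factor_constants E) CE &
    (exists2 M : R,
       is_max [set expeR (\int[mu]_(z in [set z : R[i] | 1 <= cabs (z - u)]%R)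
                            log_dist z u)
              | u in boundary E] M%:E
       & CE = M / capacity E)
    /\
    (regular_compact E ->
       is_max [set expeR (- \int[mu]_(z in [set z : R[i] | cabs (z - u) <= 1]%R)
                              log_dist z u)%E
              | u in boundary E] CE%:E).
Proof.
have [V muV ->] := capacity_gt0 hcap hmu.
have [M0 M00 EM0] := compact_bounded_cabs hE.
pose M := Num.max 1 M0.
have M1 : 1 <= M by rewrite le_max lexx.
have EM z : E z -> cabs z <= M by move=> /EM0 h; rewrite le_max h orbT.
have EV (nu : probability (borelC R) R) : supported_on E nu -> (V%:E <= energy nu)%E.
  by move=> nuE; rewrite -muV hmu.2; apply: ereal_inf_lbound; exists nu.
have [K [cK KE K0 potK]] := frostman_carrier hE hmu muV.
have [u bu umax] := exists_extremal_point hE EM cK KE K0.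
exists (expR (V + pot mu K 1 u)).
  split; first exact: (extremal_factor_constant hE M1 EM cK KE K0 potK).
  by move=> C HC; exact: (extremal_lower hE M1 EM EV hmu.1 muV cK KE K0 (boundary_sub hE bu) HC).
have KM w : K w -> cabs w <= M by move=> /KE; exact: EM.
split.
  exists (expR (pot mu K 1 u)).
    split; first by exists u => //; rewrite (integral_far EM cK KE K0).
    by move=> _ [v bv <-]; rewrite (integral_far EM cK KE K0) lee_fin ler_expR umax.
  by rewrite expRN invrK -expRD addrC.
move=> reg; split.
  exists u => //; rewrite (integral_near M1 EM cK KE K0 potK).
  have h := regular_upot hE M1 EM cK KE K0 potK EV hmu.1 muV reg (boundary_sub hE bu).
  have := upot_ge cK K0 M1 KM potK u => h'.
  by congr (expR _)%:E; move: h h'; lra.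
(* At the other boundary points Frostman's bound [- V <= upot] is enough. The equality that
   regularity provides is used at u only. *)
move=> _ [v bv <-]; rewrite (integral_near M1 EM cK KE K0 potK) lee_fin ler_expR.
by have := umax _ bv; have := upot_ge cK K0 M1 KM potK v; lra.
Qed.
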